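(* Let $Y_V$ be a causal MCAR$(p)$ process with $\Sigma_L>0$ (positive definite). Then: (1) $Y_V$ has a spectral density matrix $f_{Y_VY_V}(\cdot)>0$ and there exists $0<\varepsilon<1$ such that $$f_{Y_AY_A}(\lambda)^{-1/2}f_{Y_AY_B}(\lambda)f_{Y_BY_B}(\lambda)^{-1}f_{Y_BY_A}(\lambda)f_{Y_AY_A}(\lambda)^{-1/2}\le_L(1-\varepsilon)I_\alpha$$ for almost all $\lambda\in\mathbb{R}$ and for all disjoint subsets $A,B\subseteq V$ with $\#A=\alpha$; (2) $Y_V$ is purely non-deterministic, i.e. $\bigcap_{t\in\mathbb{R}}\mathcal{L}_{Y_V}(t)=\{0\}$.
   Context: $V=\{1,\ldots,k\}$. For Hermitian matrices, $M\le_L N$ means $N-M$ is positive semi-definite; $f_{Y_AY_B}$ is the $A\times B$ block of $f_{Y_VY_V}$. $\mathcal{L}_{Y_V}(t)$ is the closed linear span in $L^2(\Omega,\mathcal F,\mathbb P)$ (complex-valued) of $\{Y_v(u):v\in V,u\le t\}$. Lévy process: $L=(L(t))_{t\in\mathbb{R}}$ is a two-sided $k$-dimensional Lévy process, i.e. $L(t)=L_1(t)$ for $t\ge0$ and $L(t)=-\lim_{s\nearrow-t}L_2(s)$ for $t<0$ with independent copies $L_1,L_2$ of a one-sided Lévy process ($L_i(0)=0$ a.s., stationary independent increments, càdlàg paths), with $\mathbb{E}L(1)=0$, $\mathbb{E}\|L(1)\|^2<\infty$ and $\Sigma_L=\mathbb{E}[L(1)L(1)^\top]$. Causal MCAR$(p)$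 process, $p\ge1$: let $A_1,\ldots,A_p\in\mathbb{R}^{k\times k}$ and let $\mathbf{A}\in\mathbb{R}^{kp\times kp}$ be the block companion matrix whose $i$-th block row, $i=1,\ldots,p-1$, has $I_k$ in block column $i+1$ and zeros otherwise, and whose last block row is $(-A_p,-A_{p-1},\ldots,-A_1)$; assume all eigenvalues of $\mathbf{A}$ have strictly negative real part. Let $\mathbf{B}^\top=(0_k,\ldots,0_k,I_k)\in\mathbb{R}^{k\times kp}$ and $\mathbf{C}=(I_k,0_k,\ldots,0_k)\in\mathbb{R}^{k\times kp}$. Then $Y_V(t)=\mathbf{C}X(t)$, where $X$ is the unique $kp$-dimensional stationary solution of $dX(t)=\mathbf{A}X(t)dt+\mathbf{B}dL(t)$, i.e. $X(t)=\int_{-\infty}^te^{\mathbf{A}(t-u)}\mathbf{B}\,dL(u)$. *)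

(* Defs.v *)
From HB Require Import structures.
From mathcomp Require Import all_boot all_order all_algebra.
From mathcomp Require Import spectral sesquilinear complex.
From mathcomp Require Import all_classical all_reals all_analysis.

Set Implicit Arguments.
Unset Strict Implicit.
Unset Printing Implicit Defensive.

Import Order.TTheory GRing.Theory Num.Theory numFieldNormedType.Exports.

Local Open Scope classical_set_scope.
Local Open Scope ring_scope.
Local Open Scope sesquilinear_scope.
Local Open Scope complex_scope.

Section HermitianMatrices.
Context {C : numClosedFieldType}.

Definition psdmx n (M : 'M[C]_n) : Prop :=
  M \is hermsymmx /\ forall x : 'cV[C]_n, 0 <= (x^t* *m M *m x) 0 0.

Definition posdefmx n (M : 'M[C]_n) : Prop :=
  M \is hermsymmx /\
  forall x : 'cV[C]_n, x != 0 -> 0 < (x^t* *m M *m x) 0 0.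

Definition loewner_le n (M N : 'M[C]_n) : Prop := psdmx (N - M).

(* The principal square root, read off the spectral decomposition
   M = U^-1 diag(d) U; it is the usual one when M is positive semi-definite. *)
Definition sqrtmx n (M : 'M[C]_n) : 'M[C]_n :=
  invmx (spectralmx M) *m diag_mx (map_mx (fun z : C => sqrtC z) (spectral_diag M))
    *m spectralmx M.

Definition blockmx k (M : 'M[C]_k) (A B : {set 'I_k}) : 'M[C]_(#|A|, #|B|) :=
  mxsub (fun i : 'I_#|A| => enum_val i) (fun j : 'I_#|B| => enum_val j) M.

End HermitianMatrices.

Section RealMatrices.
Context {R : realType}.

Definition frobsq m n (M : 'M[R]_(m, n)) : R := \sum_i \sum_j M i j ^+ 2.

Definition expmx n (M : 'M[R]_n) : 'M[R]_n :=
  \matrix_(i, j) limn (series (fun l : nat => (l`!%:R^-1 *: M ^+ l) i j)).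

Definition mxtoC m n (M : 'M[R]_(m, n)) : 'M[R[i]]_(m, n) :=
  map_mx (real_complex R) M.

(* [A j] stands for the autoregressive coefficient $A_{j+1}$, so that the entry
   in (0-based) column j of the last block row, $-A_{p-j}$, is
   [- A (rev_ord j)]. *)
Definition companion_mx k p (A : 'I_p -> 'M[R]_k) :
    'M[R]_(\sum_(i < p) k, \sum_(j < p) k) :=
  \mxblock_(i < p, j < p)
    (if i.+1 == p then - A (rev_ord j) else (j == i.+1 :> nat)%:R%:M).

Definition input_mx k p : 'M[R]_(\sum_(i < p) k, k) :=
  \mxcol_(i < p) ((i.+1 == p)%:R%:M : 'M[R]_k).

Definition output_mx k p : 'M[R]_(k, \sum_(j < p) k) :=
  \mxrow_(j < p) ((j == 0 :> nat)%:R%:M : 'M[R]_k).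

Definition cis (x : R) : R[i] := cos x +i* sin x.

Definition cintegrable (g : R -> R[i]) : Prop :=
  lebesgue_measure.-integrable setT (fun x => (complex.Re (g x))%:E) /\
  lebesgue_measure.-integrable setT (fun x => (complex.Im (g x))%:E).

Definition cintegral (g : R -> R[i]) : R[i] :=
  (\int[lebesgue_measure]_x complex.Re (g x)) +i*
  (\int[lebesgue_measure]_x complex.Im (g x)).

Definition borel_cV n : set (set 'cV[R]_n) :=
  g_sigma_preimage (fun (i : 'I_n) (x : 'cV[R]_n) => x i 0 : measurableTypeR R).

End RealMatrices.

Section Processes.
Context {R : realType} {d : measure_display} {T : measurableType d}.
Variable P : probability T R.

Definition random_vector n (Z : T -> 'cV[R]_n) : Prop :=
  forall B, borel_cV B -> measurable (Z @^-1` B).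

Definition same_law n (Z Z' : T -> 'cV[R]_n) : Prop :=
  forall B, borel_cV B -> P (Z @^-1` B) = P (Z' @^-1` B).

Definition independent_vectors (I : finType) n (Z : I -> T -> 'cV[R]_n) : Prop :=
  forall B : I -> set 'cV[R]_n, (forall i, borel_cV (B i)) ->
    P (\bigcap_(i in [set: I]) (Z i @^-1` B i)) =
    (\prod_(i : I) fine (P (Z i @^-1` B i)))%:E.

(* Equality in law of two processes indexed by D.  Measurable rectangles
   generate the product sigma-algebra and are stable under intersection. *)
Definition same_fdd (D : set R) n (Z Z' : R -> T -> 'cV[R]_n) : Prop :=
  forall m (t : 'I_m -> R) (B : 'I_m -> set 'cV[R]_n),
    (forall i, D (t i)) -> (forall i, borel_cV (B i)) ->
    P (\bigcap_(i in [set: 'I_m]) (Z (t i) @^-1` B i)) =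
    P (\bigcap_(i in [set: 'I_m]) (Z' (t i) @^-1` B i)).

Definition sigma_process (D : set R) n (Z : R -> T -> 'cV[R]_n) : set (set T) :=
  <<s [set E | exists t B, [/\ D t, borel_cV B & E = Z t @^-1` B]] >>.

Definition independent_processes (D : set R) n (Z Z' : R -> T -> 'cV[R]_n) :
    Prop :=
  forall E F, sigma_process D Z E -> sigma_process D Z' F ->
    P (E `&` F) = (P E * P F)%E.

Definition strictly_stationary n (Z : R -> T -> 'cV[R]_n) : Prop :=
  forall h, same_fdd setT Z (fun t => Z (t + h)).

Record one_sided_levy n (L : R -> T -> 'cV[R]_n) : Prop := {
  levy_rv : forall t, 0 <= t -> random_vector (L t) ;
  levy0 : {ae P, forall w, L 0 w = 0} ;
  levy_stationary : forall s h, 0 <= s -> 0 <= h ->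
    same_law (fun w => L (s + h) w - L s w) (fun w => L h w - L 0 w) ;
  levy_independent : forall m (t : nat -> R), 0 <= t 0%N ->
    {homo t : i j / (i <= j)%N >-> i <= j} ->
    independent_vectors (fun (i : 'I_m) w => L (t i.+1) w - L (t i) w) ;
  levy_rcont : forall w t, 0 <= t -> L s w @[s --> t^'+] --> L t w ;
  levy_llim : forall w t, 0 < t -> cvg (L s w @[s --> t^'-]) }.

Definition two_sided_levy n (L : R -> T -> 'cV[R]_n) : Prop :=
  exists L1 L2 : R -> T -> 'cV[R]_n,
    [/\ one_sided_levy L1, one_sided_levy L2,
        same_fdd [set t | 0 <= t] L1 L2,
        independent_processes [set t | 0 <= t] L1 L2 &
        forall t w, L t w =
          if 0 <= t then L1 t w else - lim (L2 s w @[s --> (- t)^'-])].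

Definition levy_cov n (L : R -> T -> 'cV[R]_n) : 'M[R]_n :=
  \matrix_(i, j) fine ('E_P[fun w => (L 1 w i 0 * L 1 w j 0)%R])%E.

(* A centred two-sided Levy process with finite second moments. *)
Definition driving_levy n (L : R -> T -> 'cV[R]_n) : Prop :=
  [/\ two_sided_levy L,
      (\int[P]_w (frobsq (L 1 w))%:E < +oo)%E &
      forall i, ('E_P[fun w => L 1%R w i 0%R] = 0)%E].

Definition step_fun k m n (a b : 'I_n -> R) (M : 'I_n -> 'M[R]_(m, k)) (u : R) :
    'M[R]_(m, k) :=
  \sum_(j < n) (a j < u <= b j)%R%:R *: M j.

Definition step_integral k m n (a b : 'I_n -> R) (M : 'I_n -> 'M[R]_(m, k))
    (L : R -> T -> 'cV[R]_k) (w : T) : 'cV[R]_m :=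
  \sum_(j < n) M j *m (L (b j) w - L (a j) w).

(* J is the integral over the real line of the deterministic square-integrable
   function f with respect to L: the extension by L2-continuity of
   [step_integral], which is well defined because the increments of L are
   centred and uncorrelated, with covariance (b - a) Sigma_L over ]a, b]. *)
Definition levy_integral k m (L : R -> T -> 'cV[R]_k) (f : R -> 'M[R]_(m, k))
    (J : T -> 'cV[R]_m) : Prop :=
  forall eps : R, 0 < eps ->
    exists (n : nat) (a b : 'I_n -> R) (M : 'I_n -> 'M[R]_(m, k)),
      [/\ forall j, a j <= b j,
          (\int[lebesgue_measure]_u
             (frobsq (f u - step_fun a b M u)%R)%:E < eps%:E)%E &
          (\int[P]_w
             (frobsq (J w - step_integral a b M L w)%R)%:E < eps%:E)%E].

(* dX(t) = F X(t) dt + G dL(t), in integrated form. *)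
Definition solves_sde k m (F : 'M[R]_m) (G : 'M[R]_(m, k))
    (L : R -> T -> 'cV[R]_k) (X : R -> T -> 'cV[R]_m) : Prop :=
  forall s t, s <= t -> {ae P, forall w,
    (forall i, lebesgue_measure.-integrable `[s, t]
                 (fun u => (X u w i 0)%:E)) /\
    X t w - X s w =
      \col_i (\int[lebesgue_measure]_(u in `[s, t]) (F *m X u w) i 0)
      + G *m (L t w - L s w)}.

(* The last two clauses determine the same process X, up to modification. *)
Record MCAR_state k m (F : 'M[R]_m) (G : 'M[R]_(m, k))
    (L : R -> T -> 'cV[R]_k) (X : R -> T -> 'cV[R]_m) : Prop := {
  state_rv : forall t, random_vector (X t) ;
  state_stationary : strictly_stationary X ;
  state_sde : solves_sde F G L X ;
  state_integral : forall t, levy_integral L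
    (fun u => if u <= t then expmx ((t - u) *: F) *m G else 0) (X t) }.

Definition causal_MCAR k p (A : 'I_p -> 'M[R]_k) (L Y : R -> T -> 'cV[R]_k) :
    Prop :=
  [/\ driving_levy L,
      forall z : R[i],
        eigenvalue (mxtoC (companion_mx A)) z -> complex.Re z < 0 &
      exists2 X : R -> T -> 'cV[R]_(\sum_(i < p) k),
        MCAR_state (companion_mx A) (input_mx k p) L X &
        forall t w, Y t w = output_mx k p *m X t w].

(* Y is wide-sense stationary and its autocovariance function is
   c(h) = Cov(Y(t + h), Y(t)) = \int e^{i lambda h} f(lambda) d lambda. *)
Record spectral_density k (Y : R -> T -> 'cV[R]_k) (f : R -> 'M[R[i]]_k) :
    Prop := {
  sd_rv : forall t, random_vector (Y t) ;
  sd_moment : forall t, (\int[P]_w (frobsq (Y t w))%:E < +oo)%E ;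
  sd_mean : forall t a, ('E_P[fun w => Y t w a 0%R] = 'E_P[fun w => Y 0%R w a 0%R])%E ;
  sd_integrable : forall a b, cintegrable (fun lam => f lam a b) ;
  sd_cov : forall a b t h,
    (fine (covariance P (fun w => Y (t + h) w a 0) (fun w => Y t w b 0)))%:C =
    cintegral (fun lam => cis (lam * h) * f lam a b) }.

Definition L2C (Z : T -> R[i]) : Prop :=
  [/\ measurable_fun setT (fun w => complex.Re (Z w)),
      measurable_fun setT (fun w => complex.Im (Z w)) &
      (\int[P]_w (Normc.normc (Z w) ^+ 2)%:E < +oo)%E].

(* The elements of L2 are represented by functions, so that this is the union
   of the classes belonging to the closed linear span. *)
Definition past_space k (Y : R -> T -> 'cV[R]_k) (t : R) : set (T -> R[i]) :=
  [set Z | L2C Z /\ forall eps : R, 0 < eps ->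
    exists (n : nat) (c : 'I_n -> R[i]) (v : 'I_n -> 'I_k) (u : 'I_n -> R),
      (forall j, u j <= t) /\
      (\int[P]_w (Normc.normc (Z w - \sum_(j < n)
          c j * (Y (u j) w (v j) 0)%:C)%R ^+ 2)%:E < eps%:E)%E].

Definition purely_nondeterministic k (Y : R -> T -> 'cV[R]_k) : Prop :=
  \bigcap_(t in [set: R]) past_space Y t =
  [set Z | L2C Z /\ {ae P, forall w, Z w = 0}].

End Processes.

(* Main.v *)
Require Import Defs.
From HB Require Import structures.
From mathcomp Require Import all_boot all_order all_algebra.
From mathcomp Require Import spectral sesquilinear complex.
From mathcomp Require Import all_classical all_reals all_analysis.
From mathcomp Require Import measurable_realfun ring lra.

Set Implicit Arguments.
Unset Strict Implicit.
Unset Printing Implicit Defensive.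

Import Order.TTheory GRing.Theory Num.Theory numFieldNormedType.Exports.

Local Open Scope classical_set_scope.
Local Open Scope ring_scope.
Local Open Scope sesquilinear_scope.

(** Notation: A, B, C are the companion, input and output matrices, e^(sA) decays
    exponentially because A is stable, and the state X(t) is the integral against
    L of the kernel that equals e^((t-u)A) B for u <= t and 0 for u > t.

    Second moments. The covariance of L(s) and L(t) is Sigma_L times the length of
    the overlap of the intervals from 0 to s and from 0 to t ([two_sided_gram]):
    the increments are independent and stationary, so means and variances are
    additive in time; right-continuity of the paths forces the means to vanish, and
    covariances, being additive and of linear growth, are linear. Hence integrals of step
    functions, and by continuity all integrals against L, obey the isometry
    E[J J'] = sum_(q, q') Sigma_(q q') <f_q, f'_q'> ([wiener_isometry]).

    Spectral density. By the isometry Cov(X(t + h), X(t)) = e^(hA) G for h >= 0, where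
    G is the integral of e^(sA) B Sigma_L B^T e^(sA)^T over s >= 0, which solves the
    Lyapunov equation A G + G A^T = - B Sigma_L B^T. The Fourier transform of this
    covariance is R G + G R^* with R = (i l - A)^-1, the half-line transform of
    e^(sA); the Lyapunov equation turns it into R B Sigma_L B^T R^*
    ([spectral_factorization]). So the candidate for the density is
    f = H Sigma_L H^* / (2 pi) with H = C R B. Since R = O(1 / (1 + |l|)), it is
    integrable, and inversion of the Fourier transform at the origin, obtained by
    Abel-Poisson summation ([fourier_inversion0]) and applied to translates of the
    autocovariance, shows that it represents the autocovariance ([specdens_cov]).

    Coherence. The block rows of (i l - A) R B = B give P(i l) H = I for the
    autoregressive polynomial P ([ar_transfer]), whence f > 0. Moreover P = O(1 + |l|^p)
    and H = O(1 / (1 + |l|^p)), so the largest and the smallest value of the form of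
    f(l) on unit vectors are both of the exact order (1 + |l|^p)^-2 and their ratio
    is bounded, uniformly in l. A Schur complement is bounded below by the smallest
    value, and this bounds the coherence by 1 - m / M, where m and M are lower and
    upper bounds of the form ([coherence_le]).

    Remote past. A variable Z in the past of every t is orthogonal to the increments
    of L over ]a, b], because it belongs to the past of a, which is orthogonal to
    them. As every Y(u) is a limit of combinations of increments, Z is orthogonal to
    the variables Y(u), and therefore to itself ([remote_past0]). *)

(** * Hermitian forms and the coherence bound *)

Section HermitianForms.
Context {C : numClosedFieldType}.

Definition sqn n (x : 'cV[C]_n) : C := (x^t* *m x) 0 0.

Lemma adjM m n q (A : 'M[C]_(m, n)) (B : 'M[C]_(n, q)) :
  (A *m B)^t* = B^t* *m A^t*.
Proof. by rewrite trmx_mul map_mxM. Qed.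

Lemma adjK m n (A : 'M[C]_(m, n)) : A^t*^t* = A.
Proof. by rewrite map_trmx trmxK map_mxCK. Qed.

Lemma adj1 n : 1%:M^t* = 1%:M :> 'M[C]_n.
Proof. by apply/matrixP => i j; rewrite !mxE eq_sym; case: eqP; rewrite ?conjC1 ?conjC0. Qed.

Lemma hermsymmxE n (M : 'M[C]_n) : (M \is hermsymmx) = (M^t* == M).
Proof.
by rewrite is_hermitianmxE expr0 scale1r eq_sym.
Qed.

Lemma adj_inv n (M : 'M[C]_n) : (invmx M)^t* = invmx (M^t*).
Proof. by rewrite trmx_inv map_invmx. Qed.

Lemma sqnE n (x : 'cV[C]_n) : sqn x = \sum_i `|x i 0| ^+ 2.
Proof. by rewrite /sqn mxE; apply: eq_bigr => i _; rewrite !mxE normCKC. Qed.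

Lemma sqn_ge0 n (x : 'cV[C]_n) : 0 <= sqn x.
Proof. by rewrite sqnE sumr_ge0 // => i _; rewrite exprn_ge0. Qed.

Lemma form_mul m n (E : 'M[C]_(m, n)) (M : 'M[C]_m) (x : 'cV[C]_n) :
  x^t* *m (E^t* *m M *m E) *m x = (E *m x)^t* *m M *m (E *m x).
Proof. by rewrite adjM !mulmxA. Qed.

Lemma hermsym_congr m n (E : 'M[C]_(m, n)) (M : 'M[C]_m) :
  M \is hermsymmx -> E^t* *m M *m E \is hermsymmx.
Proof.
by rewrite !hermsymmxE => /eqP hM; rewrite !adjM adjK hM mulmxA.
Qed.

(** A vector of the kernel would have value 0 under the form. *)
Lemma posdefmx_unit n (M : 'M[C]_n) : posdefmx M -> M \in unitmx.
Proof.
move=> [_ hM]; rewrite -unitmx_tr -row_free_unit -kermx_eq0; apply/eqP/row_matrixP => i; rewrite row0.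
apply/eqP/negP => /negP hi.
have /hM : (row i (kermx M^T))^T != 0.
  by apply: contra hi => /eqP h; rewrite -[row _ _]trmxK h trmx0.
have -> : (row i (kermx M^T))^T^t* *m M *m (row i (kermx M^T))^T = 0.
  rewrite -mulmxA (_ : M *m _ = 0) ?mulmx0 //; apply: trmx_inj.
  by rewrite trmx_mul trmxK -row_mul mulmx_ker row0 trmx0.
by rewrite mxE ltxx.
Qed.

Lemma posdef_congr m n (E : 'M[C]_(m, n)) (M : 'M[C]_m) :
  (forall x : 'cV_n, E *m x = 0 -> x = 0) -> posdefmx M ->
  posdefmx (E^t* *m M *m E).
Proof.
move=> E0 [hM pM]; split; first exact: hermsym_congr.
move=> x x0; rewrite form_mul pM //; apply: contra x0 => /eqP/E0 ->.
exact: eqxx.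
Qed.

(** In the spectral basis the eigenvalues are values of the form, hence
   nonnegative, so that their square roots are real and the diagonal matrix of
   these roots is hermitian. *)
Lemma sqrtmxP n (M : 'M[C]_n) : posdefmx M ->
  [/\ sqrtmx M \is hermsymmx, sqrtmx M *m sqrtmx M = M & sqrtmx M \in unitmx].
Proof.
move=> pM; case: (pM) => hM qM.
have eM := hM; move/hermitian_normalmx/orthomx_spectralP : eM => eM.
set U := spectralmx M in eM *; set dd := spectral_diag M in eM *.
have uU : U \in unitmx by exact: spectral_unit.
have iU : invmx U = U^t* by rewrite invmx_unitary // spectral_unitarymx.
have UU : U *m U^t* = 1%:M by rewrite -iU mulmxV.
(* the i-th eigenvalue is the value of the form at the i-th eigenvector *)
have dd0 i : 0 <= dd 0 i.
  pose v : 'cV_n := U^t* *m (delta_mx i 0 : 'cV_n).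
  have -> : dd 0 i = (v^t* *m M *m v) 0 0.
    rewrite /v eM iU adjM adjK !mulmxA -[_ *m U *m U^t*]mulmxA UU mulmx1.
    rewrite -[_ *m U *m U^t*]mulmxA UU mulmx1.
    rewrite -mulmxA mxE (bigD1 i) //= big1 ?addr0; last first.
      by move=> j ji; rewrite !mxE (negbTE ji) conjC0 mul0r.
    rewrite !mxE !eqxx conjC1 mul1r (bigD1 i) //= big1 ?addr0; last first.
      by move=> j ji; rewrite !mxE (negbTE ji) mulr0.
    by rewrite !mxE !eqxx mulr1n mulr1.
  case: (eqVneq v 0) => [->|/qM/ltW //].
  by rewrite mulmx0 mxE.
set D := diag_mx (map_mx (fun z : C => sqrtC z) dd).
have eS : sqrtmx M = U^t* *m D *m U by rewrite /sqrtmx -/U -/dd iU.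
have hD : D^t* = D.
  apply/matrixP => i j; rewrite !mxE eq_sym.
  case: eqVneq => [->|]; last by rewrite !mulr0n conjC0.
  by rewrite !mulr1n; apply: CrealP; rewrite ger0_real ?sqrtC_ge0.
have SS : sqrtmx M *m sqrtmx M = M.
  rewrite eS [RHS]eM iU !mulmxA -[_ *m U *m U^t*]mulmxA UU mulmx1.
  congr (_ *m _); rewrite -!mulmxA; congr (_ *m _).
  apply/matrixP => i j; rewrite !mxE (bigD1 i) //= big1 ?addr0; last first.
    by move=> k ki; rewrite !mxE eq_sym (negbTE ki) mulr0n mul0r.
  rewrite !mxE eqxx mulr1n; case: eqVneq => [->|]; last by rewrite !mulr0n mulr0.
  by rewrite !mulr1n -expr2 sqrtCK.
split => //; last first.
  have := posdefmx_unit pM; rewrite -{1}SS unitmx_mul => /andP[] //.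
by rewrite eS hermsymmxE !adjM adjK hD mulmxA.
Qed.


(** Double both sides and sum 2 a b <= a ^ 2 + b ^ 2 over all pairs. *)
Lemma norm_sum_sqr (I : finType) (z : I -> C) :
  `|\sum_i z i| ^+ 2 <= #|I|%:R * \sum_i `|z i| ^+ 2.
Proof.
apply: (@le_trans _ _ ((\sum_i `|z i|) ^+ 2)).
  by rewrite lerXn2r ?nnegrE ?sumr_ge0 // ler_norm_sum.
rewrite expr2 mulr_suml.
under eq_bigr do rewrite mulr_sumr.
rewrite -(ler_pM2l (ltr0Sn C 1)) [leLHS]mulr_sumr.
apply: (@le_trans _ _ (\sum_i \sum_j (`|z i| ^+ 2 + `|z j| ^+ 2))).
  apply: ler_sum => i _; rewrite mulr_sumr; apply: ler_sum => j _.
  rewrite -subr_ge0 (_ : _ - _ = (`|z i| - `|z j|) ^+ 2); last by ring.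
  by rewrite real_exprn_even_ge0 // rpredB // normr_real.
under eq_bigr do rewrite big_split /= sumr_const.
rewrite big_split /= sumr_const sumrMnl.
by rewrite mulr_natl [X in _ <= X *+ 2]mulr_natl [leRHS]mulr2n.
Qed.

(** Entrywise bounds are all that is known about the matrices below; the
   dimension factor is harmless because it is constant in the frequency. *)
Lemma sqn_mul_le m n (N : 'M[C]_(m, n)) (K : C) (x : 'cV[C]_n) :
  (forall i j, `|N i j| <= K) ->
  sqn (N *m x) <= (m * n)%:R * K ^+ 2 * sqn x.
Proof.
move=> hN; rewrite [leLHS]sqnE.
apply: (@le_trans _ _ (\sum_(i < m) n%:R * (K ^+ 2 * sqn x))); last first.
  by rewrite sumr_const card_ord -[leLHS]mulr_natl natrM !mulrA.
apply: ler_sum => i _; rewrite mxE.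
apply: (le_trans (norm_sum_sqr _)); rewrite card_ord ler_wpM2l ?ler0n //.
rewrite sqnE mulr_sumr; apply: ler_sum => j _.
rewrite normrM exprMn ler_wpM2r ?exprn_ge0 //.
by rewrite lerXn2r ?nnegrE // (le_trans _ (hN i j)).
Qed.

Lemma mx_entry_bound m n (N : 'M[C]_(m, n)) :
  exists2 K : C, 0 < K & forall i j, `|N i j| <= K.
Proof.
exists (1 + \sum_i \sum_j `|N i j|).
  by rewrite ltr_pwDl // sumr_ge0 // => i _; rewrite sumr_ge0.
move=> i j; rewrite (bigD1 i) //= (bigD1 j) //=.
rewrite addrCA -!addrA lerDl.
by rewrite !addr_ge0 // ?sumr_ge0 // => k _; rewrite sumr_ge0.
Qed.

(** The inverse of the square root S of M is bounded, and the form is the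
   squared norm of S x. *)
Lemma posdef_lower_bound n (M : 'M[C]_n) : posdefmx M ->
  exists2 s : C, 0 < s & forall x, s * sqn x <= (x^t* *m M *m x) 0 0.
Proof.
move=> /sqrtmxP[]; set S := sqrtmx M; rewrite hermsymmxE => /eqP hS SS uS.
have [K K0 hK] := mx_entry_bound (invmx S).
have Kn : 0 < 1 + (n * n)%:R * K ^+ 2.
  by rewrite ltr_pwDl // mulr_ge0 ?ler0n // exprn_ge0 // ltW.
exists (1 + (n * n)%:R * K ^+ 2)^-1; first by rewrite invr_gt0.
move=> x; rewrite ler_pdivrMl //.
have -> : (x^t* *m M *m x) 0 0 = sqn (S *m x) by rewrite /sqn adjM hS -SS !mulmxA.
rewrite -{1}[x](mulKmx uS).
apply: (le_trans (sqn_mul_le _ hK)); apply: ler_wpM2r; first exact: sqn_ge0.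
by rewrite lerDr.
Qed.

(** The isometric inclusion of the coordinates of A into all coordinates;
   compression by it turns blocks of M into congruences of M. *)
Definition selmx k (A : {set 'I_k}) : 'M[C]_(k, #|A|) :=
  \matrix_(i, j) (i == enum_val j)%:R.

Lemma blockmxE k (M : 'M[C]_k) (A B : {set 'I_k}) :
  blockmx M A B = (selmx A)^t* *m M *m selmx B.
Proof.
apply/matrixP => i j; rewrite !mxE (bigD1 (enum_val j)) //= big1 ?addr0; last first.
  by move=> l lj; rewrite [X in _ * X]mxE (negbTE lj) mulr0.
rewrite [X in _ * X]mxE eqxx mulr1 mxE (bigD1 (enum_val i)) //= big1 ?addr0.
  by rewrite !mxE eqxx conjC1 mul1r.
by move=> l li; rewrite !mxE (negbTE li) conjC0 mul0r.
Qed.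

Lemma selmx_adj k (A B : {set 'I_k}) :
  (selmx A)^t* *m selmx B = blockmx 1%:M A B.
Proof. by rewrite blockmxE mulmx1. Qed.

Lemma selmx_ortho k (A : {set 'I_k}) : (selmx A)^t* *m selmx A = 1%:M.
Proof.
rewrite selmx_adj; apply/matrixP => i j; rewrite !mxE.
by rewrite (inj_eq enum_val_inj).
Qed.

Lemma selmx_disj k (A B : {set 'I_k}) : [disjoint A & B]%B ->
  (selmx A)^t* *m selmx B = 0.
Proof.
move=> AB; rewrite selmx_adj; apply/matrixP => i j; rewrite !mxE.
case: eqP => // e; have := disjointFr AB (enum_valP i).
by rewrite e enum_valP.
Qed.

Lemma selmx_inj k (A : {set 'I_k}) (x : 'cV_(#|A|)) : selmx A *m x = 0 -> x = 0.
Proof.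
by move=> /(congr1 (fun y => (selmx A)^t* *m y)); rewrite mulmxA selmx_ortho mul1mx mulmx0.
Qed.

(** Regrouping that exposes the product of two inclusions. *)
Lemma mulmx_mid m1 m2 m3 m4 m5 (a : 'M[C]_(m1, m2)) (b : 'M[C]_(m2, m3))
    (c : 'M[C]_(m3, m4)) (e : 'M[C]_(m4, m5)) :
  a *m b *m (c *m e) = a *m (b *m c) *m e.
Proof. by rewrite !mulmxA. Qed.

(** Put y = F_AA^(-1/2) x. The claim says that e y^* F_AA y is at most the Schur
   complement y^* (F_AA - F_AB F_BB^-1 F_BA) y. The latter equals z^* F z for
   z = (y, - F_BB^-1 F_BA y), whose norm is at least that of y; hence it is at
   least m |y|^2, while F_AA is at most M on the coordinates of A. *)
Lemma coherence_le k (F : 'M[C]_k) (m M e : C) (A B : {set 'I_k}) :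
  posdefmx F -> 0 < m -> 0 < M -> e <= m / M ->  e \is Num.real ->
  (forall x, m * sqn x <= (x^t* *m F *m x) 0 0) ->
  (forall x, (x^t* *m F *m x) 0 0 <= M * sqn x) ->
  [disjoint A & B]%B ->
  loewner_le
     (invmx (sqrtmx (blockmx F A A)) *m blockmx F A B *m invmx (blockmx F B B)
        *m blockmx F B A *m invmx (sqrtmx (blockmx F A A)))
     ((1 - e)%:M).
Proof.
move=> pF m0 M0 em eR hm hM AB.
have pA : posdefmx (blockmx F A A).
  by rewrite blockmxE; apply: posdef_congr => // x; exact: selmx_inj.
have pB : posdefmx (blockmx F B B).
  by rewrite blockmxE; apply: posdef_congr => // x; exact: selmx_inj.
have uB := posdefmx_unit pB.
have [hS SS uS] := sqrtmxP pA.
have hF : F^t* = F by apply/eqP; rewrite -hermsymmxE; case: pF.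
have hBA : (blockmx F A B)^t* = blockmx F B A.
  by rewrite !blockmxE !adjM adjK hF mulmxA.
have hB : (blockmx F B B)^t* = blockmx F B B.
  by rewrite blockmxE !adjM adjK hF mulmxA.
have hA : (blockmx F A A)^t* = blockmx F A A.
  by rewrite blockmxE !adjM adjK hF mulmxA.
set S := sqrtmx _ in hS SS uS *.
rewrite hermsymmxE in hS; move/eqP in hS.
set FAA := blockmx F A A in pA hA SS *; set FAB := blockmx F A B in hBA *.
set FBB := blockmx F B B in pB uB hB *; set FBA := blockmx F B A in hBA *.
set G := FAB *m invmx FBB *m FBA.
have -> : invmx S *m FAB *m invmx FBB *m FBA *m invmx S
    = (invmx S)^t* *m G *m invmx S by rewrite adj_inv hS /G !mulmxA.
have hG : G^t* = G by rewrite /G !adjM adj_inv hB hBA -hBA adjK mulmxA.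
split.
  rewrite hermsymmxE; apply/eqP.
  rewrite linearB /= map_mxB /= tr_scalar_mx map_scalar_mx /=.
  rewrite (adjM _ (invmx S)) (adjM _ G) adjK hG mulmxA; congr (_%:M - _).
  by apply: CrealP; rewrite rpredB // rpred1.
move=> x; set y := invmx S *m x.
have xx : x = S *m y by rewrite /y mulKVmx.
have -> : (x^t* *m ((1 - e)%:M - (invmx S)^t* *m G *m invmx S) *m x) 0 0 =
   (y^t* *m FAA *m y) 0 0 - e * (y^t* *m FAA *m y) 0 0 - (y^t* *m G *m y) 0 0.
  rewrite mulmxBr mulmxBl mxE [X in _ + X]mxE form_mul -/y; congr (_ - _).
  rewrite mul_mx_scalar -scalemxAl mxE xx adjM hS -SS !mulmxA.
  by rewrite -!mulmxA mulrBl mul1r.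
(* the minimizer of the form over the coordinates of B, when those of A are y *)
clearbody y; pose w : 'cV_(#|B|) := - (invmx FBB *m FBA *m y).
pose z : 'cV_k := selmx A *m y + selmx B *m w.
have zadj : z^t* = y^t* *m (selmx A)^t* + w^t* *m (selmx B)^t*.
  by rewrite /z linearD /= map_mxD !adjM.
have zz : sqn z = sqn y + sqn w.
  rewrite /sqn zadj /z mulmxDl !mulmxDr.
  rewrite !(mulmx_mid _ _ _ y) !(mulmx_mid _ _ _ w) !selmx_ortho !selmx_disj //; last by rewrite disjoint_sym.
  rewrite !mulmx1 !mulmx0 !mul0mx addr0 add0r.
  by rewrite mxE.
have zFz : z^t* *m F *m z = y^t* *m FAA *m y - y^t* *m G *m y.
  have -> : z^t* *m F *m z = y^t* *m FAA *m y + y^t* *m FAB *m w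
     + (w^t* *m FBA *m y + w^t* *m FBB *m w).
    by rewrite zadj /z !(mulmxDl, mulmxDr) /FAA /FAB /FBA /FBB !blockmxE !mulmxA addrACA addrA.
  have -> : y^t* *m FAB *m w = - (y^t* *m G *m y) by rewrite /w /G !mulmxN !mulmxA.
  have -> : w^t* *m FBB *m w = - (w^t* *m FBA *m y).
    by rewrite {2}/w mulmxN -!mulmxA mulKVmx.
  by rewrite subrr addr0.
have : e * (y^t* *m FAA *m y) 0 0 <= m * sqn z.
  have y1 : (y^t* *m FAA *m y) 0 0 <= M * sqn y.
    rewrite /FAA blockmxE form_mul; apply: (le_trans (hM _)).
    by rewrite ler_wpM2l ?(ltW M0) // /sqn adjM !mulmxA -[_ *m _ *m selmx A]mulmxA selmx_ortho mulmx1.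
  have y0 : 0 <= (y^t* *m FAA *m y) 0 0.
    case: (eqVneq y 0) => [->|/pA.2/ltW //]; first by rewrite mulmx0 mxE.
  apply: (@le_trans _ _ (m / M * (M * sqn y))).
    apply: (@le_trans _ _ (m / M * (y^t* *m FAA *m y) 0 0)).
      exact: ler_wpM2r.
    by apply: ler_wpM2l => //; rewrite divr_ge0 // ltW.
  rewrite mulrA divfK ?gt_eqF //; apply: ler_wpM2l; first exact: ltW.
  by rewrite zz lerDl sqn_ge0.
move=> /le_trans/(_ (hm z)); rewrite zFz => h; move: h.
have e2 (X Z : 'M[C]_1) : (X - Z) 0 0 = X 0 0 - Z 0 0 by rewrite !mxE.
rewrite e2 => h.
by rewrite addrAC subr_ge0.
Qed.
End HermitianForms.

(** * The matrix exponential *)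

Section MatrixExponential.
Context {R : realType}.

(** The rules of differentiation are restated for functions in applied form, as
   they occur in entries of matrix products. *)
Lemma is_derive_bigsum n (h : 'I_n -> R -> R) (dh : 'I_n -> R) (x : R) :
  (forall i, is_derive x (1 : R) (h i) (dh i)) ->
  is_derive x (1 : R) (fun x => \sum_(i < n) h i x) (\sum_(i < n) dh i).
Proof.
move=> H; have := @is_derive_sum R R R n h x 1 dh H.
by rewrite (_ : \sum_(i < n) h i = (fun x => \sum_(i < n) h i x)) // funeqE => y; rewrite fct_sumE.
Qed.

Lemma is_derive_mul (f g : R -> R) (x df dg : R) :
  is_derive x (1 : R) f df -> is_derive x (1 : R) g dg ->
  is_derive x (1 : R) (fun x => f x * g x) (df * g x + f x * dg).
Proof.
move=> hf hg; have := is_deriveM hf hg.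
by move=> H; apply: is_derive_eq; rewrite addrC [g x *: _]mulrC.
Qed.

Lemma is_derive_cmul (c : R) (f : R -> R) (x df : R) :
  is_derive x (1 : R) f df -> is_derive x (1 : R) (fun x => c * f x) (c * df).
Proof. by move=> hf; have := is_deriveZ c hf. Qed.

Lemma is_derive_addf (f g : R -> R) (x df dg : R) :
  is_derive x (1 : R) f df -> is_derive x (1 : R) g dg ->
  is_derive x (1 : R) (fun x => f x + g x) (df + dg).
Proof. by move=> hf hg; have := is_deriveD hf hg. Qed.

Lemma is_derive_affine (f : R -> R) (a b x df : R) :
  is_derive (a * x + b) (1 : R) f df ->
  is_derive x (1 : R) (fun x => f (a * x + b)) (a * df).
Proof.
move=> hf; have hg : is_derive x (1 : R) (fun x : R => a * x + b) a.
  have := is_derive_addf (is_derive_cmul a (is_derive_id x 1)) (is_derive_cst b x 1).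
  by rewrite mulr1 addr0.
by have := @is_derive1_comp R f (fun x => a * x + b) x df a hf hg; rewrite mulrC.
Qed.

Lemma derive_expRZ (c s : R) :
  is_derive s (1 : R) (fun s => expR (c * s)) (c * expR (c * s)).
Proof.
have := @is_derive_affine expR c 0 s _ (is_derive_expR _).
by rewrite addr0 (_ : (fun x => expR (c * x + 0)) = fun s => expR (c * s)) //; apply/funext => x; rewrite addr0.
Qed.

Lemma is_derive_continuous (f : R -> R) (df : R -> R) :
  (forall x, is_derive x (1 : R) f (df x)) -> continuous f.
Proof.
by move=> H x; apply/differentiable_continuous/derivable1_diffP; case: (H x).
Qed.

Lemma cvg_bigsum (T : Type) (F : set_system T) (FF : Filter F) (I : finType)
    (u : I -> T -> R) (l : I -> R) :
  (forall i, u i x @[x --> F] --> l i) ->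
  (\sum_i u i x) @[x --> F] --> \sum_i l i.
Proof.
by move=> H; apply: cvg_big => //; exact: add_continuous.
Qed.

(** The exponential generating function of u; entries of N e^(sA) are such series
   in s, with u l the entry of N A^l, and differentiation shifts u. *)
Definition egf (u : nat -> R) (x : R) : R :=
  limn (pseries (fun l => l`!%:R^-1 * u l) x).

(** Comparison with the exponential series at b |x|. *)
Lemma egf_cvg (u : nat -> R) (K b x : R) : 0 <= K -> 0 <= b ->
  (forall l, `|u l| <= K * b ^+ l) ->
  cvgn (pseries (fun l => l`!%:R^-1 * u l) x).
Proof.
move=> K0 b0 hu; apply: normed_cvg.
apply: (@series_le_cvg _ _ (fun l => K * exp_coeff (b * `|x|) l)).
- by move=> l; exact: normr_ge0.
- by move=> l; rewrite mulr_ge0 // /exp_coeff /= divr_ge0 // exprn_ge0 // mulr_ge0.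
- move=> l; rewrite /exp_coeff /= !normrM normrX exprMn.
  rewrite [`|l`!%:R^-1|]ger0_norm ?invr_ge0 //.
  rewrite mulrAC [leRHS]mulrA [leRHS]mulrC -[leLHS]mulrA ler_wpM2l ?invr_ge0 //.
  by rewrite mulrC [leRHS]mulrA; apply: ler_wpM2r; rewrite ?exprn_ge0.
- by have := @is_cvg_seriesZ _ _ K (@is_cvg_series_exp_coeff R (b * `|x|)).
Qed.

Lemma egf_derive (u : nat -> R) (K b x : R) : 0 <= K -> 0 <= b ->
  (forall l, `|u l| <= K * b ^+ l) ->
  is_derive x (1 : R) (egf u) (egf (fun l => u l.+1) x).
Proof.
move=> K0 b0 hu.
have e (v : nat -> R) : pseries_diffs (fun l => l`!%:R^-1 * v l) = (fun l => l`!%:R^-1 * v l.+1).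
  apply/funext => l; rewrite /pseries_diffs mulrA; congr (_ * _).
  by rewrite factS natrM invfM mulVKf // pnatr_eq0.
have sh m : forall l, `|u (l + m)%N| <= (K * b ^+ m) * b ^+ l.
  by move=> l; rewrite -mulrA -exprD addnC.
have s1 : forall l, `|u l.+1| <= (K * b) * b ^+ l.
  by move=> l; rewrite -addn1; have := sh 1%N l; rewrite expr1.
have s2 : forall l, `|u l.+2| <= (K * b ^+ 2) * b ^+ l.
  by move=> l; rewrite -addn2; have := sh 2%N l.
rewrite /egf -(e u); apply: (@pseries_snd_diffs _ _ (`|x| + 1)).
- exact: (@egf_cvg _ K b).
- by rewrite e; apply: (@egf_cvg _ (K * b) b) => //; rewrite mulr_ge0.
- by rewrite !e; apply: (@egf_cvg _ (K * b ^+ 2) b) => //; rewrite mulr_ge0 // exprn_ge0.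
- by rewrite [ltRHS]ger0_norm // ltrDl.
Qed.

Variables (n : nat) (A : 'M[R]_n).

Definition expt (s : R) : 'M[R]_n := expmx (s *: A).

Lemma mxpow_bound : exists2 b : R, 0 <= b & forall l i j, `|(A ^+ l) i j| <= b ^+ l.
Proof.
pose K := \sum_i \sum_j `|A i j|.
have hK i j : `|A i j| <= K.
  rewrite /K (bigD1 i) //= (bigD1 j) //= -addrA lerDl.
  by rewrite addr_ge0 // ?sumr_ge0 // => k _; rewrite sumr_ge0.
have K0 : 0 <= K by rewrite sumr_ge0 // => i _; rewrite sumr_ge0.
exists (n%:R * K); first by rewrite mulr_ge0.
elim=> [|l IH] i j.
  by rewrite !expr0 mxE; case: eqP => _ ; rewrite ?mulr1n ?mulr0n ?normr1 ?normr0.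
rewrite exprS -mulmxE mxE; apply: (le_trans (ler_norm_sum _ _ _)).
apply: (@le_trans _ _ (\sum_(k < n) K * (n%:R * K) ^+ l)).
  by apply: ler_sum => k _; rewrite normrM ler_pM.
by rewrite sumr_const card_ord -[leLHS]mulr_natl exprS mulrA.
Qed.

Lemma expr_scalemx (s : R) l : (s *: A) ^+ l = s ^+ l *: A ^+ l.
Proof.
elim: l => [|l IH]; first by rewrite !expr0 scale1r.
by rewrite !exprS IH -!mulmxE -scalemxAl -scalemxAr scalerA.
Qed.

Lemma exptE s i j : expt s i j = egf (fun l => (A ^+ l) i j) s.
Proof.
rewrite mxE /egf /pseries; congr (limn _); apply/funext => m.
rewrite /series /=; apply: eq_bigr => l _.
by rewrite expr_scalemx !mxE mulrCA mulrC.
Qed.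

Lemma expt_mulE m (N : 'M[R]_(m, n)) s i j :
  (N *m expt s) i j = egf (fun l => (N *m A ^+ l) i j) s.
Proof.
have [b b0 hb] := mxpow_bound.
rewrite mxE; under eq_bigr do rewrite exptE.
symmetry; rewrite {1}/egf; apply: cvg_lim => //.
rewrite (_ : pseries _ s = fun M : nat =>
   \sum_k N i k * pseries (fun l => l`!%:R^-1 * (A ^+ l) k j) s M); last first.
  apply/funext => M; rewrite /pseries /series /=.
  under [RHS]eq_bigr do rewrite mulr_sumr.
  rewrite exchange_big /=; apply: eq_bigr => l _.
  rewrite mxE mulr_sumr mulr_suml; apply: eq_bigr => k _.
  by rewrite !mulrA [N i k * _]mulrC.
apply: cvg_bigsum => k; apply: cvgMl_tmp.
apply: (@egf_cvg _ 1 b) => // l; first by rewrite mul1r.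
Qed.

Lemma expt_mul_derive m (N : 'M[R]_(m, n)) (s : R) i j :
  is_derive s (1 : R) (fun s => (N *m expt s) i j) ((N *m A *m expt s) i j).
Proof.
have [b b0 hb] := mxpow_bound.
rewrite expt_mulE (_ : (fun s => _) = egf (fun l => (N *m A ^+ l) i j)); last first.
  by apply/funext => t; rewrite expt_mulE.
rewrite (_ : (fun l => (N *m A *m A ^+ l) i j) = (fun l => (N *m A ^+ l.+1) i j)).
  apply: (@egf_derive _ (\sum_k `|N i k|) b) => //; first by rewrite sumr_ge0.
  move=> l; rewrite mxE; apply: (le_trans (ler_norm_sum _ _ _)).
  by rewrite mulr_suml; apply: ler_sum => k _; rewrite normrM ler_pM.
by apply/funext => l; rewrite exprS -mulmxE mulmxA.
Qed.

Lemma expt_derive (s : R) i j :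
  is_derive s (1 : R) (fun s => expt s i j) ((A *m expt s) i j).
Proof.
have := expt_mul_derive 1%:M s i j; rewrite mul1mx.
by rewrite (_ : (fun s => (1%:M *m expt s) i j) = (fun s => expt s i j)) //; apply/funext => t; rewrite mul1mx.
Qed.

Lemma expt0 : expt 0 = 1%:M.
Proof.
apply/matrixP => i j; rewrite exptE /egf; apply: cvg_lim => //.
rewrite (_ : 1%:M i j = (0`!)%:R^-1 * (A ^+ 0) i j); last first.
  by rewrite expr0 fact0 invr1 mul1r.
apply: (@cvg_near_cst _ _ _ _ _ _); near=> M.
have M0 : (0 < M)%N by near: M; exists 1%N.
rewrite /pseries /series /= -(prednK M0) big_nat_recl //= expr0 mulr1 big1 ?addr0 //.
by move=> l _; rewrite expr0n mulr0.
Unshelve. all: by end_near. Qed.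

Lemma expt_comm s : A *m expt s = expt s *m A.
Proof.
apply/matrixP => i j; rewrite expt_mulE [RHS]mxE.
have [b b0 hb] := mxpow_bound.
under [RHS]eq_bigr do rewrite exptE.
rewrite /egf; apply: cvg_lim => //.
rewrite (_ : pseries _ s = fun M : nat =>
   \sum_k pseries (fun l => l`!%:R^-1 * (A ^+ l) i k) s M * A k j); last first.
  apply/funext => M; rewrite /pseries /series /=.
  under [RHS]eq_bigr do rewrite mulr_suml.
  rewrite exchange_big /=; apply: eq_bigr => l _.
  rewrite mulmxE -exprS exprSr -mulmxE mxE mulr_sumr mulr_suml; apply: eq_bigr => k _.
  by rewrite !mulrA mulrAC.
apply: cvg_bigsum => k; apply: cvgMr_tmp.
apply: (@egf_cvg _ 1 b) => // l; first by rewrite mul1r.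
Qed.

(** The derivative in x of e^((s + t - x)A) e^(xA) vanishes, so the values at 0
   and at t agree. *)
Lemma exptD s t : expt (s + t) = expt s *m expt t.
Proof.
apply/matrixP => i j.
pose g (x : R) := (expt (s + t - x) *m expt x) i j.
suff H : g 0 = g t.
  by move: H; rewrite /g subr0 expt0 mulmx1 addrK.
apply: is_derive_0_is_cst => x.
have -> : g = fun x => \sum_k expt (-1 * x + (s + t)) i k * expt x k j.
  by apply/funext => y; rewrite /g mxE mulN1r addrC.
have H k : is_derive x (1 : R) (fun x => expt (-1 * x + (s + t)) i k * expt x k j)
   ((-1 * (A *m expt (-1 * x + (s + t))) i k) * expt x k j +
    expt (-1 * x + (s + t)) i k * (A *m expt x) k j).
  apply: is_derive_mul; last exact: expt_derive.
  apply: (@is_derive_affine (fun y => expt y i k)); exact: expt_derive.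
have := is_derive_bigsum H; set S := \sum_k _; suff -> : S = 0 by [].
rewrite /S big_split /=.
under eq_bigr do rewrite mulN1r mulNr.
rewrite sumrN; apply/eqP; rewrite addrC subr_eq0; apply/eqP.
have -> : \sum_k expt (-1 * x + (s + t)) i k * (A *m expt x) k j =
  (expt (-1 * x + (s + t)) *m (A *m expt x)) i j by rewrite mxE.
by rewrite mulmxA -expt_comm mxE.
Qed.

Lemma expt_continuous i j : continuous (fun s => expt s i j).
Proof. exact: (is_derive_continuous (fun s => expt_derive s i j)). Qed.

End MatrixExponential.

(** * Exponential decay for stable matrices *)

Section StableExponential.
Context {R : realType}.
Local Open Scope complex_scope.

Lemma Re_add (x y : R[i]) : complex.Re (x + y) = complex.Re x + complex.Re y.
Proof. by case: x; case: y. Qed.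
Lemma Im_add (x y : R[i]) : complex.Im (x + y) = complex.Im x + complex.Im y.
Proof. by case: x; case: y. Qed.
Lemma Re_mul (x y : R[i]) : complex.Re (x * y) =
  complex.Re x * complex.Re y - complex.Im x * complex.Im y.
Proof. by case: x; case: y. Qed.
Lemma Im_mul (x y : R[i]) : complex.Im (x * y) =
  complex.Re x * complex.Im y + complex.Im x * complex.Re y.
Proof. by case: x; case: y. Qed.
Lemma Re_sum (I : Type) (r : seq I) (Q : pred I) (F : I -> R[i]) :
  complex.Re (\sum_(i <- r | Q i) F i) = \sum_(i <- r | Q i) complex.Re (F i).
Proof. by elim/big_ind2 : _ => // x1 x2 y1 y2 <- <-; rewrite Re_add. Qed.
Lemma Im_sum (I : Type) (r : seq I) (Q : pred I) (F : I -> R[i]) :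
  complex.Im (\sum_(i <- r | Q i) F i) = \sum_(i <- r | Q i) complex.Im (F i).
Proof. by elim/big_ind2 : _ => // x1 x2 y1 y2 <- <-; rewrite Im_add. Qed.

Definition exp_decay (f : R -> R) : Prop :=
  exists K g : R, [/\ 0 <= K, 0 < g &
    forall s, 0 <= s -> `|f s| <= K * expR (- (g * s))].

Lemma exp_decay_weaken (f : R -> R) (K g g' : R) : 0 <= K -> g' <= g ->
  (forall s, 0 <= s -> `|f s| <= K * expR (- (g * s))) ->
  forall s, 0 <= s -> `|f s| <= K * expR (- (g' * s)).
Proof.
move=> K0 gg H s s0; apply: (le_trans (H s s0)).
by rewrite ler_wpM2l // ler_expR lerN2 ler_wpM2r.
Qed.

Lemma exp_decay0 : exp_decay (fun=> 0).
Proof. by exists 0, 1; split => // s _; rewrite normr0 mul0r. Qed.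

Lemma exp_decayD (f h : R -> R) :
  exp_decay f -> exp_decay h -> exp_decay (fun s => f s + h s).
Proof.
move=> [K [g [K0 g0 H]]] [K' [g' [K0' g0' H']]].
exists (K + K'), (Num.min g g'); split; rewrite ?addr_ge0 ?lt_min ?g0 ?g0' // => s s0.
apply: (le_trans (ler_normD _ _)); rewrite mulrDl lerD //.
  by apply: (exp_decay_weaken K0 _ H) => //; rewrite ge_min lexx.
by apply: (exp_decay_weaken K0' _ H') => //; rewrite ge_min lexx orbT.
Qed.

Lemma exp_decayZ (c : R) (f : R -> R) : exp_decay f -> exp_decay (fun s => c * f s).
Proof.
move=> [K [g [K0 g0 H]]]; exists (`|c| * K), g; split; rewrite ?mulr_ge0 // => s s0.
by rewrite normrM -mulrA ler_wpM2l // H.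
Qed.

Lemma exp_decay_sum n (f : 'I_n -> R -> R) :
  (forall i, exp_decay (f i)) -> exp_decay (fun s => \sum_i f i s).
Proof.
move=> H; elim: n f H => [|n IH] f H.
  by rewrite (_ : (fun s => _) = fun=> 0); [exact: exp_decay0|apply/funext => s; rewrite big_ord0].
rewrite (_ : (fun s => _) = (fun s => f ord0 s + \sum_i f (lift ord0 i) s)).
  by apply: exp_decayD => //; apply: IH.
by apply/funext => s; rewrite big_ord_recl.
Qed.

(** The real form of y' = mu y + z with y = a + i b, mu = al + i be, al < 0 and
   z = p + i q decaying. The squared modulus w of y satisfies
   w' <= - (2 g + r) w + M r e^(-2gs), because 2 a p <= r a^2 + p^2 / r and
   likewise for b q; hence e^((2g + r)s) w - M e^(rs) is nonincreasing. *)
Lemma exp_decay_ode (a b p q : R -> R) (al be : R) : al < 0 ->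
  (forall s, is_derive s (1 : R) a (al * a s - be * b s + p s)) ->
  (forall s, is_derive s (1 : R) b (al * b s + be * a s + q s)) ->
  exp_decay p -> exp_decay q -> exp_decay a /\ exp_decay b.
Proof.
move=> al0 da db [K1 [g1 [K10 g10 H1]]] [K2 [g2 [K20 g20 H2]]].
pose K := K1 + K2; pose g := Num.min (Num.min g1 g2) (- al / 2).
have K0 : 0 <= K by rewrite addr_ge0.
have g0 : 0 < g by rewrite !lt_min g10 g20 /= divr_gt0 // oppr_gt0.
have gal : g <= - al / 2 by rewrite /g ge_min lexx orbT.
have P1 s : 0 <= s -> `|p s| <= K * expR (- (g * s)).
  move=> s0; apply: (@le_trans _ _ (K1 * expR (- (g * s)))); last first.
    by rewrite ler_wpM2r ?expR_ge0 // lerDl.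
  by apply: (exp_decay_weaken K10 _ H1) => //; rewrite /g !ge_min lexx.
have P2 s : 0 <= s -> `|q s| <= K * expR (- (g * s)).
  move=> s0; apply: (@le_trans _ _ (K2 * expR (- (g * s)))); last first.
    by rewrite ler_wpM2r ?expR_ge0 // lerDr.
  by apply: (exp_decay_weaken K20 _ H2) => //; rewrite /g !ge_min lexx orbT.
(* at most half of the damping is spent on the decay rate g, the rest, r, on absorbing z *)
pose r := - al - g.
have r0 : 0 < r by rewrite /r; lra.
pose w s := a s * a s + b s * b s.
pose M := 2 * K ^+ 2 / r ^+ 2.
have M0 : 0 <= M by rewrite /M divr_ge0 ?exprn_ge0 ?mulr_ge0 ?exprn_ge0 // ltW.
pose dw s := 2 * al * w s + 2 * (a s * p s + b s * q s).
have hw s : is_derive s (1 : R) w (dw s).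
  have := is_derive_addf (is_derive_mul (da s) (da s)) (is_derive_mul (db s) (db s)).
  by move=> H; apply: is_derive_eq; rewrite /dw /w; ring.
pose Z s := expR ((2 * g + r) * s) * w s + (- M) * expR (r * s).
pose dZ s := (2 * g + r) * expR ((2 * g + r) * s) * w s + expR ((2 * g + r) * s) * dw s
   + (- M) * (r * expR (r * s)).
have hZ s : is_derive s (1 : R) Z (dZ s).
  exact: (is_derive_addf (is_derive_mul (derive_expRZ _ s) (hw s)) (is_derive_cmul (- M) (derive_expRZ r s))).
have dZ0 s : 0 <= s -> dZ s <= 0.
  move=> s0.
  have eq1 : expR (r * s) = expR ((2 * g + r) * s) * expR (- (g * s)) ^+ 2.
    by rewrite -expRM_natl -expRD; congr expR; ring.
  rewrite /dZ eq1; set E := expR ((2 * g + r) * s); set F := expR (- (g * s)).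
  have -> : (2 * g + r) * E * w s + E * dw s + - M * (r * (E * F ^+ 2)) =
     E * ((2 * g + r) * w s + dw s - M * r * F ^+ 2) by ring.
  rewrite mulr_ge0_le0 ?expR_ge0 //.
  have hMr : M * r = 2 * K ^+ 2 / r by rewrite /M; field; rewrite gt_eqF.
  have hp : p s ^+ 2 <= K ^+ 2 * F ^+ 2.
    by rewrite -exprMn -[p s ^+ 2]real_normK ?num_real // lerXn2r ?nnegrE ?mulr_ge0 ?expR_ge0 //; exact: P1.
  have hq : q s ^+ 2 <= K ^+ 2 * F ^+ 2.
    by rewrite -exprMn -[q s ^+ 2]real_normK ?num_real // lerXn2r ?nnegrE ?mulr_ge0 ?expR_ge0 //; exact: P2.
  have am x y : 2 * (x * y) <= r * (x * x) + y ^+ 2 / r.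
    rewrite -subr_ge0 (_ : _ - _ = (r * x - y) ^+ 2 / r); first by rewrite divr_ge0 ?sqr_ge0 // ltW.
    by field; rewrite gt_eqF.
  have h1 := am (a s) (p s); have h2 := am (b s) (q s).
  have h3 : p s ^+ 2 / r + q s ^+ 2 / r <= M * r * F ^+ 2.
    rewrite hMr -mulrDl mulrAC ler_wpM2r ?invr_ge0 ?(ltW r0) //; lra.
  rewrite /dw /w; rewrite /r in h1 h2 h3 *; lra.
have Zle s : 0 <= s -> Z s <= Z 0.
  move=> s0; apply: (@ler0_derive1_nincry _ Z 0) => //.
  - move=> x; rewrite in_itv /= andbT => x0; rewrite derive1E.
    by have := @derive_val _ _ _ _ _ _ _ (hZ x) => ->; rewrite dZ0 // ltW.
  - by apply: continuous_subspaceT => x; exact: (is_derive_continuous hZ).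
have Z00 : Z 0 <= w 0 by rewrite /Z !mulr0 expR0 mul1r mulr1 gerDl oppr_le0.
have wle s : 0 <= s -> w s <= ((1 + w 0 + M) * expR (- (g * s))) ^+ 2.
  move=> s0; have := le_trans (Zle s s0) Z00; rewrite /Z.
  have w00 : 0 <= w 0 by rewrite /w addr_ge0 // -expr2 sqr_ge0.
  set W := w s; set W0 := w 0 in w00 *.
  have e1 : expR ((2 * g + r) * s) = expR (r * s) / expR (- (g * s)) ^+ 2.
    rewrite -expRM_natl -expRN -expRD; congr expR; ring.
  set F := expR (- (g * s)) in e1 *; have F0 : 0 < F by exact: expR_gt0.
  rewrite e1; set E := expR (r * s); have E1 : 1 <= E.
    by rewrite -expR0 ler_expR mulr_ge0 // ltW.
  move=> H.
  have hW : W <= F ^+ 2 * (W0 + M).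
    have F2 : 0 < F ^+ 2 by rewrite exprn_gt0.
    rewrite -ler_pdivrMl //.
    rewrite -(ler_pM2l (lt_le_trans ltr01 E1)).
    have : E * ((F ^+ 2)^-1 * W) <= W0 + M * E by lra.
    move=> /le_trans; apply; rewrite mulrDr [E * M]mulrC lerD2r.
    by rewrite ler_peMl.
  apply: (le_trans hW); rewrite exprMn mulrC ler_wpM2r ?sqr_ge0 //.
  have : 0 <= W0 + M by rewrite addr_ge0.
  rewrite -(addrA 1) => y0; apply: (@le_trans _ _ (1 + (W0 + M))); first by rewrite lerDr.
  by rewrite expr2 ler_peMr ?lerDl // addr_ge0.
have fin f : (forall s, f s ^+ 2 <= w s) -> exp_decay f.
  move=> hf; exists (1 + w 0 + M), g; split => //.
    rewrite !addr_ge0 // /w -?expr2 ?sqr_ge0 //.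
  move=> s s0; rewrite -(@ler_pXn2r _ 2) ?nnegrE ?normr_ge0 //; last first.
    by rewrite mulr_ge0 ?expR_ge0 // !addr_ge0 // /w -?expr2 ?sqr_ge0.
  by rewrite real_normK ?num_real // (le_trans (hf s)) // wle.
by split; apply: fin => s; rewrite /w expr2 ?lerDl ?lerDr -expr2 sqr_ge0.
Qed.

(** Cayley-Hamilton, with the factors multiplied on one after the other so that
   an induction over the list of roots can peel them off. *)
Lemma char_poly_annihilates (F : fieldType) n (M : 'M[F]_n) (mus : seq F) :
  char_poly M = \prod_(mu <- mus) ('X - mu%:P) ->
  foldl (fun N mu => N *m (M - mu%:M)) 1%:M mus = 0.
Proof.
case: n M => [|n] M hM; first by apply/matrixP => -[].
rewrite -(Cayley_Hamilton M) hM rmorph_prod /=.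
suff H (N : 'M[F]_n.+1) : foldl (fun N mu => N *m (M - mu%:M)) N mus =
    N * \prod_(mu <- mus) horner_mx M ('X - mu%:P) by rewrite H mul1r.
elim: mus N {hM} => [|mu mus IH] N /=; first by rewrite big_nil mulr1.
by rewrite IH big_cons mulrA rmorphB /= horner_mx_X horner_mx_C.
Qed.

Variables (n : nat) (A : 'M[R]_n).
Hypothesis stab : forall z : R[i], eigenvalue (mxtoC A) z -> complex.Re z < 0.

Lemma mxtoCM m1 m2 m3 (M : 'M[R]_(m1, m2)) (N : 'M[R]_(m2, m3)) :
  mxtoC (M *m N) = mxtoC M *m mxtoC N.
Proof. by rewrite /mxtoC map_mxM. Qed.

(** If N (A - mu) e^(sA) decays, then so does N e^(sA), because its entries solve
   y' = mu y + z with z the corresponding entry of N (A - mu) e^(sA). When no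
   factor is left, N = 0. *)
Lemma decay_annihilated (mus : seq R[i]) : all (fun mu => complex.Re mu < 0) mus ->
  forall N : 'M[R[i]]_n,
  foldl (fun N mu => N *m (mxtoC A - mu%:M)) N mus = 0 ->
  forall i j, exp_decay (fun s => complex.Re ((N *m mxtoC (expt A s)) i j)) /\
              exp_decay (fun s => complex.Im ((N *m mxtoC (expt A s)) i j)).
Proof.
elim: mus => [_ N /= -> i j|mu mus IH /= /andP[mu0 hmus] N hN i j].
  by split; rewrite (_ : (fun s => _) = fun=> 0) //; try exact: exp_decay0;
    apply/funext => s; rewrite mul0mx mxE.
have [hp hq] := IH hmus _ hN i j.
have ReE (N' : 'M[R[i]]_n) s : complex.Re ((N' *m mxtoC (expt A s)) i j) =
    (map_mx (@complex.Re R) N' *m expt A s) i j.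
  rewrite mxE Re_sum mxE; apply: eq_bigr => k _.
  by rewrite Re_mul !mxE /= mulr0 subr0.
have ImE (N' : 'M[R[i]]_n) s : complex.Im ((N' *m mxtoC (expt A s)) i j) =
    (map_mx (@complex.Im R) N' *m expt A s) i j.
  rewrite mxE Im_sum mxE; apply: eq_bigr => k _.
  by rewrite Im_mul !mxE /= mulr0 add0r.
have split_ s : N *m mxtoC A *m mxtoC (expt A s) =
   mu *: (N *m mxtoC (expt A s)) + N *m (mxtoC A - mu%:M) *m mxtoC (expt A s).
  by rewrite mulmxBr mulmxBl mul_mx_scalar -scalemxAl addrC subrK.
apply: (@exp_decay_ode _ _ _ _ (complex.Re mu) (complex.Im mu) mu0 _ _ hp hq) => s.
  rewrite (_ : (fun s => complex.Re _) = fun s => (map_mx (@complex.Re R) N *m expt A s) i j); last first.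
    by apply/funext => t; rewrite ReE.
  apply: is_derive_eq; first exact: expt_mul_derive.
  have := congr1 (fun X : 'M[R[i]]_n => complex.Re (X i j)) (split_ s).
  rewrite [in RHS]mxE Re_add [X in complex.Re X + _]mxE Re_mul => <-.
  rewrite ReE; congr ((_ *m _) i j); apply/matrixP => x y.
  rewrite !mxE Re_sum; apply: eq_bigr => k _.
  by rewrite Re_mul !mxE /= mulr0 subr0.
rewrite (_ : (fun s => complex.Im _) = fun s => (map_mx (@complex.Im R) N *m expt A s) i j); last first.
  by apply/funext => t; rewrite ImE.
apply: is_derive_eq; first exact: expt_mul_derive.
have := congr1 (fun X : 'M[R[i]]_n => complex.Im (X i j)) (split_ s).
rewrite [in RHS]mxE Im_add [X in complex.Im X + _]mxE Im_mul => <-.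
rewrite ImE; congr ((_ *m _) i j); apply/matrixP => x y.
rewrite !mxE Im_sum; apply: eq_bigr => k _.
by rewrite Im_mul !mxE /= mulr0 add0r.
Qed.

(** Cayley-Hamilton makes the previous lemma applicable to N = 1 and all roots of
   the characteristic polynomial; this takes the place of the Jordan form. *)
Lemma expt_decay i j : exp_decay (fun s => expt A s i j).
Proof.
have n0 : (0 < n)%N by case: (n) i => // -[].
have [mus hmus] := closed_field_poly_normal (char_poly (mxtoC A)).
have mon : lead_coef (char_poly (mxtoC A)) = 1 by apply/monicP/char_poly_monic.
rewrite mon scale1r in hmus.
have stb : all (fun mu : R[i] => complex.Re mu < 0) mus.
  apply/allP => mu hmu; apply: stab; rewrite eigenvalue_root_char hmus.
  by rewrite root_prod_XsubC.
have ann : foldl (fun N mu => N *m (mxtoC A - mu%:M)) 1%:M mus = 0.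
  exact: char_poly_annihilates.
have [h _] := decay_annihilated stb ann i j.
by move: h; rewrite (_ : (fun s => _) = (fun s => expt A s i j)) //; apply/funext => s; rewrite mul1mx mxE.
Qed.

End StableExponential.

(** * Real-valued integrals and affine substitution *)

Section RealIntegrals.
Context {R : realType} d (T : measurableType d) (mu : {measure set T -> \bar R}).
Implicit Types f g : T -> R.

Definition rinteg f : Prop := mu.-integrable setT (EFin \o f).

Lemma rintegP f : rinteg f <->
  measurable_fun setT f /\ (\int[mu]_x `|f x|%:E < +oo)%E.
Proof.
split; first by move=> /integrableP[/measurable_EFinP ? h]; split.
by move=> [mf h]; apply/integrableP; split => //; apply/measurable_EFinP.
Qed.

Lemma rinteg_measurable f : rinteg f -> measurable_fun setT f.
Proof. by case/rintegP. Qed.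

Lemma rinteg_le f g : measurable_fun setT f -> (forall x, `|f x| <= `|g x|) ->
  rinteg g -> rinteg f.
Proof.
move=> mf fg; apply: le_integrable => //; first exact/measurable_EFinP.
by move=> x _; rewrite /= lee_fin.
Qed.

Lemma rintegD f g : rinteg f -> rinteg g -> rinteg (fun x => f x + g x).
Proof. by move=> hf hg; have := integrableD measurableT hf hg. Qed.

Lemma rintegZ (c : R) f : rinteg f -> rinteg (fun x => c * f x).
Proof. by move=> hf; have := integrableZl measurableT c hf. Qed.

Lemma rinteg0 : rinteg (fun=> 0).
Proof. exact: integrable0. Qed.

Lemma rinteg_sum (I : finType) (f : I -> T -> R) :
  (forall i, rinteg (f i)) -> rinteg (fun x => \sum_i f i x).
Proof.
move=> H; have := @integrable_sum _ _ _ mu setT measurableT _ (index_enum I) xpredT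
  (fun i => EFin \o f i) (fun i _ => H i).
by rewrite /rinteg (_ : (fun x => _) = EFin \o (fun x => \sum_i f i x)) //;
  apply/funext => x; rewrite /= sumEFin.
Qed.

Lemma rintD f g : rinteg f -> rinteg g ->
  \int[mu]_x (f x + g x) = \int[mu]_x f x + \int[mu]_x g x.
Proof. by move=> hf hg; rewrite RintegralD. Qed.

Lemma rintZ (c : R) f : rinteg f -> \int[mu]_x (c * f x) = c * \int[mu]_x f x.
Proof. by move=> hf; rewrite RintegralZl. Qed.

Lemma rint0 : \int[mu]_x (0 : R) = 0.
Proof. by rewrite /Rintegral integral0. Qed.

Lemma rint_sum (I : finType) (f : I -> T -> R) : (forall i, rinteg (f i)) ->
  \int[mu]_x (\sum_i f i x) = \sum_i \int[mu]_x f i x.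
Proof.
move=> H; have HH (s : seq I) : rinteg (fun x => \sum_(i <- s) f i x) /\
    \int[mu]_x (\sum_(i <- s) f i x) = \sum_(i <- s) \int[mu]_x f i x.
  elim: s => [|i s [h1 h2]].
    rewrite big_nil (_ : (fun x => _) = fun=> 0) ?rint0; last first.
      by apply/funext => x; rewrite big_nil.
    by split; [exact: rinteg0|].
  rewrite big_cons (_ : (fun x => _) = fun x => f i x + \sum_(i <- s) f i x); last first.
    by apply/funext => x; rewrite big_cons.
  by split; [exact: rintegD|rewrite rintD // h2].
by case: (HH (index_enum I)).
Qed.

End RealIntegrals.

Section AffineSubstitution.
Context {R : realType}.
Notation mu := (@lebesgue_measure R).

(** The codomain is the Borel line, the measurable space on which pushforwards of
   Lebesgue measure are taken. *)
Definition affine (a b : R) (x : R) : measurableTypeR R := a * x + b.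

Lemma measurable_affine a b : measurable_fun [set: measurableTypeR R] (affine a b).
Proof.
by apply: continuous_measurable_fun => x; apply: cvgD; [apply: cvgMl_tmp; exact: cvg_id|exact: cvg_cst].
Qed.

(** Lebesgue measure is the only measure that agrees with it on half-open
   intervals. *)
Lemma lebesgue_measure_affine (a b : R) (A : set R) : a != 0 -> measurable A ->
  (`|a|%:E * pushforward mu (affine a b) A = mu A)%E.
Proof.
move=> a0 mA.
have na : 0 <= `|a| by [].
have := @lebesgue_measure_unique R (mscale (NngNum na) (pushforward mu (affine a b))).
move=> /(_ (measurable_affine a b)) H; rewrite {}H // => {mA A} _ [[c e]] _ <- /=; rewrite /mscale /= /pushforward.
have aa : `|a| \is a GRing.unit by rewrite unitfE normr_eq0.
case: (ltgtP a 0) a0 => // a0 _.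
  have -> : affine a b @^-1` `]c, e] = `[(e - b) / a, (c - b) / a[%classic.
    apply/seteqP; split => x /=; rewrite !in_itv /= /affine => /andP[h1 h2]; apply/andP; split.
    - by rewrite ler_ndivrMr // mulrC; lra.
    - by rewrite ltr_ndivlMr // mulrC; lra.
    - by move: h2; rewrite ltr_ndivlMr // mulrC; lra.
    - by move: h1; rewrite ler_ndivrMr // mulrC; lra.
  rewrite !lebesgue_measure_itv /= !lte_fin ltr_nM2r ?invr_lt0 // ltrD2r.
  case: ifP => _; last by rewrite mule0.
  rewrite -!EFinD -EFinM; congr EFin; rewrite ltr0_norm //; field.
  by rewrite lt_eqF.
have -> : affine a b @^-1` `]c, e] = `](c - b) / a, (e - b) / a]%classic.
  apply/seteqP; split => x /=; rewrite !in_itv /= /affine => /andP[h1 h2]; apply/andP; split.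
  - by rewrite ltr_pdivrMr // mulrC; lra.
  - by rewrite ler_pdivlMr // mulrC; lra.
  - by move: h1; rewrite ltr_pdivrMr // mulrC; lra.
  - by move: h2; rewrite ler_pdivlMr // mulrC; lra.
rewrite !lebesgue_measure_itv /= !lte_fin ltr_pM2r ?invr_gt0 // ltrD2r.
case: ifP => _; last by rewrite mule0.
rewrite -!EFinD -EFinM; congr EFin; rewrite gtr0_norm //; field.
by rewrite gt_eqF.
Qed.

Lemma ge0_integral_affine (a b : R) (f : R -> \bar R) : a != 0 ->
  measurable_fun setT f -> (forall x, 0 <= f x)%E ->
  (`|a|%:E * \int[mu]_x f (a * x + b)%R = \int[mu]_x f x)%E.
Proof.
move=> a0 mf f0.
have na : 0 <= `|a| by [].
have ma := measurable_affine a b.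
have -> : (\int[mu]_x f (a * x + b)%R = \int[pushforward mu (affine a b)]_y f y)%E.
  by rewrite ge0_integral_pushforward.
rewrite -(@ge0_integral_mscale _ _ _ _ _ measurableT (NngNum na)) //.
apply: eq_measure_integral => A mA _.
exact: (lebesgue_measure_affine b a0 mA).
Qed.

Notation integ f := (rinteg mu f).

Lemma integ_affine (a b : R) (f : R -> R) : a != 0 -> integ f ->
  integ (fun x => f (a * x + b)).
Proof.
move=> a0 /rintegP[mf h]; apply/rintegP; split.
  by apply: measurableT_comp => //; exact: measurable_affine.
have := @ge0_integral_affine a b (fun x => `|f x|%:E) a0.
move=> H; rewrite -H in h => //; last first.
  by apply/measurable_EFinP; exact: measurableT_comp.
rewrite ltNge leye_eq; apply/eqP => e; move: h.
by rewrite e gt0_muley ?ltxx // lte_fin normr_gt0.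
Qed.

Lemma Rintegral_affine (a b : R) (f : R -> R) : a != 0 -> integ f ->
  `|a| * \int[mu]_x f (a * x + b) = \int[mu]_x f x.
Proof.
move=> a0 hf; have hg := integ_affine b a0 hf.
have mf : measurable_fun setT (EFin \o f) by case/integrableP : hf.
apply: EFin_inj; rewrite EFinM /Rintegral !fineK; last 2 first.
- exact: integrable_fin_num.
- exact: integrable_fin_num.
rewrite integralE [in RHS]integralE muleBr //; last first.
  by rewrite fin_num_adde_defl // fin_numN; exact: integrable_neg_fin_num.
congr (_ - _)%E.
  have := @ge0_integral_affine a b (EFin \o f)^\+%E a0 => <- //.
    by congr (_ * _)%E; apply: eq_integral => x _; rewrite !funeposE.
  exact: measurable_funepos.
have := @ge0_integral_affine a b (EFin \o f)^\-%E a0 => <- //.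
  by congr (_ * _)%E; apply: eq_integral => x _; rewrite !funenegE.
exact: measurable_funeneg.
Qed.

End AffineSubstitution.

(** * Decaying functions on the half-line *)

Section HalfLine.
Context {R : realType}.
Notation mu := (@lebesgue_measure R).
Notation Hl := (`[0%R, +oo[%classic : set R).

Lemma exp_decay_bounded (f g : R -> R) (M : R) :
  (forall s, 0 <= s -> `|g s| <= M) -> exp_decay f -> exp_decay (fun s => f s * g s).
Proof.
move=> hg [K [c [K0 c0 H]]]; exists (K * `|M|), c; split; rewrite ?mulr_ge0 // => s s0.
rewrite normrM mulrAC; apply: ler_pM => //; first exact: H.
by apply: (le_trans (hg s s0)); exact: ler_norm.
Qed.

Lemma exp_decay_le_cst (f : R -> R) : exp_decay f ->
  exists M, forall s, 0 <= s -> `|f s| <= M.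
Proof.
move=> [K [c [K0 c0 H]]]; exists K => s s0; apply: (le_trans (H s s0)).
by rewrite ler_piMr // -expR0 ler_expR oppr_le0 mulr_ge0 // ltW.
Qed.

Lemma exp_decayM (f g : R -> R) : exp_decay f -> exp_decay g ->
  exp_decay (fun s => f s * g s).
Proof. by move=> hf /exp_decay_le_cst[M hM]; exact: exp_decay_bounded hM hf. Qed.

Lemma cvg_expRN_pinfty (c : R) : 0 < c -> expR (- (c * x)) @[x --> +oo] --> (0 : R).
Proof.
move=> c0; apply: (@cvg_comp _ _ _ (fun x => c * x) (fun x => expR (- x)) _ +oo); last exact: cvgr_expR.
apply/cvgryPge => A; near=> x; rewrite mulrC -(ler_pdivrMr _ _ c0).
by near: x; apply: nbhs_pinfty_ge; rewrite num_real.
Unshelve. all: by end_near. Qed.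

Lemma integrable_expRN (c : R) : 0 < c ->
  mu.-integrable Hl (EFin \o (fun x => expR (- (c * x)))).
Proof.
move=> c0.
have cf : continuous (fun x : R => expR (- (c * x))).
  by move=> x; have := is_derive_continuous (derive_expRZ (- c)) (x := x); under eq_fun do rewrite mulNr.
apply/integrableP; split.
  apply/measurable_EFinP; apply: measurable_funTS; exact: continuous_measurable_fun.
under eq_integral do rewrite /= ger0_norm ?expR_ge0 //.
have h x : is_derive x (1 : R) (fun x => - c^-1 * expR (- c * x)) (expR (- (c * x))).
  have := is_derive_cmul (- c^-1) (derive_expRZ (- c) x).
  by move=> ?; apply: is_derive_eq; rewrite mulrA mulrNN mulVf ?gt_eqF // mul1r mulNr.
rewrite (@ge0_continuous_FTC2y _ _ (fun x => - c^-1 * expR (- c * x)) _ 0).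
- by rewrite ltry.
- by move=> x _; exact: expR_ge0.
- exact: continuous_subspaceT.
- rewrite -(mulr0 (- c^-1)); apply: cvgMl_tmp.
  by under eq_fun do rewrite mulNr; exact: cvg_expRN_pinfty.
- by move=> x _; case: (h x).
- by apply: cvg_at_right_filter; exact: (is_derive_continuous h).
- by move=> x _; rewrite derive1E; have := @derive_val _ _ _ _ _ _ _ (h x).
Qed.

Lemma exp_decay_integrable (f : R -> R) : measurable_fun setT f -> exp_decay f ->
  mu.-integrable Hl (EFin \o f).
Proof.
move=> mf [K [c [K0 c0 H]]].
have := @integrableZl _ _ _ mu Hl (measurable_itv _) K _ (integrable_expRN c0).
apply: le_integrable => //.
  by apply/measurable_EFinP; exact: measurable_funTS.
move=> x /=; rewrite in_itv /= andbT => x0.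
by rewrite lee_fin [leRHS]ger0_norm ?mulr_ge0 ?expR_ge0 // H.
Qed.

Lemma exp_decay_cvg0 (f : R -> R) : exp_decay f -> f x @[x --> +oo] --> (0 : R).
Proof.
move=> [K [c [K0 c0 H]]]; apply/norm_cvg0P.
apply: (@squeeze_cvgr _ _ _ _ (fun=> 0) (fun x => K * expR (- (c * x)))).
- near=> x; rewrite normr_ge0 /= H //; near: x; exact: nbhs_pinfty_ge.
- exact: cvg_cst.
- by rewrite -[X in _ --> X](mulr0 K); apply: cvgMl_tmp; exact: cvg_expRN_pinfty.
Unshelve. all: by end_near. Qed.

(** The theorem on [0, n + 1], then n to infinity, by dominated convergence on the
   left and the decay of F on the right. The equations for the Gramian and
   for the resolvent are instances. *)
Lemma half_line_FTC (F f : R -> R) :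
  (forall x, is_derive x (1 : R) F (f x)) -> continuous f ->
  exp_decay F -> exp_decay f ->
  \int[mu]_(x in Hl) f x = - F 0.
Proof.
move=> hF cf dF df.
have mf : measurable_fun setT f by exact: continuous_measurable_fun.
have If := exp_decay_integrable mf df.
pose fn (n : nat) (x : R) : \bar R := ((f \_ `[0%R, n.+1%:R]) x)%:E.
have mfn n : measurable_fun Hl (fn n).
  apply/measurable_EFinP; apply: measurable_funTS.
  by apply/(measurable_restrictT _ (measurable_itv _)); exact: measurable_funTS.
have [||||_ _ H] := @dominated_convergence _ _ _ mu Hl (measurable_itv _) fn (EFin \o f)
  (EFin \o (fun x => `|f x|)) mfn.
- by apply/measurable_EFinP; exact: measurable_funTS.
- apply: aeW => x /=; rewrite in_itv /= andbT => x0.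
  apply: cvg_near_cst; near=> n; rewrite /fn patchE ifT // inE /= in_itv /= x0 /=.
  rewrite (@le_trans _ _ n%:R) // ?ler_nat //; near: n; exact: nbhs_infty_ger.
- by have /= := integrable_abse If.
- apply: aeW => x n _; rewrite /fn patchE; case: ifP => _; rewrite lee_fin //.
  by rewrite normr0.
have e n : (\int[mu]_(x in Hl) fn n x = (F n.+1%:R - F 0)%:E)%E.
  have -> : fn n = (EFin \o f) \_ `[0, n.+1%:R] by rewrite restrict_EFin.
  rewrite -integral_mkcondr setIidr; last first.
    by move=> x /=; rewrite !in_itv /= andbT => /andP[].
  rewrite (@continuous_FTC2 _ f F) //.
  - exact: continuous_subspaceT.
  - split.
    + by move=> x _; case: (hF x).
    + by apply: cvg_at_right_filter; exact: (is_derive_continuous hF).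
    + by apply: cvg_at_left_filter; exact: (is_derive_continuous hF).
  - by move=> x _; rewrite derive1E; have := @derive_val _ _ _ _ _ _ _ (hF x).
have H2 : (\int[mu]_(x in Hl) fn n x)%E @[n --> \oo] --> (- F 0)%:E.
  under eq_fun do rewrite e.
  apply: cvg_EFin; first by apply: nearW.
  rewrite -[X in _ --> X]add0r; apply: cvgB; last exact: cvg_cst.
  apply: (cvg_comp (fun n : nat => n.+1%:R : R) F _ (exp_decay_cvg0 dF)).
  have := @cvgr_idn R; rewrite -(cvg_shiftS (fun n : nat => n%:R : R)); exact.
by have := cvg_unique _ H H2; rewrite /Rintegral => ->.
Unshelve. all: by end_near. Qed.

End HalfLine.

(** * Fourier inversion at the origin *)

Section FourierInversion.
Context {R : realType}.
Notation mu := (@lebesgue_measure R).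
Notation Hl := (`[0%R, +oo[%classic : set R).
Notation integ f := (rinteg mu f).

Lemma derive_cosZ (s x : R) :
  is_derive x (1 : R) (fun x => cos (s * x)) (s * - sin (s * x)).
Proof.
have := @is_derive_affine _ cos s 0 x _ (is_derive_cos _).
by rewrite addr0 (_ : (fun x => cos (s * x + 0)) = fun x => cos (s * x)) //; apply/funext => y; rewrite addr0.
Qed.

Lemma derive_sinZ (s x : R) :
  is_derive x (1 : R) (fun x => sin (s * x)) (s * cos (s * x)).
Proof.
have := @is_derive_affine _ sin s 0 x _ (is_derive_sin _).
by rewrite addr0 (_ : (fun x => sin (s * x + 0)) = fun x => sin (s * x)) //; apply/funext => y; rewrite addr0.
Qed.

Lemma continuous_cosZ (s : R) : continuous (fun x : R => cos (s * x)).
Proof. exact: (is_derive_continuous (derive_cosZ s)). Qed.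

Lemma continuous_sinZ (s : R) : continuous (fun x : R => sin (s * x)).
Proof. exact: (is_derive_continuous (derive_sinZ s)). Qed.

Lemma continuous_cosZr (s : R) : continuous (fun x : R => cos (x * s)).
Proof. by under eq_fun do rewrite mulrC; exact: continuous_cosZ. Qed.

Lemma integral_line_split (f : R -> R) : integ f ->
  \int[mu]_x f x = \int[mu]_(x in Hl) f x + \int[mu]_(x in Hl) f (- x).
Proof.
move=> hf.
have hfN : integ (fun x => f (- x)).
  have := @integ_affine R (-1) 0 f _ hf; rewrite oppr_eq0 oner_eq0 => /(_ isT).
  by under eq_fun do rewrite mulN1r addr0.
have U : [set: R] = `]-oo, 0%R[ `|` Hl.
  apply/seteqP; split => x //= _; rewrite !in_itv /= andbT.
  by case: (ltP x 0) => h; [left|right].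
rewrite U Rintegral_setU //=; last 2 first.
- by rewrite -U.
- rewrite disj_set2E; apply/eqP/seteqP; split => x //= []; rewrite !in_itv /= andbT.
  by move=> h1 h2; have := lt_le_trans h1 h2; rewrite ltxx.
rewrite addrC; congr (_ + _).
rewrite Rintegral_mkcond.
have hr : integ (f \_ `]-oo, 0%R[).
  apply: rinteg_le (hf).
    apply/(measurable_restrictT _ (measurable_itv _)); apply: measurable_funTS.
    exact: rinteg_measurable hf.
  by move=> x; rewrite patchE; case: ifP => // _; rewrite normr0.
have := @Rintegral_affine R (-1) 0 _ _ hr; rewrite oppr_eq0 oner_eq0 => /(_ isT) <-.
rewrite normrN1 mul1r -Rintegral_itv_obnd_cbnd; last first.
  by apply: integrableS hfN => //; exact: measurable_itv.
rewrite [RHS]Rintegral_mkcond; apply: eq_Rintegral => x _.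
rewrite !patchE mulN1r addr0.
have -> : (- x \in (`]-oo, 0%R[%classic : set R)) = (x \in (`]0%R, +oo[%classic : set R)).
  by apply/idP/idP; rewrite !inE /= !in_itv /= andbT oppr_lt0.
by [].
Qed.

Lemma integ_exp_abs (c : R) : 0 < c -> integ (fun x => expR (- (c * `|x|))).
Proof.
move=> c0.
have cf : continuous (fun x : R => expR (- (c * `|x|))).
  move=> x; apply: (@continuous_comp _ _ _ (fun x : R => - (c * `|x|)) expR); last exact: continuous_expR.
  by apply: cvgN; apply: cvgMl_tmp; exact: norm_continuous.
apply/rintegP; split; first exact: continuous_measurable_fun.
under eq_integral do rewrite ger0_norm ?expR_ge0 //.
rewrite ge0_symfun_integralT //; last by move=> x /=; rewrite normrN.
have := integrable_expRN c0 => /integrableP[_].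
rewrite -set_itvcy.
have -> : (\int[mu]_(x in Hl) `|(EFin \o (fun x : R => expR (- (c * x)))) x| =
  \int[mu]_(x in Hl) (expR (- (c * `|x|)))%:E)%E.
  apply: eq_integral => x; rewrite inE /= in_itv /= andbT => x0.
  by rewrite ger0_norm ?expR_ge0 // ger0_norm.
by move=> h; rewrite lte_mul_pinfty.
Qed.

(** An antiderivative is e^(-cx) (s sin(sx) - c cos(sx)) / (c^2 + s^2). *)
Lemma integral_exp_cos (c s : R) : 0 < c ->
  \int[mu]_(x in Hl) (expR (- (c * x)) * cos (s * x)) = c / (c ^+ 2 + s ^+ 2).
Proof.
move=> c0.
have d0 : c ^+ 2 + s ^+ 2 != 0 by rewrite gt_eqF // ltr_pwDl ?exprn_gt0 ?sqr_ge0.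
have dE : exp_decay (fun x => expR (- c * x)).
  by exists 1, c; split => // x x0; rewrite mul1r ger0_norm ?expR_ge0 // mulNr.
have hc := derive_cosZ s; have hs := derive_sinZ s.
pose G x := s * sin (s * x) + - c * cos (s * x).
have hG x : is_derive x (1 : R) G (s * (s * cos (s * x)) + - c * (s * - sin (s * x))).
  exact: (is_derive_addf (is_derive_cmul _ (hs x)) (is_derive_cmul _ (hc x))).
pose F x := (c ^+ 2 + s ^+ 2)^-1 * (expR (- c * x) * G x).
have hF x : is_derive x (1 : R) F (expR (- (c * x)) * cos (s * x)).
  have := is_derive_cmul (c ^+ 2 + s ^+ 2)^-1 (is_derive_mul (derive_expRZ (- c) x) (hG x)).
  by move=> ?; apply: is_derive_eq; rewrite /G (_ : expR (- c * x) = expR (- (c * x))) ?mulNr //; field.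
rewrite (half_line_FTC hF).
- by rewrite /F /G !mulr0 expR0 sin0 cos0; field.
- move=> x; apply: cvgM; last exact: (is_derive_continuous hc).
  by have := is_derive_continuous (derive_expRZ (- c)) (x := x); under eq_fun do rewrite mulNr.
- apply: exp_decayZ; apply: (@exp_decay_bounded _ _ _ (`|s| + `|c|)) dE => x _.
  rewrite /G (le_trans (ler_normD _ _)) // !normrM normrN lerD //.
    by rewrite ler_piMr // sin_max.
  by rewrite ler_piMr // cos_max.
- rewrite (_ : (fun x => _) = fun x => expR (- c * x) * cos (s * x)); last first.
    by apply/funext => x; rewrite mulNr.
  by apply: (@exp_decay_bounded _ _ _ 1) dE => x _; exact: cos_max.
Qed.

(** The antiderivative is the arctangent. *)
Lemma integ_cauchy : integ (fun u : R => (1 + u ^+ 2)^-1) /\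
  \int[mu]_u (1 + u ^+ 2)^-1 = pi :> R.
Proof.
have p0 (u : R) : 0 < 1 + u ^+ 2 by rewrite ltr_pwDl // sqr_ge0.
have cf : continuous (fun u : R => (1 + u ^+ 2)^-1).
  move=> x; apply: cvgV; first by rewrite gt_eqF.
  by apply: cvgD; [exact: cvg_cst|exact: exprn_continuous].
have E : (\int[mu]_u ((1 + u ^+ 2)^-1)%:E = pi%:E)%E.
  rewrite ge0_symfun_integralT //; last 2 first.
  - by move=> x; rewrite invr_ge0 ltW.
  - by move=> x /=; rewrite sqrrN.
  rewrite -set_itvcy (@ge0_continuous_FTC2y _ _ (@atan R) _ (pi / 2)).
  - by rewrite atan0 -EFinB -EFinM subr0; congr EFin; field.
  - by move=> x _; rewrite invr_ge0 ltW.
  - exact: continuous_subspaceT.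
  - exact: cvgy_atan.
  - by move=> x _; exact: derivable_atan.
  - by apply: cvg_at_right_filter; exact: continuous_atan.
  - by move=> x _; rewrite derive1_atan.
split; last by rewrite /Rintegral E.
apply/rintegP; split; first exact: continuous_measurable_fun.
under eq_integral do rewrite ger0_norm ?invr_ge0 ?(ltW (p0 _)) //.
by rewrite E ltry.
Qed.

(** Fubini: the factor e^(-e|l|) makes the double integral absolutely convergent,
   and its own cosine transform is the Poisson kernel. *)
Lemma poisson_transform (c : R -> R) (e : R) : 0 < e -> integ c ->
  \int[mu]_l (expR (- (e * `|l|)) * \int[mu]_s (c s * cos (s * l))) =
  \int[mu]_s (c s * (2 * (e / (e ^+ 2 + s ^+ 2)))).
Proof.
move=> e0 hc.
have mc := rinteg_measurable hc.
have hcos s : integ (fun l => expR (- (e * `|l|)) * cos (s * l)).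
  apply: (rinteg_le _ _ (integ_exp_abs e0)).
    apply: measurable_funM; first exact: (rinteg_measurable (integ_exp_abs e0)).
    exact: continuous_measurable_fun (@continuous_cosZ s).
  by move=> l; rewrite normrM ler_piMr // cos_max.
have hcs l : integ (fun s => c s * cos (s * l)).
  apply: (rinteg_le _ _ hc).
    by apply: measurable_funM => //; exact: continuous_measurable_fun (@continuous_cosZr l).
  by move=> s; rewrite normrM ler_piMr // cos_max.
pose h (z : R * R) : R := expR (- (e * `|z.1|)) * (c z.2 * cos (z.2 * z.1)).
have mh : measurable_fun setT h.
  apply: measurable_funM.
    by apply: (measurableT_comp (f := fun x : R => expR (- (e * `|x|)))) => //; exact: (rinteg_measurable (integ_exp_abs e0)).
  apply: measurable_funM; first exact: (measurableT_comp mc).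
  apply: measurableT_comp; first exact: continuous_measurable_fun (@continuous_cos R).
  by apply: measurable_funM.
have inner s : \int[mu]_l h (l, s) = c s * (2 * (e / (e ^+ 2 + s ^+ 2))).
  rewrite /h /=.
  have -> : \int[mu]_l (expR (- (e * `|l|)) * (c s * cos (s * l))) =
     \int[mu]_l (c s * (expR (- (e * `|l|)) * cos (s * l))).
    by apply: eq_Rintegral => l _; rewrite mulrCA.
  rewrite rintZ // integral_line_split //; congr (_ * _).
  have e1 : \int[mu]_(x in Hl) (expR (- (e * `|x|)) * cos (s * x)) = e / (e ^+ 2 + s ^+ 2).
    rewrite -(integral_exp_cos s e0); apply: eq_Rintegral => x; rewrite inE /= in_itv /= andbT => x0.
    by rewrite ger0_norm.
  rewrite e1 (_ : \int[mu]_(x in Hl) _ = e / (e ^+ 2 + s ^+ 2)); first by rewrite mulr2n mulrDl mul1r.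
  by rewrite -e1; apply: eq_Rintegral => x _; rewrite normrN mulrN cosN.
have inner2 l : \int[mu]_s h (l, s) = expR (- (e * `|l|)) * \int[mu]_s (c s * cos (s * l)).
  by rewrite /h /= rintZ.
pose h2 (z : R * R) : R := expR (- (e * `|z.1|)) * c z.2.
have mh2 : measurable_fun setT h2.
  apply: measurable_funM; last exact: (measurableT_comp mc).
  by apply: (measurableT_comp (f := fun x : R => expR (- (e * `|x|)))) => //; exact: (rinteg_measurable (integ_exp_abs e0)).
have Ih2 : (mu \x mu)%E.-integrable setT (EFin \o h2).
  apply/integrable12ltyP; first exact/measurable_EFinP.
  have [_ fc] := (rintegP _ _).1 hc.
  have [_ fe] := (rintegP _ _).1 (integ_exp_abs e0).
  have -> : (\int[mu]_x \int[mu]_y `|(EFin \o h2) (x, y)| =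
     \int[mu]_x ((expR (- (e * `|x|)))%:E * \int[mu]_y `|c y|%:E))%E.
    apply: eq_integral => x _; rewrite -ge0_integralZl //; last first.
      by apply/measurable_EFinP; exact: measurableT_comp.
    by apply: eq_integral => y _; rewrite /h2 /= normrM (ger0_norm (expR_ge0 _)).
  rewrite ge0_integralZr //; last 2 first.
  - by apply/measurable_EFinP; exact: (rinteg_measurable (integ_exp_abs e0)).
  - exact: integral_ge0.
  rewrite lte_mul_pinfty //.
  - by apply: integral_ge0 => x _; rewrite lee_fin expR_ge0.
  - have /fineK <- // := integrable_fin_num measurableT (integ_exp_abs e0).
have Ih : (mu \x mu)%E.-integrable setT (EFin \o h).
  apply: le_integrable (Ih2) => //; first exact/measurable_EFinP.
  move=> z _; rewrite /= lee_fin /h /h2 !normrM ler_wpM2l // ler_piMr //.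
  exact: cos_max.
have F := @Fubini _ _ _ _ R mu mu (EFin \o h) Ih.
have : (\int[mu]_l (expR (- (e * `|l|)) * \int[mu]_s (c s * cos (s * l)))%:E =
  \int[mu]_s (c s * (2 * (e / (e ^+ 2 + s ^+ 2))))%:E)%E.
  transitivity (\int[mu]_l \int[mu]_s (EFin \o h) (l, s))%E.
    apply: eq_integral => l _; rewrite -inner2 /Rintegral fineK //.
    exact: (integrable_fin_num measurableT (rintegZ (expR (- (e * `|l|))) (hcs l))).
  rewrite F; apply: eq_integral => s _; rewrite -inner /Rintegral fineK //.
  have := integrable_fin_num measurableT (rintegZ (c s) (hcos s)).
  by congr (_ \is a fin_num); apply: eq_integral => l _; rewrite /= mulrCA.
by rewrite /Rintegral => ->.
Qed.


(** Insert the factor exp (- e |l|) on the left; as e tends to 0 it is removed by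
   dominated convergence. By [poisson_transform] and the substitution s = e u the
   regularized integral is that of c (e u) * 2 / (1 + u^2), which tends to
   c 0 * 2 pi, again by dominated convergence. Inversion at other points
   is the case of a translate of c. *)
Theorem fourier_inversion0 (c : R -> R) (M : R) :
  continuous c -> (forall s, `|c s| <= M) -> integ c ->
  integ (fun l => \int[mu]_s (c s * cos (s * l))) ->
  \int[mu]_l \int[mu]_s (c s * cos (s * l)) = 2 * pi * c 0.
Proof.
move=> cc cM hc; set D := (fun l => _) => hD.
have [Ik Ek] := integ_cauchy.
have mc := rinteg_measurable hc.
have mD := rinteg_measurable hD.
have mk := rinteg_measurable Ik.
pose e (n : nat) : R := n.+1%:R^-1.
have e0 n : 0 < e n by rewrite invr_gt0.
have ecvg : e n @[n --> \oo] --> (0 : R) by exact: cvg_harmonic.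
pose k (u : R) : R := 2 * (1 + u ^+ 2)^-1.
have k0 u : 0 <= k u by rewrite mulr_ge0 // invr_ge0 addr_ge0 // sqr_ge0.
have Ik2 : integ k by exact: rintegZ.
have M0 : 0 <= M by apply: le_trans (cM 0).
have rescale n : \int[mu]_l (expR (- (e n * `|l|)) * D l) = \int[mu]_u (c (e n * u + 0) * k u).
  rewrite (poisson_transform (e0 n) hc).
  have hg : integ (fun s => c s * (2 * (e n / (e n ^+ 2 + s ^+ 2)))).
    have p0 s : 0 < e n ^+ 2 + s ^+ 2 by rewrite ltr_pwDl ?exprn_gt0 ?sqr_ge0.
    apply: (rinteg_le _ _ (rintegZ (2 / e n) hc)).
      apply: measurable_funM => //; apply: continuous_measurable_fun => s.
      apply: cvgMl_tmp; apply: cvgMl_tmp; apply: cvgV; first by rewrite gt_eqF.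
      by apply: cvgD; [exact: cvg_cst|exact: exprn_continuous].
    have q0 : 0 <= e n by rewrite ltW.
    have q1 s : 0 <= e n ^+ 2 + s ^+ 2 by rewrite ltW.
    move=> s; rewrite normrM [leRHS]normrM mulrC ler_wpM2r //.
    rewrite ger0_norm; last by rewrite mulr_ge0 // divr_ge0.
    rewrite ger0_norm; last by rewrite divr_ge0.
    rewrite ler_pM2l //.
    by rewrite ler_pdivrMr // ler_pdivlMl // -expr2 lerDl sqr_ge0.
  have en0 : e n != 0 by rewrite gt_eqF.
  rewrite -(Rintegral_affine 0 en0 hg) -rintZ; last exact: (integ_affine 0 en0 hg).
  apply: eq_Rintegral => u _; rewrite addr0 gtr0_norm // /k.
  have p1 : 1 + u ^+ 2 != 0 by rewrite gt_eqF // ltr_pwDl // sqr_ge0.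
  have p2 : e n ^+ 2 + (e n * u) ^+ 2 != 0 by rewrite gt_eqF // ltr_pwDl ?exprn_gt0 ?sqr_ge0.
  rewrite mulrCA; congr (_ * _); move: (e n) en0 p2 {hg} => x x0 p2.
  by field; rewrite ?p1 ?p2 ?x0.
have [|||||_ _ H1] := @dominated_convergence _ _ _ mu setT measurableT
  (fun n l => (expR (- (e n * `|l|)) * D l)%:E) (EFin \o D) (EFin \o (fun l => `|D l|)).
- move=> n; apply/measurable_EFinP; apply: measurable_funM => //.
  exact: (rinteg_measurable (integ_exp_abs (e0 n))).
- exact/measurable_EFinP.
- apply: aeW => l _; apply: cvg_EFin; first exact: nearW.
  rewrite -[X in _ --> X]mul1r; apply: cvgMr_tmp.
  rewrite -[X in _ --> X]expR0; apply: continuous_cvg; first exact: continuous_expR.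
  by rewrite -oppr0 -(mul0r `|l|); apply: cvgN; apply: cvgMr_tmp.
- by have := integrable_abse hD.
- apply: aeW => l n _; rewrite /= lee_fin normrM ler_piMl // ger0_norm ?expR_ge0 //.
  by rewrite -expR0 ler_expR oppr_le0 mulr_ge0 // ltW.
have [|||||_ _ H2] := @dominated_convergence _ _ _ mu setT measurableT
  (fun n u => (c (e n * u + 0) * k u)%:E) (EFin \o (fun u => c 0 * k u)) (EFin \o (fun u => M * k u)).
- move=> n; apply/measurable_EFinP; apply: measurable_funM; last exact: rinteg_measurable Ik2.
  by apply: measurableT_comp => //; exact: measurable_affine.
- by apply/measurable_EFinP; exact: rinteg_measurable (rintegZ _ Ik2).
- apply: aeW => u _; apply: cvg_EFin; first exact: nearW.
  apply: cvgMr_tmp; apply: continuous_cvg; first exact: cc.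
  under eq_fun do rewrite addr0.
  by rewrite -(mul0r u); apply: cvgMr_tmp.
- exact: (rintegZ M Ik2).
- apply: aeW => u n _; rewrite /= lee_fin normrM (ger0_norm (k0 u)).
  by rewrite ler_wpM2r.
have H2' : [sequence (\int[mu]_x (expR (- (e n * `|x|)) * D x)%R%:E)%E]_n @ \oo -->
   (\int[mu]_u (c 0 * k u)%R%:E)%E.
  move: H2; apply: cvg_trans; apply: near_eq_cvg; apply: nearW => n /=.
  apply/esym.
  have := congr1 EFin (rescale n); rewrite /Rintegral !fineK //.
  - apply: integrable_fin_num => //.
    apply: (rinteg_le _ _ (rintegZ M Ik2)).
      apply: measurable_funM; last exact: rinteg_measurable Ik2.
      by apply: measurableT_comp => //; exact: measurable_affine.
    by move=> u; rewrite !normrM ler_wpM2r // (le_trans (cM _)) // ler_norm.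
  - apply: integrable_fin_num => //; apply: (rinteg_le _ _ hD).
      apply: measurable_funM => //; exact: (rinteg_measurable (integ_exp_abs (e0 n))).
    move=> l; rewrite normrM ler_piMl // ger0_norm ?expR_ge0 //.
    by rewrite -expR0 ler_expR oppr_le0 mulr_ge0 // ltW.
have -> : \int[mu]_l D l = \int[mu]_u (c 0 * k u).
  rewrite /Rintegral; congr fine; apply: cvg_unique H1 H2' => //.
by rewrite rintZ // /k rintZ // Ek; ring.
Qed.

End FourierInversion.

(** * Square-integrable functions *)

Section SquareIntegrable.
Context {R : realType} d (T : measurableType d) (mu : {measure set T -> \bar R}).
Implicit Types f g h : T -> R.

Definition sqint f : Prop := measurable_fun setT f /\ rinteg mu (fun x => f x ^+ 2).
Definition ip f g : R := \int[mu]_x (f x * g x).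

Lemma sqint_mul f g : sqint f -> sqint g -> rinteg mu (fun x => f x * g x).
Proof.
move=> [mf hf] [mg hg]; apply: (rinteg_le _ _ (rintegD hf hg)).
  exact: measurable_funM.
move=> x; rewrite [leRHS]ger0_norm ?addr_ge0 ?sqr_ge0 // normrM.
rewrite -(real_normK (num_real (f x))) -(real_normK (num_real (g x))).
have a0 : 0 <= `|f x| by []; have b0 : 0 <= `|g x| by [].
by move: `|f x| `|g x| a0 b0 => a b a0 b0; nra.
Qed.

Lemma sqintD f g : sqint f -> sqint g -> sqint (fun x => f x + g x).
Proof.
move=> hf hg; have hfg := sqint_mul hf hg.
case: hf hg => [mf hf] [mg hg]; split; first exact: measurable_funD.
have := rintegD (rintegD hf hg) (rintegZ 2 hfg).
rewrite /rinteg; congr (_.-integrable _ (EFin \o _)); apply/funext => x; ring.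
Qed.

Lemma sqintZ (c : R) f : sqint f -> sqint (fun x => c * f x).
Proof.
move=> [mf hf]; split; first exact: measurable_funM.
have := rintegZ (c ^+ 2) hf.
by rewrite /rinteg; congr (_.-integrable _ (EFin \o _)); apply/funext => x; rewrite exprMn.
Qed.

Lemma sqintB f g : sqint f -> sqint g -> sqint (fun x => f x - g x).
Proof.
move=> hf hg; have := sqintD hf (sqintZ (-1) hg).
by congr sqint; apply/funext => x; rewrite mulN1r.
Qed.

Lemma sqint0 : sqint (fun=> 0).
Proof.
split; first exact: measurable_cst.
have := @rinteg0 R d T mu; rewrite /rinteg; congr (_.-integrable _ (EFin \o _)).
by apply/funext => x; rewrite expr0n.
Qed.

Lemma sqint_sum (I : finType) (f : I -> T -> R) :
  (forall i, sqint (f i)) -> sqint (fun x => \sum_i f i x).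
Proof.
move=> H; have HH (s : seq I) : sqint (fun x => \sum_(i <- s) f i x).
  elim: s => [|i s IH].
    by rewrite (_ : (fun x => _) = fun=> 0); [exact: sqint0|apply/funext => x; rewrite big_nil].
  rewrite (_ : (fun x => _) = fun x => f i x + \sum_(i <- s) f i x); first exact: sqintD.
  by apply/funext => x; rewrite big_cons.
exact: HH.
Qed.

Lemma ipC f g : ip f g = ip g f.
Proof. by apply: eq_Rintegral => x _; rewrite mulrC. Qed.

Lemma ipDl f g h : sqint f -> sqint g -> sqint h ->
  ip (fun x => f x + g x) h = ip f h + ip g h.
Proof.
move=> hf hg hh; rewrite /ip -rintD; [|exact: sqint_mul..].
by apply: eq_Rintegral => x _; rewrite mulrDl.
Qed.

Lemma ipZl (c : R) f h : sqint f -> sqint h -> ip (fun x => c * f x) h = c * ip f h.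
Proof.
move=> hf hh; rewrite /ip -rintZ; last exact: sqint_mul.
by apply: eq_Rintegral => x _; rewrite mulrA.
Qed.

Lemma ipDr f g h : sqint f -> sqint g -> sqint h ->
  ip h (fun x => f x + g x) = ip h f + ip h g.
Proof. by move=> hf hg hh; rewrite ipC ipDl // !(ipC _ h). Qed.

Lemma ipZr (c : R) f h : sqint f -> sqint h -> ip h (fun x => c * f x) = c * ip h f.
Proof. by move=> hf hh; rewrite ipC ipZl // ipC. Qed.

Lemma ip_suml (I : finType) (f : I -> T -> R) h : (forall i, sqint (f i)) -> sqint h ->
  ip (fun x => \sum_i f i x) h = \sum_i ip (f i) h.
Proof.
move=> hf hh; rewrite /ip -rint_sum; last by move=> i; exact: sqint_mul.
by apply: eq_Rintegral => x _; rewrite mulr_suml.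
Qed.

Lemma ip_sumr (I : finType) (f : I -> T -> R) h : (forall i, sqint (f i)) -> sqint h ->
  ip h (fun x => \sum_i f i x) = \sum_i ip h (f i).
Proof.
by move=> hf hh; rewrite ipC ip_suml //; apply: eq_bigr => i _; rewrite ipC.
Qed.

Lemma ip_zero f g : (forall x, f x * g x = 0) -> ip f g = 0.
Proof. by move=> fg; rewrite /ip -[RHS](rint0 mu); apply: eq_Rintegral => x _; rewrite fg. Qed.

Lemma ip_ge0 f : 0 <= ip f f.
Proof. by apply: Rintegral_ge0 => x _; rewrite -expr2 sqr_ge0. Qed.

(** The quadratic form of a f + b g is nonnegative; evaluate it at a = - <f, g>,
   b = <f, f>, except when <f, f> = 0. *)
Lemma ip_CS f g : sqint f -> sqint g ->
  `|ip f g| <= Num.sqrt (ip f f) * Num.sqrt (ip g g).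
Proof.
move=> hf hg.
have q (a b : R) : 0 <= a ^+ 2 * ip f f + 2 * (a * b) * ip f g + b ^+ 2 * ip g g.
  have hx : sqint (fun x => a * f x + b * g x) by apply: sqintD; apply: sqintZ.
  have := ip_ge0 (fun x => a * f x + b * g x).
  rewrite ipDl ?ipDr ?ipZl ?ipZr //; try (exact: sqintZ); try (exact: sqintD).
  by rewrite (ipC g f) => h; apply: le_trans h _; rewrite le_eqVlt; apply/orP; left; apply/eqP; ring.
have f0 := ip_ge0 f; have g0 := ip_ge0 g.
rewrite -sqrtrM // -sqrtr_sqr ler_sqrt ?mulr_ge0 //.
move: (ip f f) (ip g g) (ip f g) q f0 g0 => F G X q F0 G0.
have [F00|Fp] := eqVneq F 0.
  rewrite F00 mul0r; have [->|X0] := eqVneq X 0; first by rewrite expr0n.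
  exfalso.
  have := q (- (1 + G) / X) 1; rewrite F00 mulr0 add0r expr1n mul1r mulr1.
  have -> : 2 * (- (1 + G) / X) * X = - 2 * (1 + G) by field.
  lra.
have Fp' : 0 < F by rewrite lt_def Fp.
have := q (- X) F.
rewrite (_ : _ + _ = F * (F * G - X ^+ 2)); last by ring.
by rewrite pmulr_rge0 // subr_ge0.
Qed.

Lemma ip_norm_cvg (fn : nat -> T -> R) g : (forall n, sqint (fn n)) -> sqint g ->
  ip (fn n) (fn n) @[n --> \oo] --> (0 : R) -> ip (fn n) g @[n --> \oo] --> (0 : R).
Proof.
move=> hfn hg h; apply/norm_cvg0P.
apply: (@squeeze_cvgr _ _ _ _ (fun=> 0) (fun n => Num.sqrt (ip (fn n) (fn n)) * Num.sqrt (ip g g))).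
- by apply: nearW => n; rewrite normr_ge0 /= ip_CS.
- exact: cvg_cst.
rewrite -[X in _ --> X](mul0r (Num.sqrt (ip g g))); apply: cvgMr_tmp.
by rewrite -[X in _ --> X]sqrtr0; apply: continuous_cvg => //; exact: sqrt_continuous.
Qed.

(** Expand the product of f - (f - fn) and g - (g - gn); the correction terms
   vanish by Cauchy-Schwarz. *)
Lemma ip_cvg (fn gn : nat -> T -> R) f g :
  (forall n, sqint (fn n)) -> (forall n, sqint (gn n)) -> sqint f -> sqint g ->
  ip (fun x => f x - fn n x) (fun x => f x - fn n x) @[n --> \oo] --> (0 : R) ->
  ip (fun x => g x - gn n x) (fun x => g x - gn n x) @[n --> \oo] --> (0 : R) ->
  ip (fn n) (gn n) @[n --> \oo] --> ip f g.
Proof.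
move=> hfn hgn hf hg h1 h2.
have hF n : sqint (fun x => f x - fn n x) by exact: sqintB.
have hG n : sqint (fun x => g x - gn n x) by exact: sqintB.
have E n : ip (fn n) (gn n) = ip f g - ip (fun x => f x - fn n x) g
    - ip (fun x => g x - gn n x) f + ip (fun x => f x - fn n x) (fun x => g x - gn n x).
  move: (hF n) (hG n).
  set F := fun x => f x - fn n x; set G := fun x => g x - gn n x => hFn hGn.
  have -> : fn n = (fun x => f x + -1 * F x) by apply/funext => x; rewrite /F; ring.
  have -> : gn n = (fun x => g x + -1 * G x) by apply/funext => x; rewrite /G; ring.
  move: F G hFn hGn => F G {}hF {}hG.
  have hF' : sqint (fun x => -1 * F x) by exact: sqintZ.
  have hG' : sqint (fun x => -1 * G x) by exact: sqintZ.
  have hGG : sqint (fun x => g x + -1 * G x) by exact: sqintD.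
  by rewrite ipDl // !ipDr // ipZl // !ipZr // ipZl // (ipC f G); ring.
suff : (fun n => ip f g - ip (fun x => f x - fn n x) g
    - ip (fun x => g x - gn n x) f + ip (fun x => f x - fn n x) (fun x => g x - gn n x)) @ \oo
    --> ip f g - 0 - 0 + 0.
  by rewrite (_ : (fun n => _) = (fun n => ip (fn n) (gn n))) ?addr0 ?subr0 //; apply/funext => n; rewrite E.
apply: cvgD; first apply: cvgB; first apply: cvgB.
- exact: cvg_cst.
- exact: ip_norm_cvg.
- exact: ip_norm_cvg.
apply/norm_cvg0P.
apply: (@squeeze_cvgr _ _ _ _ (fun=> 0) (fun n => Num.sqrt (ip (fun x => f x - fn n x) (fun x => f x - fn n x)) * Num.sqrt (ip (fun x => g x - gn n x) (fun x => g x - gn n x)))).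
- by apply: nearW => n; rewrite normr_ge0 /= ip_CS.
- exact: cvg_cst.
rewrite -[0 in X in _ --> X](mul0r (0 : R)); apply: cvgM.
  by rewrite -[X in _ --> X]sqrtr0; apply: continuous_cvg => //; exact: sqrt_continuous.
by rewrite -[X in _ --> X]sqrtr0; apply: continuous_cvg => //; exact: sqrt_continuous.
Qed.

Lemma sqint_lty f : measurable_fun setT f -> (\int[mu]_x (f x ^+ 2)%:E < +oo)%E -> sqint f.
Proof.
move=> mf h; split => //; apply/rintegP; split; first exact: measurable_funX.
by under eq_integral do rewrite ger0_norm ?sqr_ge0 //.
Qed.

Lemma ip_lt f (e : R) : measurable_fun setT f -> (\int[mu]_x (f x ^+ 2)%:E < e%:E)%E ->
  sqint f /\ ip f f < e.
Proof.
move=> mf h; have hf : sqint f by apply: sqint_lty => //; apply: lt_trans h (ltry _).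
split => //; rewrite -lte_fin /ip /Rintegral fineK; first by under eq_integral do rewrite -expr2.
by apply: integrable_fin_num => //; exact: sqint_mul.
Qed.

Lemma ip_eq0_ae f : sqint f -> ip f f = 0 -> {ae mu, forall x, f x = 0}.
Proof.
move=> hf h0.
have E : (\int[mu]_x `|(f x ^+ 2)%:E| = 0)%E.
  under eq_integral do rewrite gee0_abs ?lee_fin ?sqr_ge0 //.
  have /fineK <- := integrable_fin_num measurableT hf.2; congr EFin.
  by rewrite -h0 /ip /Rintegral; congr fine; apply: eq_integral => x _; rewrite /= expr2.
have mf : measurable_fun setT (fun x => (f x ^+ 2)%:E).
  by apply/measurable_EFinP; apply: measurable_funX; case: hf.
have := (ae_eq_integral_abs mu measurableT mf).1 E.
apply: filterS => x /(_ I) /= /eqP.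
by rewrite eqe sqrf_eq0 => /eqP.
Qed.

Lemma ae0_sqint f : measurable_fun setT f -> {ae mu, forall x, f x = 0} ->
  sqint f /\ ip f f = 0.
Proof.
move=> mf f0.
have mf2 : measurable_fun setT (fun x => (f x ^+ 2)%:E).
  by apply/measurable_EFinP; exact: measurable_funX.
have E : (\int[mu]_x (f x ^+ 2)%:E = 0)%E.
  have /(ae_eq_integral_abs mu measurableT mf2).2 : ae_eq mu setT (fun x => (f x ^+ 2)%:E) (cst 0%E).
    by apply: filterS f0 => x fx0 _ /=; rewrite fx0 expr0n.
  by under eq_integral do rewrite gee0_abs ?lee_fin ?sqr_ge0 //.
split; first by apply: sqint_lty => //; rewrite E ltry.
by rewrite /ip /Rintegral; under eq_integral do rewrite -expr2; rewrite E.
Qed.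

Lemma sqint_ae f g : sqint f -> measurable_fun setT g ->
  {ae mu, forall x, g x = f x} -> sqint g.
Proof.
move=> hf mg fg.
have [h _] : sqint (fun x => g x - f x) /\ ip (fun x => g x - f x) (fun x => g x - f x) = 0.
  apply: ae0_sqint; first by apply: measurable_funB => //; case: hf.
  by apply: filterS fg => x ->; rewrite subrr.
have := sqintD h hf; congr sqint; apply/funext => x; exact: subrK.
Qed.

Lemma ip_ael f g h : sqint f -> sqint h -> measurable_fun setT g ->
  {ae mu, forall x, g x = f x} -> ip g h = ip f h.
Proof.
move=> hf hh mg fg; have hg := sqint_ae hf mg fg.
have [hd hd0] : sqint (fun x => g x - f x) /\ ip (fun x => g x - f x) (fun x => g x - f x) = 0.
  apply: ae0_sqint; first by apply: measurable_funB => //; case: hf.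
  by apply: filterS fg => x ->; rewrite subrr.
have : ip (fun x => g x - f x) h = 0.
  by apply/eqP; rewrite -normr_le0 (le_trans (ip_CS hd hh)) // hd0 sqrtr0 mul0r.
move=> e; have <- : ip (fun x => (g x - f x) + f x) h = ip g h.
  by congr ip; apply/funext => x; rewrite subrK.
by rewrite ipDl // e add0r.
Qed.

End SquareIntegrable.

(** * Independence and second moments *)

Section Independence.
Context {R : realType} {d : measure_display} {T : measurableType d}.
Variable P : probability T R.
Implicit Types X Y : T -> R.

Definition indep2 X Y : Prop := forall E F : set R, measurable E -> measurable F ->
  (P (X @^-1` E `&` Y @^-1` F) = P (X @^-1` E) * P (Y @^-1` F))%E.

Section Joint.
Variables X Y : {mfun T >-> measurableTypeR R}.
Hypothesis hXY : indep2 X Y.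
Let pair_ (w : T) : measurableTypeR R * measurableTypeR R := (X w, Y w).

Lemma measurable_pair_ : measurable_fun setT pair_.
Proof. by apply: measurable_fun_pair. Qed.

(** Uniqueness of the product measure; it makes Fubini's theorem available for
   independent variables. *)
Lemma joint_law (A : set (measurableTypeR R * measurableTypeR R)) : measurable A ->
  (distribution P X \x distribution P Y)%E A = pushforward P pair_ A.
Proof.
move=> mA; have mp := measurable_pair_.
apply: (@product_measure_unique _ _ _ _ _ (distribution P X) (distribution P Y)
  (pushforward P pair_)); last exact: mA.
by move=> E F mE mF; exact: hXY.
Qed.

Lemma joint_integrable (f : measurableTypeR R * measurableTypeR R -> R) :
  measurable_fun setT f -> rinteg P (fun w => f (X w, Y w)) ->
  (distribution P X \x distribution P Y)%E.-integrable setT (EFin \o f) /\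
  (\int[P]_w (f (X w, Y w))%:E =
   \int[(distribution P X \x distribution P Y)%E]_z (f z)%:E)%E.
Proof.
move=> mf hf; have mp := measurable_pair_.
have ef : measurable_fun setT (EFin \o f) by exact/measurable_EFinP.
split.
  apply/integrableP; split => //.
  rewrite (eq_measure_integral (pushforward P pair_)); last by move=> A mA _; exact: joint_law.
  rewrite ge0_integral_pushforward //; last by apply: measurableT_comp.
  by case/integrableP : hf.
rewrite [RHS](eq_measure_integral (pushforward P pair_)); last by move=> A mA _; exact: joint_law.
by rewrite integral_pushforward.
Qed.

End Joint.

Lemma sqint_cst (c : R) : sqint P (fun=> c).
Proof. by split; [exact: measurable_cst|apply: finite_measure_integrable_cst]. Qed.

Lemma sqint_rinteg (X : T -> R) : sqint P X -> rinteg P X.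
Proof.
move=> hX; have := sqint_mul hX (sqint_cst 1); rewrite /rinteg; congr (_.-integrable _ (EFin \o _)).
by apply/funext => x; rewrite mulr1.
Qed.

Lemma dist_integrable (X : {mfun T >-> measurableTypeR R}) : rinteg P X ->
  (distribution P X).-integrable setT (EFin \o (id : measurableTypeR R -> R)).
Proof.
move=> /integrableP[mX hX]; apply/integrableP; split; first exact/measurable_EFinP.
rewrite ge0_integral_distribution //; apply: measurableT_comp => //.
exact/measurable_EFinP.
Qed.

Lemma indep_ip X Y : sqint P X -> sqint P Y -> indep2 X Y ->
  ip P X Y = (\int[P]_w X w) * (\int[P]_w Y w).
Proof.
move=> hX hY hXY; have mX := hX.1; have mY := hY.1.
pose mX' := isMeasurableFun.Build _ _ T (measurableTypeR R) X mX.
pose X' : {mfun T >-> measurableTypeR R} := HB.pack X mX'.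
pose mY' := isMeasurableFun.Build _ _ T (measurableTypeR R) Y mY.
pose Y' : {mfun T >-> measurableTypeR R} := HB.pack Y mY'.
have hXY' : indep2 X' Y' by [].
pose f (z : measurableTypeR R * measurableTypeR R) : R := z.1 * z.2.
have mf : measurable_fun setT f by apply: measurable_funM.
have [If Ef] := joint_integrable hXY' mf (sqint_mul hX hY).
have IX := sqint_rinteg hX; have IY := sqint_rinteg hY.
have dX : (distribution P X').-integrable setT (EFin \o (id : measurableTypeR R -> R)).
  exact: dist_integrable.
have dY : (distribution P Y').-integrable setT (EFin \o (id : measurableTypeR R -> R)).
  exact: dist_integrable.
have EX : (\int[distribution P X']_x x%:E = (\int[P]_w X w)%:E)%E.
  rewrite integral_distribution // /Rintegral fineK //.
  exact: integrable_fin_num IX.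
have EY : (\int[distribution P Y']_x x%:E = (\int[P]_w Y w)%:E)%E.
  rewrite integral_distribution // /Rintegral fineK //.
  exact: integrable_fin_num IY.
apply: EFin_inj; rewrite EFinM {1}/ip /Rintegral fineK; last first.
  exact: integrable_fin_num (sqint_mul hX hY).
rewrite Ef -integral12_prod_meas1 //= /f /=.
transitivity (\int[distribution P X']_x (x%:E * (\int[P]_w Y w)%:E))%E.
  apply: eq_integral => x _; rewrite /fubini_F /= -EY -integralZl //.
by rewrite integralZr // EX.
Qed.

(** By Fubini the integral of (X + y)^2 is finite for almost every value y of Y,
   hence for some y. *)
Lemma indep_sqint X Y : measurable_fun setT X -> measurable_fun setT Y ->
  indep2 X Y -> sqint P (fun w => X w + Y w) -> sqint P X.
Proof.
move=> mX mY hXY [_ hS].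
pose mX' := isMeasurableFun.Build _ _ T (measurableTypeR R) X mX.
pose X' : {mfun T >-> measurableTypeR R} := HB.pack X mX'.
pose mY' := isMeasurableFun.Build _ _ T (measurableTypeR R) Y mY.
pose Y' : {mfun T >-> measurableTypeR R} := HB.pack Y mY'.
have hXY' : indep2 X' Y' by [].
pose f (z : measurableTypeR R * measurableTypeR R) : R := (z.1 + z.2) ^+ 2.
have mf : measurable_fun setT f by apply: measurable_funX; apply: measurable_funD.
have [If Ef] := joint_integrable hXY' mf hS.
have PF : ProperFilter (almost_everywhere (distribution P Y')).
  apply: ae_properfilter_algebraOfSetsType.
  have : (0 < distribution P Y' setT)%E by rewrite probability_setT.
  exact.
have [y hy] := filter_ex (ae_integrable2 If).
have : rinteg P (fun w => (X w + y) ^+ 2).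
  apply/rintegP; split; first by apply: measurable_funX; apply: measurable_funD.
  case/integrableP : hy => my; rewrite ge0_integral_distribution //.
  by apply: measurableT_comp.
move=> h; have hs : sqint P (fun w => X w + y) by split=> //; apply: measurable_funD.
have := sqintD hs (sqint_cst (- y)); congr sqint; apply/funext => w; exact: addrK.
Qed.

Lemma ip_cst (X : T -> R) (c : R) : sqint P X ->
  ip P X (fun=> c) = c * \int[P]_w X w.
Proof.
move=> hX; rewrite /ip -rintZ; last exact: sqint_rinteg.
by apply: eq_Rintegral => w _; rewrite mulrC.
Qed.

(** Fatou's lemma for the squares. *)
Lemma fatou0 (fn : nat -> T -> R) (f : T -> R) :
  (forall n, sqint P (fn n)) -> (forall w, fn n w @[n --> \oo] --> f w) ->
  ip P (fn n) (fn n) @[n --> \oo] --> (0 : R) ->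
  sqint P f /\ ip P f f = 0.
Proof.
move=> hfn hf h0.
have mf : measurable_fun setT f.
  apply: (@measurable_fun_cvg _ _ _ _ fn) => //.
  by move=> n; case: (hfn n).
have E : (\int[P]_w (f w ^+ 2)%:E = 0)%E.
  apply/eqP; rewrite eq_le; apply/andP; split; last by apply: integral_ge0 => w _; rewrite lee_fin sqr_ge0.
  apply: (@le_trans _ _ (limn_einf (fun n => \int[P]_w (fn n w ^+ 2)%:E)%E)).
    apply: le_trans (fatou P measurableT _ _).
    - rewrite le_eqVlt; apply/orP; left; apply/eqP; apply: eq_integral => w _.
      have c : (fn n w ^+ 2)%:E @[n --> \oo] --> (f w ^+ 2)%:E.
        apply: cvg_EFin; first exact: nearW.
        by rewrite expr2; under eq_fun do rewrite expr2; apply: cvgM; exact: hf.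
      by have [-> _] := cvg_limn_einf_sup c.
    - by move=> n; apply/measurable_EFinP; apply: measurable_funX; case: (hfn n).
    - by move=> n w _; rewrite lee_fin sqr_ge0.
  have c : (\int[P]_w (fn n w ^+ 2)%:E)%E @[n --> \oo] --> 0%E.
    have -> : (fun n => \int[P]_w (fn n w ^+ 2)%:E)%E = (fun n => (ip P (fn n) (fn n))%:E).
      apply/funext => n; rewrite /ip /Rintegral fineK; last first.
        exact: integrable_fin_num (sqint_mul (hfn n) (hfn n)).
      by apply: eq_integral => w _; rewrite expr2.
    by apply: cvg_EFin; first exact: nearW.
  by have [-> _] := cvg_limn_einf_sup c.
split; first by apply: sqint_lty => //; rewrite E ltry.
by rewrite /ip /Rintegral; under eq_integral do rewrite -expr2; rewrite E.
Qed.

End Independence.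

(** * Laws of random vectors *)

Section VectorLaws.
Context {R : realType} {d : measure_display} {T : measurableType d}.
Variable P : probability T R.
Variable n : nat.

(** Generates the Borel sets of vectors; the name makes it possible to give the
   vectors the structure of a measurable space. *)
Definition cVgen : set (set 'cV[R]_n) :=
  \big[setU/set0]_(i < n)
    preimage_set_system setT (fun x : 'cV[R]_n => x i 0 : measurableTypeR R) measurable.

Notation bcV := (g_sigma_algebraType cVgen).

Lemma borel_coord (i : 'I_n) (E : set R) : measurable E ->
  borel_cV [set x : 'cV[R]_n | E (x i 0)].
Proof.
move=> mE; apply: sub_sigma_algebra; rewrite (bigD1 i) //=; left.
by exists E => //; rewrite setTI.
Qed.

Lemma measurable_coord (i : 'I_n) : measurable_fun setT (fun x : bcV => x i 0 : R).
Proof. by move=> _ E mE; rewrite setTI; exact: borel_coord. Qed.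

Lemma random_vector_coord (Z : T -> 'cV[R]_n) (i : 'I_n) :
  random_vector Z -> measurable_fun setT (fun w => Z w i 0).
Proof.
move=> hZ _ E mE; rewrite setTI.
by have := hZ _ (borel_coord i mE).
Qed.

Lemma random_vector_measurable (Z : T -> 'cV[R]_n) :
  random_vector Z -> measurable_fun setT (Z : T -> bcV).
Proof. by move=> hZ _ B mB; rewrite setTI; exact: hZ. Qed.

Lemma random_vectorP (Z : T -> 'cV[R]_n) :
  (forall i, measurable_fun setT (fun w => Z w i 0)) -> random_vector Z.
Proof.
move=> hZ B mB.
have : measurable_fun setT (Z : T -> bcV).
  apply: (@measurability _ _ T bcV setT Z cVgen) => // _ [A hA <-].
  have [i [E mE <-]] : exists i : 'I_n, preimage_set_system setT
      (fun x : 'cV[R]_n => x i 0 : measurableTypeR R) measurable A.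
    move: hA; rewrite /cVgen.
    apply: (big_ind (fun S : set (set 'cV[R]_n) => S A -> _)) => //.
      by move=> S1 S2 h1 h2 [/h1|/h2].
    by move=> i _ hi; exists i.
  rewrite setTI setTI.
  by have := hZ i measurableT E mE; rewrite setTI.
by move=> /(_ measurableT B mB); rewrite setTI.
Qed.

Lemma same_law_int (Z Z' : T -> 'cV[R]_n) (f : 'cV[R]_n -> R) :
  random_vector Z -> random_vector Z' -> same_law P Z Z' ->
  measurable_fun setT (f : bcV -> R) ->
  rinteg P (fun w => f (Z w)) ->
  rinteg P (fun w => f (Z' w)) /\ \int[P]_w f (Z' w) = \int[P]_w f (Z w).
Proof.
move=> /random_vector_measurable mZ /random_vector_measurable mZ' hl mf hf.
have e A : measurable (A : set bcV) -> pushforward P (Z : T -> bcV) A = pushforward P (Z' : T -> bcV) A.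
  by move=> mA; exact: hl.
have ef : measurable_fun setT (EFin \o (f : bcV -> R)) by exact/measurable_EFinP.
have hf' : rinteg P (fun w => f (Z' w)).
  apply/rintegP; split; first by apply: (measurableT_comp mf mZ').
  case/rintegP : hf => _.
  have := @ge0_integral_pushforward _ _ _ _ R _ mZ P setT (fun x => `|(f x)%:E|%E) measurableT.
  rewrite preimage_setT => <- //; last by apply: measurableT_comp.
  have := @ge0_integral_pushforward _ _ _ _ R _ mZ' P setT (fun x => `|(f x)%:E|%E) measurableT.
  rewrite preimage_setT => <- //; last by apply: measurableT_comp.
  by rewrite (eq_measure_integral (pushforward P (Z' : T -> bcV))) // => A mA _; exact: e.
split => //; rewrite /Rintegral; congr fine.
have := @integral_pushforward _ _ _ _ R _ mZ' P setT (EFin \o (f : bcV -> R)) ef.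
rewrite preimage_setT => <- //.
have := @integral_pushforward _ _ _ _ R _ mZ P setT (EFin \o (f : bcV -> R)) ef.
rewrite preimage_setT => <- //.
by apply: eq_measure_integral => A mA _; rewrite [RHS]e.
Qed.

Lemma same_law_sqint (Z Z' : T -> 'cV[R]_n) (i : 'I_n) :
  random_vector Z -> random_vector Z' -> same_law P Z Z' ->
  sqint P (fun w => Z w i 0) -> sqint P (fun w => Z' w i 0).
Proof.
move=> rZ rZ' hl [mZ hZ]; split; first exact: random_vector_coord.
have mf : measurable_fun setT (fun x : bcV => x i 0 ^+ 2 : R).
  by apply: measurable_funX; exact: measurable_coord.
by case: (@same_law_int _ _ (fun x => x i 0 ^+ 2) rZ rZ' hl mf hZ).
Qed.

Lemma same_law_mean (Z Z' : T -> 'cV[R]_n) (i : 'I_n) :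
  random_vector Z -> random_vector Z' -> same_law P Z Z' ->
  sqint P (fun w => Z w i 0) -> \int[P]_w Z' w i 0 = \int[P]_w Z w i 0.
Proof.
move=> rZ rZ' hl hZ.
by case: (@same_law_int _ _ (fun x => x i 0) rZ rZ' hl (measurable_coord i) (sqint_rinteg hZ)).
Qed.

Lemma same_law_ip (Z Z' : T -> 'cV[R]_n) (i j : 'I_n) :
  random_vector Z -> random_vector Z' -> same_law P Z Z' ->
  sqint P (fun w => Z w i 0) -> sqint P (fun w => Z w j 0) ->
  ip P (fun w => Z' w i 0) (fun w => Z' w j 0) = ip P (fun w => Z w i 0) (fun w => Z w j 0).
Proof.
move=> rZ rZ' hl hZ hZ'.
have mf : measurable_fun setT (fun x : bcV => x i 0 * x j 0 : R).
  by apply: measurable_funM; exact: measurable_coord.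
by case: (@same_law_int _ _ (fun x => x i 0 * x j 0) rZ rZ' hl mf (sqint_mul hZ hZ')).
Qed.

Lemma indep_vectors2 (Z : 'I_2 -> T -> 'cV[R]_n) (i j : 'I_n) :
  (forall a, random_vector (Z a)) ->
  independent_vectors P Z ->
  indep2 P (fun w => Z ord0 w i 0) (fun w => Z ord_max w j 0).
Proof.
move=> rZ hZ E F mE mF.
pose B (a : 'I_2) : set 'cV[R]_n :=
  if a == ord0 then [set x : 'cV[R]_n | E (x i 0)] else [set x : 'cV[R]_n | F (x j 0)].
have hB a : borel_cV (B a) by rewrite /B; case: ifP => _; exact: borel_coord.
have := hZ B hB; rewrite big_ord_recl big_ord1 EFinM !fineK; last 2 first.
- by apply: fin_num_measure; exact: rZ.
- by apply: fin_num_measure; exact: rZ.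
rewrite (_ : lift ord0 ord0 = ord_max); last exact/val_inj.
move=> <-; congr (P _); apply/seteqP; split => [w [hE hF] a _|w hw].
  rewrite /B; case: ifP => [/eqP -> //|a0].
  suff -> : a = ord_max by [].
  by apply/val_inj; case: a a0 => -[|[|]].
by split; [have := hw ord0 I|have := hw ord_max I].
Qed.

End VectorLaws.

(** * Second moments of one-sided Levy processes *)

Lemma cvg_coord {R : realType} n (U : Type) (F : set_system U) (FF : Filter F)
    (f : U -> 'cV[R]_n) (l : 'cV[R]_n) (i : 'I_n) :
  f x @[x --> F] --> l -> f x i 0 @[x --> F] --> l i 0.
Proof.
move=> h; apply: (@cvg_comp U _ _ f (fun M : 'cV[R]_n => M i 0) _ _ _ h).
exact: coord_continuous.
Qed.

Section AdditiveFunctions.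
Context {R : realType}.

(** A nonnegative additive function is nondecreasing, so m t is squeezed between
   consecutive integers, and m |q t - t q 1| <= q 1 for all m. *)
Lemma additive_nneg_linear (q : R -> R) :
  (forall s t, 0 <= s -> 0 <= t -> q (s + t) = q s + q t) ->
  (forall t, 0 <= t -> 0 <= q t) -> forall t, 0 <= t -> q t = t * q 1.
Proof.
move=> qD q0 t t0.
have qmono s u : 0 <= s -> s <= u -> q s <= q u.
  move=> s0 su; rewrite -(subrK s u) qD ?subr_ge0 //.
  by rewrite lerDr q0 // subr_ge0.
have qnat (m : nat) u : 0 <= u -> q (m%:R * u) = m%:R * q u.
  move=> u0; elim: m => [|m IH].
    rewrite !mul0r; have := qD 0 0 (lexx _) (lexx _); rewrite addr0 => h.
    by apply/eqP; rewrite -(inj_eq (addrI (q 0))) addr0 -h.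
  by rewrite -addn1 natrD !mulrDl !mul1r qD ?IH ?mulr_ge0.
have bound (m : nat) : `|m%:R * (q t - t * q 1)| <= q 1.
  have mt0 : 0 <= m%:R * t by rewrite mulr_ge0.
  have [k /andP[k1 k2]] : exists k : nat, k%:R <= m%:R * t < k.+1%:R.
    exists (Num.truncn (m%:R * t)); exact: truncn_itv.
  have h1 : k%:R * q 1 <= m%:R * q t.
    by rewrite -!qnat // mulr1; exact: qmono.
  have h2 : m%:R * q t <= k.+1%:R * q 1.
    by rewrite -!qnat // mulr1; apply: qmono => //; exact: ltW.
  have q10 := q0 1 ler01.
  rewrite ler_norml; move: h2; rewrite -natr1 => h2.
  have h3 : k%:R * q 1 <= m%:R * t * q 1 by rewrite ler_wpM2r.
  have h4 : m%:R * t * q 1 <= (k%:R + 1) * q 1 by rewrite ler_wpM2r // natr1 ltW.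
  by apply/andP; split; lra.
apply/eqP; rewrite -subr_eq0 -normr_le0 leNgt; apply/negP => e0.
pose m := (Num.truncn (q 1 / `|q t - t * q 1|)).+1.
have := bound m; rewrite normrM ger0_norm // -ler_pdivlMr // leNgt.
by rewrite truncnS_gt.
Qed.

(** Adding t K reduces this to the nonnegative case. *)
Lemma additive_bounded_linear (q : R -> R) (K : R) :
  (forall s t, 0 <= s -> 0 <= t -> q (s + t) = q s + q t) ->
  (forall t, 0 <= t -> `|q t| <= t * K) -> forall t, 0 <= t -> q t = t * q 1.
Proof.
move=> qD qb t t0.
have := @additive_nneg_linear (fun t => q t + t * K).
move=> H; have := H _ _ t t0; rewrite mul1r mulrDr => H2; apply: (addIr (t * K)); apply: H2.
  by move=> s u s0 u0; rewrite qD // mulrDl addrACA.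
by move=> u u0; have := qb u u0; rewrite ler_norml => /andP[]; lra.
Qed.

End AdditiveFunctions.

Section OneSidedLevy.
Context {R : realType} {d : measure_display} {T : measurableType d}.
Variable P : probability T R.
Variables (n : nat) (L : R -> T -> 'cV[R]_n).
Hypothesis hL : one_sided_levy P L.
Hypothesis L1_sqint : forall i, sqint P (fun w => L 1 w i 0).
Hypothesis L1_mean : forall i, \int[P]_w L 1 w i 0 = 0.

Lemma rint_prob_cst (c : R) : \int[P]_w c = c.
Proof.
rewrite (@Rintegral_cst _ _ _ P setT measurableT c) -[RHS]mulr1; congr (_ * _).
exact: (congr1 fine (probability_setT P)).
Qed.

Definition incr (s t : R) (w : T) : 'cV[R]_n := L t w - L s w.
Definition dL (s t : R) (i : 'I_n) (w : T) : R := incr s t w i 0.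

Lemma dLE s t i w : dL s t i w = L t w i 0 - L s w i 0.
Proof. by rewrite /dL /incr !mxE. Qed.

Lemma measurable_L t i : 0 <= t -> measurable_fun setT (fun w => L t w i 0).
Proof. by move=> t0; apply: random_vector_coord; exact: levy_rv hL _ t0. Qed.

Lemma incr_rv s t : 0 <= s -> 0 <= t -> random_vector (incr s t).
Proof.
move=> s0 t0; apply: random_vectorP => i.
under eq_fun do rewrite -/(dL s t i _) dLE.
by apply: measurable_funB; exact: measurable_L.
Qed.

Lemma measurable_dL s t i : 0 <= s -> 0 <= t -> measurable_fun setT (dL s t i).
Proof. by move=> s0 t0; apply: random_vector_coord; exact: incr_rv. Qed.

Lemma dL_add s t u i w : dL s u i w = dL s t i w + dL t u i w.
Proof. by rewrite !dLE; ring. Qed.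

Lemma dL_indep s t u i j : 0 <= s -> s <= t -> t <= u ->
  indep2 P (dL s t i) (dL t u j).
Proof.
move=> s0 st tu.
pose tt (k : nat) : R := if k == 0%N then s else if k == 1%N then t else u.
have := @levy_independent _ _ _ _ _ _ hL 2 tt.
rewrite /tt /= => /(_ s0) H.
have : independent_vectors P (fun (i : 'I_2) w => L (tt i.+1) w - L (tt i) w).
  apply: H; move=> [|[|a]] [|[|b]] //= _; by [exact: (le_trans st tu)|].
move=> hI.
have rv a : random_vector (fun w => L (tt (a : 'I_2).+1) w - L (tt a) w).
  case: a => -[|[|a]] // ha; rewrite /tt /=; apply: incr_rv => //.
  - exact: le_trans st.
  - exact: le_trans st.
  - exact: le_trans (le_trans s0 st) tu.
by have := @indep_vectors2 R d T P n _ i j rv hI.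
Qed.

(** Stationarity, in the form in which moments are transported. *)
Lemma dL_law s h : 0 <= s -> 0 <= h -> same_law P (incr 0 h) (incr s (s + h)).
Proof. by move=> s0 h0 B hB; rewrite /incr (levy_stationary hL s0 h0). Qed.

Lemma dL0_ae i t : {ae P, forall w, dL 0 t i w = L t w i 0}.
Proof.
by apply: filterS (levy0 hL) => w h0; rewrite dLE h0 mxE subr0.
Qed.

(** The process starts at 0 only almost surely, whence the passage through
   increments. *)
Lemma dL01_sqint i : sqint P (dL 0 1 i).
Proof. by apply: sqint_ae (L1_sqint i) (measurable_dL _ _ _) (dL0_ae _ _). Qed.

Lemma dL0n_sqint (m : nat) i : sqint P (dL 0 m%:R i).
Proof.
elim: m => [|m IH].
  have := sqint0 P; congr sqint; apply/funext => w; by rewrite dLE subrr.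
have -> : dL 0 m.+1%:R i = (fun w => dL 0 m%:R i w + dL m%:R (m%:R + 1) i w).
  by apply/funext => w; rewrite -natr1 (dL_add 0 m%:R).
apply: sqintD => //.
apply: (same_law_sqint (i := i) _ _ (dL_law (s := m%:R) (h := 1) _ _)) => //.
- exact: incr_rv.
- by apply: incr_rv.
- exact: dL01_sqint.
Qed.

(** L t - L 0 is one of two independent summands of an increment of integer
   length, which is square-integrable. *)
Lemma dL0_sqint t i : 0 <= t -> sqint P (dL 0 t i).
Proof.
move=> t0; pose m := (Num.truncn t).+1.
have tm : t <= m%:R by rewrite ltW // truncnS_gt.
apply: (@indep_sqint R d T P _ (dL t m%:R i)).
- exact: measurable_dL.
- exact: measurable_dL.
- exact: dL_indep.
- have := dL0n_sqint m i; congr sqint; apply/funext => w; exact: dL_add.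
Qed.

Lemma dL_sqint s t i : 0 <= s -> s <= t -> sqint P (dL s t i).
Proof.
move=> s0 st; rewrite -(subrK s t) addrC.
have h0 : 0 <= t - s by rewrite subr_ge0.
apply: (same_law_sqint (i := i) _ _ (dL_law s0 h0)).
- exact: incr_rv.
- by apply: incr_rv => //; rewrite addr_ge0.
- exact: dL0_sqint.
Qed.

Definition incr_mean i t : R := \int[P]_w dL 0 t i w.
(** A second moment; it is a covariance once the means are known to vanish. *)
Definition incr_cov i j t : R := ip P (dL 0 t i) (dL 0 t j).

Lemma mean_shift s t i : 0 <= s -> s <= t -> \int[P]_w dL s t i w = incr_mean i (t - s).
Proof.
move=> s0 st; rewrite -{1}(subrK s t) addrC.
have h0 : 0 <= t - s by rewrite subr_ge0.
apply: (same_law_mean (i := i) _ _ (dL_law s0 h0)).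
- exact: incr_rv.
- by apply: incr_rv => //; rewrite addr_ge0.
- exact: dL0_sqint.
Qed.

Lemma ip_shift s t i j : 0 <= s -> s <= t -> ip P (dL s t i) (dL s t j) = incr_cov i j (t - s).
Proof.
move=> s0 st; rewrite -{1 2}(subrK s t) addrC.
have h0 : 0 <= t - s by rewrite subr_ge0.
apply: (same_law_ip (i := i) (j := j) _ _ (dL_law s0 h0)).
- exact: incr_rv.
- by apply: incr_rv => //; rewrite addr_ge0.
- exact: dL0_sqint.
- exact: dL0_sqint.
Qed.

Lemma incr_mean_add i s t : 0 <= s -> 0 <= t -> incr_mean i (s + t) = incr_mean i s + incr_mean i t.
Proof.
move=> s0 t0; have st : s <= s + t by rewrite lerDl.
rewrite {1}/incr_mean (_ : (fun w => dL 0 (s + t) i w) = fun w => dL 0 s i w + dL s (s + t) i w).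
  rewrite rintD; [|exact: sqint_rinteg (dL0_sqint _ _)|exact: sqint_rinteg (dL_sqint _ _ _)].
  by rewrite (mean_shift _ s0 st) (_ : s + t - s = t) //; ring.
by apply/funext => w; exact: dL_add.
Qed.

(** The mixed terms factorize by independence. The means vanish only a
   posteriori, see [incr_mean0]. *)
Lemma incr_cov_add i j s t : 0 <= s -> 0 <= t ->
  incr_cov i j (s + t) = incr_cov i j s + incr_cov i j t + incr_mean i s * incr_mean j t + incr_mean j s * incr_mean i t.
Proof.
move=> s0 t0; have st : s <= s + t by rewrite lerDl.
have e k : dL 0 (s + t) k = fun w => dL 0 s k w + dL s (s + t) k w.
  by apply/funext => w; exact: dL_add.
have h1 k := dL0_sqint k s0; have h2 k := dL_sqint k s0 st.
have tt : s + t - s = t by ring.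
rewrite {1}/incr_cov !e ipDl ?ipDr //; try exact: sqintD.
rewrite (ip_shift i j s0 st) tt -/(incr_cov i j s).
have x1 : ip P (dL 0 s i) (dL s (s + t) j) = incr_mean i s * incr_mean j t.
  by rewrite (indep_ip (h1 i) (h2 j) (dL_indep i j (lexx 0) s0 st)) (mean_shift _ s0 st) tt.
have x2 : ip P (dL s (s + t) i) (dL 0 s j) = incr_mean j s * incr_mean i t.
  by rewrite ipC (indep_ip (h1 j) (h2 i) (dL_indep j i (lexx 0) s0 st)) (mean_shift _ s0 st) tt.
rewrite x1 x2; ring.
Qed.

Lemma incr_mean1 i : incr_mean i 1 = 0.
Proof.
rewrite /incr_mean -[RHS](L1_mean i).
have := ip_ael (L1_sqint i) (sqint_cst P 1) (measurable_dL i (lexx 0) ler01) (dL0_ae i 1).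
by rewrite !ip_cst ?mul1r //; exact: dL01_sqint.
Qed.

(** The variance, which, unlike the second moment, is additive before the means
   are known to vanish. *)
Definition incr_var i t : R := incr_cov i i t - incr_mean i t ^+ 2.

Lemma incr_var_ge0 i t : 0 <= t -> 0 <= incr_var i t.
Proof.
move=> t0; have h := dL0_sqint i t0.
have := ip_ge0 P (fun w => dL 0 t i w + - incr_mean i t).
have hc := sqint_cst P (- incr_mean i t).
rewrite ipDl ?ipDr //; try exact: sqintD.
rewrite (ipC P (fun=> - incr_mean i t) (dL 0 t i)) !ip_cst // -/(incr_mean i t) -/(incr_cov i i t).
rewrite rint_prob_cst.
by move=> h0; rewrite /incr_var; apply: le_trans h0 _; rewrite le_eqVlt; apply/orP; left; apply/eqP; ring.
Qed.

Lemma incr_var_linear i t : 0 <= t -> incr_var i t = t * incr_var i 1.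
Proof.
apply: additive_nneg_linear; last exact: incr_var_ge0.
by move=> s u s0 u0; rewrite /incr_var incr_cov_add // incr_mean_add //; ring.
Qed.

Lemma incr_mean_rat i (k m : nat) : incr_mean i (k%:R / m.+1%:R) = 0.
Proof.
have h u (l : nat) : 0 <= u -> incr_mean i (l%:R * u) = l%:R * incr_mean i u.
  move=> u0; elim: l => [|l IH].
    rewrite !mul0r; have := incr_mean_add i (lexx (0 : R)) (lexx 0); rewrite addr0 => hh.
    by apply/eqP; rewrite -(inj_eq (addrI (incr_mean i 0))) addr0 -hh.
  by rewrite -addn1 natrD !mulrDl !mul1r incr_mean_add ?IH ?mulr_ge0.
have m0 : 0 <= m.+1%:R^-1 :> R by rewrite invr_ge0.
rewrite h // (_ : incr_mean i m.+1%:R^-1 = 0) ?mulr0 //.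
have := h _ m.+1 m0; rewrite divff ?pnatr_eq0 // incr_mean1 => /esym/eqP.
by rewrite mulf_eq0 pnatr_eq0 /= => /eqP.
Qed.

(** The mean is additive in t and vanishes at rational t. Choose h_m tending to 0
   from above with t + h_m rational: the increments over ]0, h_m] have mean
   - m(t) and variance tending to 0, while the paths are right-continuous, so by
   Fatou's lemma the constant m(t) is 0. *)
Lemma incr_mean0 i t : 0 <= t -> incr_mean i t = 0.
Proof.
move=> t0.
pose hh (m : nat) : R := (Num.truncn (t * m.+1%:R)).+1%:R / m.+1%:R - t.
have tr m := truncn_itv (_ : 0 <= t * m.+1%:R).
have hh_pos m : 0 < hh m.
  by rewrite subr_gt0 ltr_pdivlMr // truncnS_gt.
have hh_le m : hh m <= m.+1%:R^-1.
  rewrite /hh lerBlDr ler_pdivrMr // mulrDl mulVf ?pnatr_eq0 // -natr1 addrC lerD2l.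
  by rewrite truncn_le // mulr_ge0.
have hh_cvg : hh m @[m --> \oo] --> (0 : R).
  apply: (@squeeze_cvgr _ _ _ _ (fun=> 0) (fun m : nat => m.+1%:R^-1)).
  - by apply: nearW => m; rewrite hh_le andbT ltW.
  - exact: cvg_cst.
  - exact: cvg_harmonic.
have mnh m : incr_mean i (hh m) = - incr_mean i t.
  have := incr_mean_add i t0 (ltW (hh_pos m)); rewrite /hh addrC subrK incr_mean_rat => /esym/eqP.
  by rewrite addrC addr_eq0 => /eqP.
pose fn m w := dL 0 (hh m) i w + incr_mean i t.
have sfn m : sqint P (fn m).
  by apply: sqintD; [exact: dL0_sqint (ltW (hh_pos m))|exact: sqint_cst].
have fn_cvg w : fn m w @[m --> \oo] --> incr_mean i t.
  have c0 := levy_rcont (w := w) hL (lexx (0 : R)).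
  have c1 : L s w i 0 @[s --> 0^'+] --> L 0 w i 0 by apply: cvg_coord.
  have c2 : L (hh m) w i 0 @[m --> \oo] --> L 0 w i 0.
    by apply: ((cvg_at_rightP _ _ _).1 c1); split.
  have c3 : L (hh m) w i 0 - L 0 w i 0 + incr_mean i t @[m --> \oo] --> L 0 w i 0 - L 0 w i 0 + incr_mean i t.
    by apply: cvgD; [apply: cvgB; [exact: c2|exact: cvg_cst]|exact: cvg_cst].
  move: c3; rewrite subrr add0r; apply: cvg_trans; apply: near_eq_cvg.
  by apply: nearW => m; rewrite /fn dLE.
have fn_ip m : ip P (fn m) (fn m) = hh m * incr_var i 1.
  rewrite -incr_var_linear ?(ltW (hh_pos m)) // /fn ipDl ?ipDr //; try exact: sqint_cst; try exact: dL0_sqint (ltW (hh_pos m)).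
  - rewrite (ipC P (fun=> incr_mean i t) (dL 0 (hh m) i)) !ip_cst //; try exact: sqint_cst; try exact: dL0_sqint (ltW (hh_pos m)).
    rewrite -/(incr_mean i (hh m)) mnh -/(incr_cov i i (hh m)) rint_prob_cst /incr_var mnh; ring.
  - by apply: sqintD; [exact: dL0_sqint (ltW (hh_pos m))|exact: sqint_cst].
have cip : ip P (fn m) (fn m) @[m --> \oo] --> (0 : R).
  have -> : (fun m => ip P (fn m) (fn m)) = (fun m => hh m * incr_var i 1) by apply/funext.
  by rewrite -[X in _ --> X](mul0r (incr_var i 1)); apply: cvgMr_tmp.
have [_] := fatou0 sfn fn_cvg cip.
rewrite ip_cst; last exact: sqint_cst.
by rewrite rint_prob_cst => /eqP; rewrite mulf_eq0 orbb => /eqP.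
Qed.

(** Additive by the vanishing of the means, and of at most linear growth because
   2 |E (X Y)| <= E X^2 + E Y^2 and the diagonal entries are linear. *)
Lemma incr_cov_linear i j t : 0 <= t -> incr_cov i j t = t * incr_cov i j 1.
Proof.
have cvii k u : 0 <= u -> incr_cov k k u = u * incr_cov k k 1.
  by move=> u0; have := incr_var_linear k u0; rewrite /incr_var !incr_mean0 // expr0n !subr0.
apply: (@additive_bounded_linear _ _ ((incr_cov i i 1 + incr_cov j j 1) / 2)).
  by move=> s u s0 u0; rewrite incr_cov_add // !incr_mean0 // !mul0r !addr0.
move=> u u0; have h k := dL0_sqint k u0.
have h1 := ip_ge0 P (fun w => dL 0 u i w + 1 * dL 0 u j w).
have h2 := ip_ge0 P (fun w => dL 0 u i w + -1 * dL 0 u j w).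
have hz c : sqint P (fun w => c * dL 0 u j w) by exact: sqintZ.
have hs c : sqint P (fun w => dL 0 u i w + c * dL 0 u j w) by exact: sqintD.
have E c : ip P (fun w => dL 0 u i w + c * dL 0 u j w) (fun w => dL 0 u i w + c * dL 0 u j w)
    = incr_cov i i u + 2 * c * incr_cov i j u + c ^+ 2 * incr_cov j j u.
  rewrite ipDl // !ipDr // ?ipZl // ?ipZr // -/(incr_cov i i u) -/(incr_cov j j u) -/(incr_cov i j u).
  rewrite (ipC _ (dL 0 u j)) -/(incr_cov i j u); ring.
move: h1 h2; rewrite !E (cvii i u u0) (cvii j u u0) => h1 h2.
by rewrite ler_norml; apply/andP; split; lra.
Qed.

Definition unit_gram i j : R := ip P (fun w => L 1 w i 0) (fun w => L 1 w j 0).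

Lemma L_sqint t i : 0 <= t -> sqint P (fun w => L t w i 0).
Proof.
move=> t0; apply: (sqint_ae (dL0_sqint i t0) (measurable_L _ t0)).
by apply: filterS (dL0_ae i t) => w ->.
Qed.

Lemma levy_gram_le s t i j : 0 <= s -> s <= t ->
  ip P (dL 0 s i) (dL 0 t j) = s * incr_cov i j 1.
Proof.
move=> s0 st; have t0 := le_trans s0 st.
have -> : dL 0 t j = fun w => dL 0 s j w + dL s t j w.
  by apply/funext => w; exact: dL_add.
rewrite ipDr; [|exact: dL0_sqint|exact: dL_sqint|exact: dL0_sqint].
rewrite -/(incr_cov i j s) incr_cov_linear // (indep_ip (dL0_sqint i s0) (dL_sqint j s0 st) (dL_indep i j (lexx 0) s0 st)).
by rewrite (mean_shift _ s0 st) incr_mean0 ?subr_ge0 // mulr0 addr0.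
Qed.

(** The increment over ]s, t] is centred and independent of the increment over
   ]0, s]. *)
Lemma levy_gram s t i j : 0 <= s -> 0 <= t ->
  ip P (fun w => L s w i 0) (fun w => L t w j 0) = Num.min s t * unit_gram i j.
Proof.
have toL a b k l : 0 <= a -> 0 <= b ->
    ip P (dL 0 a k) (dL 0 b l) = ip P (fun w => L a w k 0) (fun w => L b w l 0).
  move=> a0 b0.
  rewrite (ip_ael (L_sqint k a0) (dL0_sqint l b0) (measurable_dL k (lexx 0) a0) (dL0_ae k a)).
  rewrite ipC (ip_ael (L_sqint l b0) (L_sqint k a0) (measurable_dL l (lexx 0) b0) (dL0_ae l b)).
  exact: ipC.
have cvLC k l : incr_cov k l 1 = unit_gram k l by rewrite /incr_cov toL.
move=> s0 t0; rewrite -toL //; case: (leP s t) => st.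
  by rewrite levy_gram_le // cvLC.
rewrite ipC levy_gram_le ?(ltW st) // cvLC; congr (_ * _); exact: ipC.
Qed.

Lemma levy_mean t i : 0 <= t -> \int[P]_w L t w i 0 = 0.
Proof.
move=> t0; rewrite -[RHS](incr_mean0 i t0) /incr_mean.
have := ip_ael (L_sqint i t0) (sqint_cst P 1) (measurable_dL i (lexx 0) t0) (dL0_ae i t).
by rewrite !ip_cst ?mul1r //; [exact: L_sqint|exact: dL0_sqint].
Qed.

End OneSidedLevy.

(** * Second moments of two-sided Levy processes *)

Section TwoSidedLevy.
Context {R : realType} {d : measure_display} {T : measurableType d}.
Variable P : probability T R.
Variables (n : nat) (L : R -> T -> 'cV[R]_n).
Hypothesis hL : driving_levy P L.

(** The length of the part that the intervals between 0 and s and between 0 and t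
   have in common, which is 0 when s and t have different signs. *)
Definition overlap (s t : R) : R :=
  if (0 <= s) && (0 <= t) then Num.min s t
  else if (s < 0) && (t < 0) then Num.min (- s) (- t) else 0.

Lemma frobsq_coord (x : 'cV[R]_n) i : x i 0 ^+ 2 <= frobsq x.
Proof.
rewrite /frobsq (bigD1 i) //= big_ord1 lerDl sumr_ge0 // => j _.
by rewrite big_ord1 sqr_ge0.
Qed.

Lemma frobsq_cV (x : 'cV[R]_n) : frobsq x = \sum_i x i 0 ^+ 2.
Proof. by rewrite /frobsq; apply: eq_bigr => i _; rewrite big_ord1. Qed.

Lemma frobsq_lt_coord (Z : T -> 'cV[R]_n) i (e : \bar R) :
  (forall i, measurable_fun setT (fun w => Z w i 0)) ->
  (\int[P]_w (frobsq (Z w))%:E < e)%E -> (\int[P]_w (Z w i 0 ^+ 2)%:E < e)%E.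
Proof.
move=> mZ; apply: le_lt_trans; apply: ge0_le_integral => //.
- by move=> w _; rewrite lee_fin sqr_ge0.
- by apply/measurable_EFinP; exact: measurable_funX.
- apply/measurable_EFinP; under eq_fun do rewrite frobsq_cV.
  by apply: measurable_sum => j; exact: measurable_funX.
- by move=> w _; rewrite lee_fin frobsq_coord.
Qed.

Lemma expectation_rint (X : T -> R) : 'E_P[X]%E = (\int[P]_w (X w)%:E)%E.
Proof. by rewrite unlock. Qed.

(** For negative t the process is the negative of a left limit of the second
   one-sided process; this limit is almost surely the value, because the second
   moment of the increments over short intervals tends to 0. *)
Lemma two_sided_gram : 
  [/\ forall t i, sqint P (fun w => L t w i 0),
      forall t i, \int[P]_w L t w i 0 = 0 &
      forall s t i j, ip P (fun w => L s w i 0) (fun w => L t w j 0) =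
                      levy_cov P L i j * overlap s t].
Proof.
case: hL => -[L1 [L2 [h1 h2 hfdd hind hLE]]] hm2 hm.
have L1E w : L 1 w = L1 1 w by rewrite hLE ler01.
have rv1 : random_vector (L1 1) by exact: levy_rv h1 _ ler01.
have rv2 : random_vector (L2 1) by exact: levy_rv h2 _ ler01.
have s1 i : sqint P (fun w => L1 1 w i 0).
  apply: sqint_lty; first exact: random_vector_coord.
  apply: (@frobsq_lt_coord (L1 1)); first by move=> j; exact: random_vector_coord.
  by under eq_integral do rewrite -L1E.
have m1 i : \int[P]_w L1 1 w i 0 = 0.
  have e : (fun w => L 1 w i 0) = (fun w => L1 1 w i 0) by apply/funext => w; rewrite L1E.
  by move: (hm i); rewrite e expectation_rint /Rintegral => ->.
have law12 : same_law P (L1 1) (L2 1).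
  move=> B hB.
  have := hfdd 1%N (fun=> 1) (fun=> B) (fun=> ler01) (fun=> hB).
  rewrite (_ : \bigcap_(i in _) _ = L1 1 @^-1` B); last first.
    by apply/seteqP; split => w h; [exact: (h ord0)|move=> i _].
  rewrite (_ : \bigcap_(i in _) _ = L2 1 @^-1` B) //.
  by apply/seteqP; split => w h; [exact: (h ord0)|move=> i _].
have s2 i : sqint P (fun w => L2 1 w i 0) by apply: same_law_sqint law12 (s1 i).
have m2 i : \int[P]_w L2 1 w i 0 = 0 by rewrite (same_law_mean rv1 rv2 law12 (s1 i)).
have covE i j : levy_cov P L i j = unit_gram P L1 i j.
  rewrite mxE expectation_rint /unit_gram /ip /Rintegral.
  by congr fine; apply: eq_integral => w _; rewrite L1E.
have LC2 i j : unit_gram P L2 i j = levy_cov P L i j.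
  by rewrite covE /unit_gram (same_law_ip rv1 rv2 law12 (s1 i) (s1 j)).
have S1 t i : 0 <= t -> sqint P (fun w => L1 t w i 0) by exact: L_sqint h1 s1 t i.
have S2 t i : 0 <= t -> sqint P (fun w => L2 t w i 0) by exact: L_sqint h2 s2 t i.
have G1 := levy_gram h1 s1 m1; have G2 := levy_gram h2 s2 m2.
have M1 t i : 0 <= t -> \int[P]_w L1 t w i 0 = 0 by exact: levy_mean h1 s1 m1 t i.
have M2 t i : 0 <= t -> \int[P]_w L2 t w i 0 = 0 by exact: levy_mean h2 s2 m2 t i.
(* left limits agree with values almost surely *)
have neg t i : t < 0 -> measurable_fun setT (fun w => L t w i 0) /\
    {ae P, forall w, L t w i 0 = - 1 * L2 (- t) w i 0}.
  move=> t0; have nt0 : 0 < - t by rewrite oppr_gt0.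
  (* approaches - t from below and stays nonnegative *)
  pose sn (m : nat) : R := - t - (- t) / m.+2%:R.
  have sn_lt m : sn m < - t by rewrite /sn gtrBl divr_gt0.
  have sn_ge m : 0 <= sn m.
    by rewrite /sn subr_ge0 ler_pdivrMr // ler_peMr ?(ltW nt0) // ler1n.
  have sn_cvg : sn m @[m --> \oo] --> - t.
    rewrite -[X in _ --> X]subr0 /sn; apply: cvgB; first exact: cvg_cst.
    rewrite -(mulr0 (- t)); apply: cvgMl_tmp.
    by have := @cvg_harmonic R; rewrite -(cvg_shiftS (@harmonic R)); exact.
  pose fn m w := L2 (- t) w i 0 - L2 (sn m) w i 0.
  pose f w := L2 (- t) w i 0 + L t w i 0.
  have sfn m : sqint P (fn m) by apply: sqintB; [exact: S2 (ltW nt0)|exact: S2 (sn_ge m)].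
  have cfn w : fn m w @[m --> \oo] --> f w.
    have c0 := levy_llim h2 (w := w) nt0.
    have c1 : L2 s w i 0 @[s --> (- t)^'-] --> (lim (L2 s w @[s --> (- t)^'-])) i 0.
      exact: cvg_coord.
    have c2 : L2 (sn m) w i 0 @[m --> \oo] --> (lim (L2 s w @[s --> (- t)^'-])) i 0.
      by apply: ((cvg_at_leftP _ _ _).1 c1); split.
    rewrite /f hLE leNgt t0 /= mxE; apply: cvgB; [exact: cvg_cst|exact: c2].
  have ipfn m : ip P (fn m) (fn m) = (- t - sn m) * unit_gram P L2 i i.
    have Sa := S2 _ i (ltW nt0); have Sb := S2 _ i (sn_ge m).
    have -> : fn m = fun w => L2 (- t) w i 0 + - 1 * L2 (sn m) w i 0.
      by apply/funext => w; rewrite /fn mulN1r.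
    have Sc : sqint P (fun w => - 1 * L2 (sn m) w i 0) by exact: sqintZ.
    have Sd := sqintD Sa Sc.
    rewrite ipDl // !ipDr // !ipZl // !ipZr //.
    rewrite !G2 ?(ltW nt0) ?sn_ge // !minxx.
    rewrite (min_r (ltW (sn_lt m))) (min_l (ltW (sn_lt m))); ring.
  have cip : ip P (fn m) (fn m) @[m --> \oo] --> (0 : R).
    have -> : (fun m => ip P (fn m) (fn m)) = (fun m => (- t - sn m) * unit_gram P L2 i i) by apply/funext.
    rewrite -[X in _ --> X](mul0r (unit_gram P L2 i i)); apply: cvgMr_tmp.
    by rewrite -[X in _ --> X](subrr (- t)); apply: cvgB => //; exact: cvg_cst.
  have [sf f0] := fatou0 sfn cfn cip.
  split; last first.
    apply: filterS (ip_eq0_ae sf f0) => w; rewrite /f => /eqP.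
    by rewrite addrC addr_eq0 mulN1r => /eqP.
  rewrite (_ : (fun w => L t w i 0) = fun w => f w - L2 (- t) w i 0); last first.
    by apply/funext => w; rewrite /f addrC addKr.
  by apply: measurable_funB; [case: sf|case: (S2 _ i (ltW nt0))].
have pos t i : 0 <= t -> (fun w => L t w i 0) = (fun w => L1 t w i 0).
  by move=> t0; apply/funext => w; rewrite hLE t0.
have negS t i : t < 0 -> sqint P (fun w => - 1 * L2 (- t) w i 0).
  by move=> t0; apply: sqintZ; apply: S2; rewrite oppr_ge0 ltW.
have SL t i : sqint P (fun w => L t w i 0).
  case: (ltP t 0) => t0; last by rewrite pos //; exact: S1.
  by have [mt at0] := neg t i t0; exact: sqint_ae (negS t i t0) mt at0.
have crossE s t i j : 0 <= s -> 0 <= t ->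
    ip P (fun w => L1 s w i 0) (fun w => L2 t w j 0) = 0.
  move=> s0 t0; rewrite indep_ip ?M1 ?mul0r //; [exact: S1|exact: S2|].
  move=> E F mE mF; apply: hind; apply: sub_sigma_algebra.
    by exists s, [set x | E (x i 0)]; split => //; exact: borel_coord.
  by exists t, [set x | F (x j 0)]; split => //; exact: borel_coord.
have negip t i (h : T -> R) : t < 0 -> sqint P h ->
    ip P (fun w => L t w i 0) h = - ip P (fun w => L2 (- t) w i 0) h.
  move=> t0 hh; have [mt at0] := neg t i t0.
  rewrite (ip_ael (negS t i t0) hh mt at0) ipZl // ?mulN1r //.
  by apply: S2; rewrite oppr_ge0 ltW.
split => //.
- move=> t i; case: (ltP t 0) => t0; last by rewrite pos // M1.
  have := negip t i (fun=> 1) t0 (sqint_cst P 1).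
  have nt : 0 <= - t by rewrite oppr_ge0 ltW.
  by rewrite !ip_cst ?mul1r ?M2 ?oppr0 //; exact: S2.
move=> s t i j; rewrite /overlap.
case: (ltP s 0) => s0; case: (ltP t 0) => t0 /=.
- have ns : 0 <= - s by rewrite oppr_ge0 ltW.
  have nt : 0 <= - t by rewrite oppr_ge0 ltW.
  rewrite negip // ipC negip //; last exact: S2.
  by rewrite opprK ipC G2 // LC2 mulrC.
- have ns : 0 <= - s by rewrite oppr_ge0 ltW.
  by rewrite negip // pos // ipC crossE // oppr0 mulr0.
- have nt : 0 <= - t by rewrite oppr_ge0 ltW.
  by rewrite ipC negip // pos // ipC crossE // oppr0 mulr0.
- by rewrite !pos // G1 // -covE mulrC.
Qed.

End TwoSidedLevy.

(** * The isometry for integrals against a Levy process *)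

Section LevyIntegral.
Context {R : realType} {d : measure_display} {T : measurableType d}.
Variable P : probability T R.
Variables (k : nat) (L : R -> T -> 'cV[R]_k).
Hypothesis hL : driving_levy P L.
Notation leb := (@lebesgue_measure R).
Notation C := (levy_cov P L).

Definition itv_ind (a b u : R) : R := (a < u <= b)%R%:R.
(** The function whose integral against L is L t (up to the null set where L 0 is
   not 0); for negative t the increment runs backwards. *)
Definition signed_ind (t u : R) : R := itv_ind 0 t u - itv_ind t 0 u.

Lemma itv_indE a b : itv_ind a b = \1_(`]a, b]%classic : set R).
Proof.
apply/funext => u; rewrite /itv_ind indicE.
by congr (_ %:R); apply/esym; rewrite mem_setE /= in_itv.
Qed.

Lemma measurable_itv_ind a b : measurable_fun setT (itv_ind a b).
Proof. by rewrite itv_indE; apply: measurable_indic; exact: measurable_itv. Qed.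

Lemma itv_ind_ge0 a b u : 0 <= itv_ind a b u.
Proof. by rewrite /itv_ind ler0n. Qed.

Lemma itv_ind_integral a b : a <= b -> rinteg leb (itv_ind a b) /\ \int[leb]_u itv_ind a b u = b - a.
Proof.
move=> ab.
have E : (\int[leb]_u (itv_ind a b u)%:E = (b - a)%:E)%E.
  rewrite itv_indE integral_indic //.
  rewrite setIT; transitivity (leb (`]a, b]%classic : set R)) => //.
  rewrite lebesgue_measure_itv /= lte_fin.
  case: (ltP a b) => h; first by rewrite -EFinB.
  by rewrite (_ : b = a) ?subrr //; apply/eqP; rewrite eq_le ab h.
split; last by rewrite /Rintegral E.
apply/rintegP; split; first exact: measurable_itv_ind.
by under eq_integral do rewrite ger0_norm ?itv_ind_ge0 //; rewrite E ltry.
Qed.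

Lemma itv_ind_sq a b u : itv_ind a b u * itv_ind a b u = itv_ind a b u.
Proof. by rewrite /itv_ind; case: (_ && _); rewrite ?mulr1 ?mulr0. Qed.

Lemma itv_ind_empty a b u : b <= a -> itv_ind a b u = 0.
Proof.
move=> ba; rewrite /itv_ind; case: andP => // -[h1 h2].
by have := lt_le_trans h1 (le_trans h2 ba); rewrite ltxx.
Qed.

Lemma itv_ind_rinteg a b : rinteg leb (itv_ind a b).
Proof.
case: (leP a b) => [/itv_ind_integral[] //|ba].
rewrite (_ : itv_ind a b = fun=> 0); first exact: rinteg0.
by apply/funext => u; rewrite itv_ind_empty // ltW.
Qed.

Lemma itv_ind_sqint a b : sqint leb (itv_ind a b).
Proof.
split; first exact: measurable_itv_ind.
have := itv_ind_rinteg a b; rewrite /rinteg; congr (_.-integrable _ (EFin \o _)).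
by apply/funext => u; rewrite expr2 itv_ind_sq.
Qed.

Lemma signed_ind_sqint t : sqint leb (signed_ind t).
Proof. by apply: sqintB; exact: itv_ind_sqint. Qed.

Lemma itv_indB a b u : a <= b -> itv_ind a b u = (u <= b)%R%:R - (u <= a)%R%:R.
Proof.
move=> ab; rewrite /itv_ind ltNge; case: (leP u a) => /= ua; last by rewrite subr0.
by rewrite (le_trans ua ab) subrr.
Qed.

(** A signed indicator is [u <= t] - [u <= 0] for every sign of t. *)
Lemma signed_ind_diff a b u : a <= b -> signed_ind b u - signed_ind a u = itv_ind a b u.
Proof.
have signed_indE t : signed_ind t u = (u <= t)%R%:R - (u <= 0)%R%:R.
  rewrite /signed_ind; case: (leP 0 t) => t0; first by rewrite (itv_ind_empty _ t0) subr0 itv_indB.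
  by rewrite (itv_ind_empty _ (ltW t0)) sub0r itv_indB ?(ltW t0) // opprB.
by move=> ab; rewrite !signed_indE itv_indB //; ring.
Qed.

Lemma signed_ind_ip s t : ip leb (signed_ind s) (signed_ind t) = overlap s t.
Proof.
have ipind a b (f g : R -> R) : a <= b -> (forall u, f u * g u = itv_ind a b u) ->
    ip leb f g = b - a.
  move=> ab fg; rewrite -(itv_ind_integral ab).2 /ip; apply: eq_Rintegral => u _; exact: fg.
rewrite /overlap; case: (leP 0 s) => s0; case: (leP 0 t) => t0 /=.
- rewrite (ipind 0 (Num.min s t)) ?subr0 //; first by rewrite le_min s0 t0.
  move=> u; rewrite /signed_ind (itv_ind_empty _ s0) (itv_ind_empty _ t0) !subr0 /itv_ind le_min.
  by case: (0 < u) => /=; case: (u <= s); case: (u <= t); rewrite /= ?mulr1 ?mulr0 ?mul0r.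
- rewrite ip_zero // => u.
  rewrite /signed_ind (itv_ind_empty _ s0) (itv_ind_empty _ (ltW t0)) subr0 sub0r /itv_ind.
  by case: (ltP 0 u) => h1 /=; rewrite ?andbF ?mul0r ?mulr0 ?oppr0 ?mulr0.
- rewrite ip_zero // => u.
  rewrite /signed_ind (itv_ind_empty _ t0) (itv_ind_empty _ (ltW s0)) subr0 sub0r /itv_ind.
  by case: (ltP 0 u) => h1 /=; rewrite ?andbF ?mul0r ?mulr0 ?oppr0 ?mul0r.
- rewrite (ipind (Num.max s t) 0) ?sub0r ?oppr_max //; first by rewrite ge_max !ltW.
  move=> u; rewrite /signed_ind (itv_ind_empty _ (ltW s0)) (itv_ind_empty _ (ltW t0)) !sub0r mulrNN /itv_ind gt_max.
  by case: (s < u); case: (t < u); case: (u <= 0); rewrite /= ?mulr1 ?mulr0 ?mul0r.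
Qed.

Definition levy_incr (a b : R) (q : 'I_k) (w : T) : R := L b w q 0 - L a w q 0.

Let gram := two_sided_gram hL.
Let L_sq t i : sqint P (fun w => L t w i 0). Proof. by case: gram. Qed.

Lemma levy_incr_sqint a b q : sqint P (levy_incr a b q).
Proof. by apply: sqintB. Qed.

Lemma levy_incr_ip a b c e q q' : a <= b -> c <= e ->
  ip P (levy_incr a b q) (levy_incr c e q') = C q q' * ip leb (itv_ind a b) (itv_ind c e).
Proof.
move=> ab ce.
have exp_ d' (T' : measurableType d') (mu : {measure set T' -> \bar R}) (f g f' g' : T' -> R) :
   sqint mu f -> sqint mu g -> sqint mu f' -> sqint mu g' ->
   ip mu (fun x => f x - g x) (fun x => f' x - g' x) =
   ip mu f f' - ip mu f g' - ip mu g f' + ip mu g g'.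
  move=> hf hg hf' hg'.
  have e1 (u v : T' -> R) : (fun x => u x - v x) = (fun x => u x + -1 * v x).
    by apply/funext => x; rewrite mulN1r.
  have z1 : sqint mu (fun x => -1 * g x) by exact: sqintZ.
  have z2 : sqint mu (fun x => -1 * g' x) by exact: sqintZ.
  have z3 := sqintD hf' z2.
  rewrite !e1 ipDl // !ipDr // !ipZl // !ipZr //; ring.
rewrite /levy_incr exp_ //.
have -> : itv_ind a b = (fun u => signed_ind b u - signed_ind a u) by apply/funext => u; rewrite signed_ind_diff.
have -> : itv_ind c e = (fun u => signed_ind e u - signed_ind c u) by apply/funext => u; rewrite signed_ind_diff.
rewrite exp_; try exact: signed_ind_sqint.
by case: gram => _ _ G; rewrite !G !signed_ind_ip; ring.
Qed.

Lemma levy_incr_mean a b q : \int[P]_w levy_incr a b q w = 0.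
Proof.
have [_ M _] := gram.
have := ipDl (L_sq b q) (sqintZ (-1) (L_sq a q)) (sqint_cst P 1).
rewrite ipZl //; last exact: sqint_cst.
rewrite !ip_cst //; last by apply: sqintD => //; exact: sqintZ.
rewrite !M !mulr0 addr0 mul1r => <-; apply: eq_Rintegral => w _.
by rewrite /levy_incr mulN1r.
Qed.

Section Step.
Variables (m : nat) (a b : 'I_m -> R) (c : 'I_m -> 'I_k -> R).
(** One row of a matrix-valued step function and the corresponding coordinate of
   its integral. *)
Definition stepf (q : 'I_k) (u : R) : R := \sum_j c j q * itv_ind (a j) (b j) u.
Definition stepI (w : T) : R := \sum_j \sum_q c j q * levy_incr (a j) (b j) q w.

Lemma stepf_sqint q : sqint leb (stepf q).
Proof. by apply: sqint_sum => j; apply: sqintZ; exact: itv_ind_sqint. Qed.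

Lemma stepI_sqint : sqint P stepI.
Proof. by apply: sqint_sum => j; apply: sqint_sum => q; apply: sqintZ; exact: levy_incr_sqint. Qed.
End Step.

Lemma ip_sum2 (d' : measure_display) (T' : measurableType d') (mu : {measure set T' -> \bar R})
    (I J : finType) (f : I -> T' -> R) (g : J -> T' -> R) (x : I -> R) (y : J -> R) :
  (forall i, sqint mu (f i)) -> (forall j, sqint mu (g j)) ->
  ip mu (fun t => \sum_i x i * f i t) (fun t => \sum_j y j * g j t) =
  \sum_i \sum_j x i * y j * ip mu (f i) (g j).
Proof.
move=> hf hg.
have hx i : sqint mu (fun t => x i * f i t) by exact: sqintZ.
have hy j : sqint mu (fun t => y j * g j t) by exact: sqintZ.
rewrite ip_suml //; last exact: sqint_sum.
apply: eq_bigr => i _; rewrite ip_sumr //; apply: eq_bigr => j _.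
by rewrite ipZl // ipZr // mulrA.
Qed.

Lemma step_isometry m m' (a b : 'I_m -> R) c (a' b' : 'I_m' -> R) c' :
  (forall j, a j <= b j) -> (forall j, a' j <= b' j) ->
  ip P (stepI a b c) (stepI a' b' c') =
  \sum_q \sum_q' C q q' * ip leb (stepf a b c q) (stepf a' b' c' q').
Proof.
move=> ab ab'.
have S1 j : sqint P (fun w => \sum_q c j q * levy_incr (a j) (b j) q w).
  by apply: sqint_sum => q; apply: sqintZ; exact: levy_incr_sqint.
have S2 j : sqint P (fun w => \sum_q c' j q * levy_incr (a' j) (b' j) q w).
  by apply: sqint_sum => q; apply: sqintZ; exact: levy_incr_sqint.
rewrite /stepI ip_suml //; last exact: sqint_sum.
transitivity (\sum_j \sum_j' \sum_q \sum_q' c j q * c' j' q' *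
   (C q q' * ip leb (itv_ind (a j) (b j)) (itv_ind (a' j') (b' j')))).
  apply: eq_bigr => j _; rewrite ip_sumr //; apply: eq_bigr => j' _.
  rewrite ip_sum2; try (by move=> q; exact: levy_incr_sqint).
  by apply: eq_bigr => q _; apply: eq_bigr => q' _; rewrite levy_incr_ip.
under [RHS]eq_bigr => q _.
  under eq_bigr => q' _.
    rewrite /stepf ip_sum2; try (by move=> j; exact: itv_ind_sqint).
    rewrite mulr_sumr; under eq_bigr do rewrite mulr_sumr.
    over.
  over.
symmetry; under eq_bigr do rewrite exchange_big /=.
rewrite exchange_big /=; apply: eq_bigr => j _.
under eq_bigr do rewrite exchange_big /=.
rewrite exchange_big /=; apply: eq_bigr => j' _.
by apply: eq_bigr => q _; apply: eq_bigr => q' _; ring.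
Qed.

(** J is the integral of the row f against L; the two approximations are measured
   by the inner product, so that the calculus of [ip] applies. *)
Definition is_wiener (f : 'I_k -> R -> R) (J : T -> R) : Prop :=
  [/\ forall q, sqint leb (f q), sqint P J &
   forall e : R, 0 < e -> exists m (a b : 'I_m -> R) (c : 'I_m -> 'I_k -> R),
    [/\ forall j, a j <= b j,
        forall q, ip leb (fun u => f q u - stepf a b c q u) (fun u => f q u - stepf a b c q u) < e &
        ip P (fun w => J w - stepI a b c w) (fun w => J w - stepI a b c w) < e]].

Lemma wiener_seq f J : is_wiener f J ->
  exists (s : nat -> 'I_k -> R -> R) (S : nat -> T -> R),
  [/\ forall N, exists m (a b : 'I_m -> R) c,
        [/\ forall j, a j <= b j, s N = stepf a b c & S N = stepI a b c],
      forall q, ip leb (fun u => f q u - s N q u) (fun u => f q u - s N q u) @[N --> \oo] --> (0 : R) &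
      ip P (fun w => J w - S N w) (fun w => J w - S N w) @[N --> \oo] --> (0 : R)].
Proof.
move=> [hf hJ H].
have H' (N : nat) : exists sS : ('I_k -> R -> R) * (T -> R),
   [/\ exists m (a b : 'I_m -> R) c,
        [/\ forall j, a j <= b j, sS.1 = stepf a b c & sS.2 = stepI a b c],
       forall q, ip leb (fun u => f q u - sS.1 q u) (fun u => f q u - sS.1 q u) < N.+1%:R^-1 &
       ip P (fun w => J w - sS.2 w) (fun w => J w - sS.2 w) < N.+1%:R^-1].
  have [|m [a [b [c [ab h1 h2]]]]] := H (N.+1%:R^-1); first by rewrite invr_gt0.
  by exists (stepf a b c, stepI a b c); split => //=; exists m, a, b, c.
have [sS hs] := choice H'.
exists (fun N => (sS N).1), (fun N => (sS N).2); split.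
- by move=> N; case: (hs N).
- move=> q; apply: (@squeeze_cvgr _ _ _ _ (fun=> 0) (fun N : nat => N.+1%:R^-1)).
  + by apply: nearW => N; rewrite ip_ge0 /=; case: (hs N) => _ h _; exact: ltW.
  + exact: cvg_cst.
  + exact: cvg_harmonic.
- apply: (@squeeze_cvgr _ _ _ _ (fun=> 0) (fun N : nat => N.+1%:R^-1)).
  + by apply: nearW => N; rewrite ip_ge0 /=; case: (hs N) => _ _ h; exact: ltW.
  + exact: cvg_cst.
  + exact: cvg_harmonic.
Qed.

(** Both sides are continuous in the mean-square sense and agree on step
   functions by [step_isometry]. *)
Theorem wiener_isometry f J g J' : is_wiener f J -> is_wiener g J' ->
  ip P J J' = \sum_q \sum_q' C q q' * ip leb (f q) (g q').
Proof.
move=> hf hg; have [sf sJ _] := hf; have [sg sJ' _] := hg.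
have [s [S [h1 h2 h3]]] := wiener_seq hf.
have [s' [S' [h1' h2' h3']]] := wiener_seq hg.
have ss N q : sqint leb (s N q).
  by have [m [a [b [c [_ -> _]]]]] := h1 N; exact: stepf_sqint.
have ss' N q : sqint leb (s' N q).
  by have [m [a [b [c [_ -> _]]]]] := h1' N; exact: stepf_sqint.
have sS N : sqint P (S N).
  by have [m [a [b [c [_ _ ->]]]]] := h1 N; exact: stepI_sqint.
have sS' N : sqint P (S' N).
  by have [m [a [b [c [_ _ ->]]]]] := h1' N; exact: stepI_sqint.
have c1 : ip P (S N) (S' N) @[N --> \oo] --> ip P J J' by exact: ip_cvg.
have c2 : ip P (S N) (S' N) @[N --> \oo] --> \sum_q \sum_q' C q q' * ip leb (f q) (g q').
  have -> : (fun N => ip P (S N) (S' N)) =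
      (fun N => \sum_q \sum_q' C q q' * ip leb (s N q) (s' N q')).
    apply/funext => N.
    have [m [a [b [c [ab -> ->]]]]] := h1 N; have [m' [a' [b' [c' [ab' -> ->]]]]] := h1' N.
    exact: step_isometry.
  apply: cvg_bigsum => q; apply: cvg_bigsum => q'; apply: cvgMl_tmp.
  exact: ip_cvg.
exact: (cvg_unique _ c1 c2).
Qed.

Lemma wiener_mean f J : is_wiener f J -> \int[P]_w J w = 0.
Proof.
move=> hf; have [sf sJ _] := hf.
have [s [S [h1 h2 h3]]] := wiener_seq hf.
have sS N : sqint P (S N).
  by have [m [a [b [c [_ _ ->]]]]] := h1 N; exact: stepI_sqint.
have s1 := sqint_cst P 1.
have c1 : ip P (S N) (fun=> 1) @[N --> \oo] --> ip P J (fun=> 1).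
  apply: (@ip_cvg _ _ _ _ S (fun _ _ => 1)) => //.
  under eq_fun do rewrite /ip subrr mul0r.
  by rewrite rint0; exact: cvg_cst.
have c2 : ip P (S N) (fun=> 1) @[N --> \oo] --> (0 : R).
  have -> : (fun N => ip P (S N) (fun=> 1)) = fun=> 0; last exact: cvg_cst.
  apply/funext => N; have [m [a [b [c [ab _ ->]]]]] := h1 N.
  have S1 j : sqint P (fun w => \sum_q c j q * levy_incr (a j) (b j) q w).
    by apply: sqint_sum => q; apply: sqintZ; exact: levy_incr_sqint.
  rewrite /stepI ip_suml // big1 // => j _; rewrite ip_suml //; last first.
    by move=> q; apply: sqintZ; exact: levy_incr_sqint.
  rewrite big1 // => q _; rewrite ipZl //; last exact: levy_incr_sqint.
  by rewrite ip_cst ?levy_incr_mean ?mulr0 //; exact: levy_incr_sqint.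
have := cvg_unique _ c1 c2; rewrite ip_cst // mul1r; exact.
Qed.

Lemma wiener_incr a b q0 : a <= b ->
  is_wiener (fun q u => (q == q0)%:R * itv_ind a b u) (levy_incr a b q0).
Proof.
move=> ab; split.
- by move=> q; apply: sqintZ; exact: itv_ind_sqint.
- exact: levy_incr_sqint.
move=> e e0; exists 1%N, (fun=> a), (fun=> b), (fun _ q => (q == q0)%:R); split => //.
  by move=> q; rewrite ip_zero // => u; rewrite /stepf big_ord1 subrr mul0r.
rewrite ip_zero // => w; rewrite /stepI big_ord1 (bigD1 q0) //= big1 ?addr0.
  by rewrite eqxx mul1r subrr mul0r.
by move=> q qq; rewrite (negbTE qq) mul0r.
Qed.

(** Rows of a matrix-valued integrand: a coordinate is dominated by the Frobenius
   norm. Square-integrability of f and J is not part of the definition of the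
   integral; it follows because both are at finite distance from step functions. *)
Lemma levy_integral_wiener m (f : R -> 'M[R]_(m, k)) (J : T -> 'cV[R]_m) (r : 'I_m) :
  (forall r q, measurable_fun setT (fun u => f u r q)) ->
  random_vector J -> levy_integral P L f J ->
  is_wiener (fun q u => f u r q) (fun w => J w r 0).
Proof.
move=> mf rJ hJ.
have mJ i : measurable_fun setT (fun w => J w i 0) by exact: random_vector_coord.
have step e : 0 < e -> exists m (a b : 'I_m -> R) (c : 'I_m -> 'I_k -> R),
    [/\ forall j, a j <= b j,
        forall q, sqint leb (fun u => f u r q - stepf a b c q u) /\
          ip leb (fun u => f u r q - stepf a b c q u) (fun u => f u r q - stepf a b c q u) < e,
        sqint P (fun w => J w r 0 - stepI a b c w) &
        ip P (fun w => J w r 0 - stepI a b c w) (fun w => J w r 0 - stepI a b c w) < e].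
  move=> e0; have [m' [a [b [M [ab h1 h2]]]]] := hJ e e0.
  pose c j q := M j r q.
  exists m', a, b, c.
  have sE u i q : step_fun a b M u i q = stepf a b (fun j q => M j i q) q u.
    rewrite /step_fun summxE /stepf; apply: eq_bigr => j _; rewrite mxE /itv_ind mulrC //.
  have SE w i : step_integral a b M L w i 0 = stepI a b (fun j q => M j i q) w.
    rewrite /step_integral summxE /stepI; apply: eq_bigr => j _; rewrite mxE.
    by apply: eq_bigr => q _; rewrite /levy_incr !mxE.
  have H1 q : sqint leb (fun u => f u r q - stepf a b c q u) /\
          ip leb (fun u => f u r q - stepf a b c q u) (fun u => f u r q - stepf a b c q u) < e.
    apply: ip_lt.
      by apply: measurable_funB; [exact: mf|case: (stepf_sqint a b c q)].
    apply: le_lt_trans h1; apply: ge0_le_integral => //.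
    - by move=> u _; rewrite lee_fin sqr_ge0.
    - apply/measurable_EFinP; apply: measurable_funX.
      by apply: measurable_funB; [exact: mf|case: (stepf_sqint a b c q)].
    - apply/measurable_EFinP; rewrite /frobsq; apply: measurable_sum => i.
      apply: measurable_sum => j; apply: measurable_funX.
      under eq_fun do rewrite !mxE sE.
      by apply: measurable_funB; [exact: mf|case: (stepf_sqint a b (fun j0 q => M j0 i q) j)].
    - move=> u _; rewrite lee_fin /frobsq (bigD1 r) //= (bigD1 q) //= !mxE sE -addrA lerDl.
      rewrite addr_ge0 // sumr_ge0 // => i _; first by rewrite sqr_ge0.
      by rewrite sumr_ge0 // => j _; rewrite sqr_ge0.
  have mS i : measurable_fun setT (fun w => (J w - step_integral a b M L w) i 0).
    under eq_fun do rewrite !mxE SE.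
    by apply: measurable_funB => //; case: (stepI_sqint a b (fun j q => M j i q)).
  have [s1 s2] : sqint P (fun w => J w r 0 - stepI a b c w) /\
        ip P (fun w => J w r 0 - stepI a b c w) (fun w => J w r 0 - stepI a b c w) < e.
    apply: ip_lt.
      by apply: measurable_funB => //; case: (stepI_sqint a b c).
    have := frobsq_lt_coord r mS h2.
    apply: le_lt_trans; rewrite le_eqVlt; apply/orP; left; apply/eqP/eq_integral => w _.
    by rewrite !mxE SE.
  by split.
have [m1 [a [b [c [ab h1 h2 h3]]]]] := step 1 ltr01.
split.
- move=> q; have := sqintD (h1 q).1 (stepf_sqint a b c q).
  by congr sqint; apply/funext => u; rewrite subrK.
- have := sqintD h2 (stepI_sqint a b c).
  by congr sqint; apply/funext => u; rewrite subrK.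
move=> e e0; have [m2 [a2 [b2 [c2 [ab2 h12 h22 h32]]]]] := step e e0.
by exists m2, a2, b2, c2; split => // q; case: (h12 q).
Qed.

End LevyIntegral.

(** * The remote past *)

Section Past.
Context {R : realType} {d : measure_display} {T : measurableType d}.
Variable P : probability T R.
Notation leb := (@lebesgue_measure R).

(** By Cauchy-Schwarz |<Z, D>|^2 <= |Z - S|^2 |D|^2; the tolerance below makes
   the right-hand side smaller than the left. *)
Lemma orth_limit (Z D : T -> R) : sqint P Z -> sqint P D ->
  (forall e : R, 0 < e -> exists S, [/\ sqint P S,
     ip P (fun w => Z w - S w) (fun w => Z w - S w) < e & ip P S D = 0]) ->
  ip P Z D = 0.
Proof.
move=> hZ hD H; apply/eqP; case: eqP => // /eqP ne; exfalso.
have x0 : 0 < `|ip P Z D| by rewrite normr_gt0.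
have D0 := ip_ge0 P D.
have D1 : 0 < ip P D D + 1 by lra.
pose e := `|ip P Z D| ^+ 2 / (ip P D D + 1).
have e0 : 0 < e by rewrite divr_gt0 // exprn_gt0.
have [S [hS hlt h0]] := H e e0.
have hZS := sqintB hZ hS.
have E : ip P Z D = ip P (fun w => Z w - S w) D.
  transitivity (ip P (fun w => Z w + -1 * S w) D).
    by rewrite ipDl ?ipZl ?h0 ?mulr0 ?addr0 //; exact: sqintZ.
  by congr ip; apply/funext => w; rewrite mulN1r.
have := ip_CS hZS hD; rewrite -E => CS.
have : `|ip P Z D| ^+ 2 <= ip P (fun w => Z w - S w) (fun w => Z w - S w) * ip P D D.
  rewrite -[X in X * _]sqr_sqrtr ?ip_ge0 // -[X in _ * X]sqr_sqrtr // -exprMn.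
  by rewrite lerXn2r // nnegrE ?mulr_ge0 ?sqrtr_ge0.
apply/negP; rewrite -ltNge.
have : ip P (fun w => Z w - S w) (fun w => Z w - S w) * ip P D D <= e * ip P D D.
  by rewrite ler_wpM2r // ltW.
move=> /le_lt_trans; apply.
rewrite /e mulrAC ltr_pdivrMr // ltr_pM2l ?exprn_gt0 //; lra.
Qed.

Variables (k : nat) (L : R -> T -> 'cV[R]_k).
Hypothesis hL : driving_levy P L.
Variables (n0 k' : nat) (X : R -> T -> 'cV[R]_n0) (M : 'M[R]_(k', n0)) (Y : R -> T -> 'cV[R]_k').
Hypothesis hX : forall u r, exists2 f, is_wiener P L f (fun w => X u w r 0) &
  forall q x, u < x -> f q x = 0.
Hypothesis YX : forall u w, Y u w = M *m X u w.

Let Xsq u r : sqint P (fun w => X u w r 0).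
Proof. by have [f []] := hX u r. Qed.

Let YE u v : (fun w => Y u w v 0) = (fun w => \sum_r M v r * X u w r 0).
Proof. by apply/funext => w; rewrite YX mxE. Qed.

Let Ysq u v : sqint P (fun w => Y u w v 0).
Proof. by rewrite YE; apply: sqint_sum => r; exact: sqintZ. Qed.

Let Yorth u v D : sqint P D -> (forall r, ip P (fun w => X u w r 0) D = 0) ->
  ip P (fun w => Y u w v 0) D = 0.
Proof.
move=> hD h; rewrite YE ip_suml //; last by move=> r; exact: sqintZ.
by rewrite big1 // => r _; rewrite ipZl // h mulr0.
Qed.

(** The real counterpart of [past_space], to which real and imaginary parts of
   its elements belong. *)
Definition real_past (t : R) (Z : T -> R) : Prop := sqint P Z /\
  forall e : R, 0 < e -> exists n (c : 'I_n -> R) v u, (forall j, u j <= t) /\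
    let S := (fun w => \sum_j c j * Y (u j) w (v j) 0) in
    ip P (fun w => Z w - S w) (fun w => Z w - S w) < e.

Lemma real_past_orth t Z D : real_past t Z -> sqint P D ->
  (forall u v, u <= t -> ip P (fun w => Y u w v 0) D = 0) -> ip P Z D = 0.
Proof.
move=> [hZ H] hD h0; apply: orth_limit => // e /H[n [c [v [u [ut h]]]]].
exists (fun w => \sum_j c j * Y (u j) w (v j) 0); split => //.
  by apply: sqint_sum => j; exact: sqintZ.
rewrite ip_suml //; last by move=> j; exact: sqintZ.
by rewrite big1 // => j _; rewrite ipZl // h0 // mulr0.
Qed.

(** By the isometry, since the integrands live on ]-oo, a] and on ]a, b]. *)
Lemma past_orth_future u v a b q : u <= a -> a <= b ->
  ip P (fun w => Y u w v 0) (levy_incr L a b q) = 0.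
Proof.
move=> ua ab; apply: Yorth => [|r]; first exact: levy_incr_sqint.
have [f wf f0] := hX u r.
rewrite (wiener_isometry hL wf (wiener_incr hL q ab)).
rewrite big1 // => q1 _; rewrite big1 // => q2 _.
rewrite ip_zero ?mulr0 // => x; case: (ltP u x) => ux; first by rewrite f0 // mul0r.
by rewrite /itv_ind (ltNge a) (le_trans ux ua) /= !mulr0.
Qed.

(** Z lies in the past of a, hence is orthogonal to every increment over ]a, b];
   the variables Y u are limits of combinations of increments, so that Z is
   orthogonal to them, and finally to itself, being one of their limits. *)
Lemma remote_past0 Z : (forall t, real_past t Z) -> ip P Z Z = 0.
Proof.
move=> hZ; have sZ := (hZ 0).1.
have Z_incr a b q : a <= b -> ip P (levy_incr L a b q) Z = 0.
  move=> ab; rewrite ipC; apply: (real_past_orth (hZ a)); first exact: levy_incr_sqint.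
  by move=> u v ua; exact: past_orth_future.
apply: (real_past_orth (hZ 0)) => // u v _; apply: Yorth => // r.
have [f [_ _ H] _] := hX u r.
apply: orth_limit => // e /H[m [a [b [c [ab _ h]]]]].
exists (stepI L a b c); split => //; first exact: stepI_sqint.
rewrite /stepI ip_suml //; last first.
  by move=> j; apply: sqint_sum => q; apply: sqintZ; exact: levy_incr_sqint.
rewrite big1 // => j _; rewrite ip_suml //; last first.
  by move=> q; apply: sqintZ; exact: levy_incr_sqint.
rewrite big1 // => q _; rewrite ipZl //; last exact: levy_incr_sqint.
by rewrite Z_incr // mulr0.
Qed.

Lemma normc_sqr (z : R[i]) : Normc.normc z ^+ 2 = complex.Re z ^+ 2 + complex.Im z ^+ 2.
Proof. by case: z => a b /=; rewrite sqr_sqrtr // addr_ge0 ?sqr_ge0. Qed.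

Lemma measurable_normc2 (F : T -> R[i]) :
  measurable_fun setT (fun w => complex.Re (F w)) ->
  measurable_fun setT (fun w => complex.Im (F w)) ->
  measurable_fun setT (fun w => (Normc.normc (F w) ^+ 2)%:E).
Proof.
move=> h1 h2; apply/measurable_EFinP; under eq_fun do rewrite normc_sqr.
by apply: measurable_funD; exact: measurable_funX.
Qed.

(** Stated for a projection pr so as to serve for both parts of Z. *)
Lemma real_past_part (pr : R[i] -> R) t Z : 
  (forall z, pr z ^+ 2 <= Normc.normc z ^+ 2) ->
  (forall x y, pr (x - y) = pr x - pr y) ->
  (forall n (F : 'I_n -> R[i]), pr (\sum_j F j) = \sum_j pr (F j)) ->
  (forall z (r : R), pr (z * r%:C%C) = pr z * r) ->
  measurable_fun setT (fun w => pr (Z w)) ->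
  past_space P Y t Z -> real_past t (fun w => pr (Z w)).
Proof.
move=> prn prB prS prM mpr [[mRe mIm Zfin] H].
split.
  apply: sqint_lty => //; apply: le_lt_trans Zfin; apply: ge0_le_integral => //.
  - by move=> w _; rewrite lee_fin sqr_ge0.
  - by apply/measurable_EFinP; exact: measurable_funX.
  - exact: measurable_normc2.
  - by move=> w _; rewrite lee_fin.
move=> e /H[n [c [v [u [ut h]]]]]; exists n, (fun j => pr (c j)), v, u; split => //=.
have mY j : measurable_fun setT (fun w => Y (u j) w (v j) 0) by case: (Ysq (u j) (v j)).
have SE w : pr (Z w) - \sum_j pr (c j) * Y (u j) w (v j) 0 =
    pr (Z w - \sum_(j < n) c j * (Y (u j) w (v j) 0)%:C%C).
  by rewrite prB prS; congr (_ - _); apply: eq_bigr => j _; rewrite prM.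
have mS : measurable_fun setT (fun w => pr (Z w) - \sum_j pr (c j) * Y (u j) w (v j) 0).
  apply: measurable_funB => //; apply: measurable_sum => j; exact: measurable_funM.
apply: (ip_lt mS _).2; apply: le_lt_trans h; apply: ge0_le_integral => //.
- by move=> w _; rewrite lee_fin sqr_ge0.
- by apply/measurable_EFinP; exact: measurable_funX.
- apply: measurable_normc2.
    under eq_fun => w do rewrite raddfB /= Re_sum.
    apply: measurable_funB => //; apply: measurable_sum => j.
    under eq_fun => w do rewrite Re_mul /= mulr0 subr0.
    exact: measurable_funM.
  under eq_fun => w do rewrite raddfB /= Im_sum.
  apply: measurable_funB => //; apply: measurable_sum => j.
  under eq_fun => w do rewrite Im_mul /= mulr0 add0r.
  exact: measurable_funM.
- by move=> w _; rewrite lee_fin SE prn.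
Qed.

Theorem remote_past_trivial : purely_nondeterministic P Y.
Proof.
apply/seteqP; split => [Z hZ|Z [hZ Z0] t _]; last first.
  split => // e e0.
  have no : 'I_0 -> False by case.
  exists 0%N, (fun=> 0), (fun j => False_rect _ (no j)), (fun=> 0); split; first by case.
  have [mRe mIm _] := hZ.
  have -> : (fun w => (Normc.normc (Z w - \sum_(j < 0)
     0 * (Y 0 w (False_rect 'I_k' (no j)) 0)%:C%C) ^+ 2)%:E) = (fun w => (Normc.normc (Z w) ^+ 2)%:E).
    by apply/funext => w; rewrite big_ord0 subr0.
  rewrite (ae_eq_integral (cst 0%E)) ?integral0 ?lte_fin //.
    exact: measurable_normc2.
  apply: filterS Z0 => w -> _; by rewrite /= expr0n /= addr0 sqrtr0 expr0n.
have hL2 : L2C P Z by have [] := hZ 0 I.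
have [mRe mIm _] := hL2.
have hRe t : real_past t (fun w => complex.Re (Z w)).
  apply: (@real_past_part (@complex.Re R)) (hZ t I) => //.
  - by move=> z; rewrite normc_sqr lerDl sqr_ge0.
  - by move=> x y; rewrite raddfB.
  - by move=> n F; rewrite Re_sum.
  - by move=> z r; rewrite Re_mul /= mulr0 subr0.
have hIm t : real_past t (fun w => complex.Im (Z w)).
  apply: (@real_past_part (@complex.Im R)) (hZ t I) => //.
  - by move=> z; rewrite normc_sqr lerDr sqr_ge0.
  - by move=> x y; rewrite raddfB.
  - by move=> n F; rewrite Im_sum.
  - by move=> z r; rewrite Im_mul /= mulr0 add0r.
split => //.
have r0 := ip_eq0_ae (hRe 0).1 (remote_past0 hRe).
have i0 := ip_eq0_ae (hIm 0).1 (remote_past0 hIm).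
apply: filterS2 r0 i0 => w; by case: (Z w) => a b /= -> ->.
Qed.
End Past.

(** * Half-line integrals of matrices, Gramian and resolvent *)

Section DecayingFunctions.
Context {R : realType}.
Notation mu := (@lebesgue_measure R).
Notation Hl := (`[0%R, +oo[%classic : set R).

(** The class of functions for which the integral over the half-line is linear;
   it contains the entries of e^(sA) and is stable under the operations needed. *)
Definition decaying (f : R -> R) : Prop := continuous f /\ exp_decay f.
Definition half_int (f : R -> R) : R := \int[mu]_(x in Hl) f x.

Lemma decaying_integrable f : decaying f -> mu.-integrable Hl (EFin \o f).
Proof. by move=> [cf ef]; apply: exp_decay_integrable => //; exact: continuous_measurable_fun. Qed.

Lemma decaying0 : decaying (fun=> 0).
Proof. by split; [move=> x; exact: cvg_cst|exact: exp_decay0]. Qed.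

Lemma decayingD f g : decaying f -> decaying g -> decaying (fun s => f s + g s).
Proof.
move=> [cf ef] [cg eg]; split; last exact: exp_decayD.
by move=> x; apply: cvgD; [exact: cf|exact: cg].
Qed.

Lemma decayingZ (c : R) f : decaying f -> decaying (fun s => c * f s).
Proof.
move=> [cf ef]; split; last exact: exp_decayZ.
by move=> x; apply: cvgMl_tmp; exact: cf.
Qed.

Lemma decaying_sum n (f : 'I_n -> R -> R) :
  (forall i, decaying (f i)) -> decaying (fun s => \sum_i f i s).
Proof.
move=> H; split; last by apply: exp_decay_sum => i; case: (H i).
by move=> x; apply: cvg_bigsum => i; case: (H i) => + _; apply.
Qed.

Lemma decayingM f g : decaying f -> decaying g -> decaying (fun s => f s * g s).
Proof.
move=> [cf ef] [cg eg]; split; last exact: exp_decayM.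
by move=> x; apply: cvgM; [exact: cf|exact: cg].
Qed.

Lemma decaying_bounded (M : R) (f g : R -> R) : (forall s, `|g s| <= M) -> continuous g ->
  decaying f -> decaying (fun s => g s * f s).
Proof.
move=> hg cg [cf ef]; split; first by move=> x; apply: cvgM; [exact: cg|exact: cf].
under eq_fun do rewrite mulrC.
by apply: (@exp_decay_bounded _ _ _ M) => // s _; exact: hg.
Qed.

Lemma decaying_cos l f : decaying f -> decaying (fun s => cos (l * s) * f s).
Proof.
apply: (@decaying_bounded 1); last exact: continuous_cosZ.
by move=> s; exact: cos_max.
Qed.

Lemma decaying_sin l f : decaying f -> decaying (fun s => sin (l * s) * f s).
Proof.
apply: (@decaying_bounded 1); last exact: continuous_sinZ.
by move=> s; exact: sin_max.
Qed.

Lemma half_intD f g : decaying f -> decaying g ->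
  half_int (fun s => f s + g s) = half_int f + half_int g.
Proof. by move=> hf hg; apply: RintegralD => //; exact: decaying_integrable. Qed.

Lemma half_intZ c f : decaying f -> half_int (fun s => c * f s) = c * half_int f.
Proof. by move=> hf; apply: RintegralZl => //; exact: decaying_integrable. Qed.

Lemma half_int0 : half_int (fun=> 0) = 0.
Proof.
rewrite -[RHS](mul0r (half_int (fun=> 0))) -(half_intZ _ decaying0).
by congr half_int; apply/funext => s; rewrite mulr0.
Qed.

Lemma half_int_sum n (f : 'I_n -> R -> R) : (forall i, decaying (f i)) ->
  half_int (fun s => \sum_i f i s) = \sum_i half_int (f i).
Proof.
move=> hf; elim: n f hf => [|n IH] f hf.
  by rewrite big_ord0 -[RHS]half_int0; congr half_int; apply/funext => s; rewrite big_ord0.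
rewrite big_ord_recl -IH // -half_intD //; last exact: decaying_sum.
by congr half_int; apply/funext => s; rewrite big_ord_recl.
Qed.

Lemma decaying_norm (f : R -> R) : decaying f -> decaying (fun s => `|f s|).
Proof.
move=> [cf [K [c [K0 c0 H]]]]; split; first by move=> x; apply: cvg_norm; exact: cf.
by exists K, c; split => // s s0; rewrite normr_id H.
Qed.

(** The bound does not depend on the bounded factor, in particular not on the
   frequency when that factor is a sine or cosine. *)
Lemma half_int_bounded (f g : R -> R) : decaying f -> continuous g -> (forall s, `|g s| <= 1) ->
  `|half_int (fun s => g s * f s)| <= half_int (fun s => `|f s|).
Proof.
move=> hf cg g1.
have hgf := decaying_bounded g1 cg hf.
have hn := decaying_norm hf.
apply: (le_trans (le_normr_Rintegral _ _)) => //; first exact: decaying_integrable.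
apply: le_Rintegral => //.
- have := decaying_integrable hgf; exact: integrable_norm.
- exact: decaying_integrable.
- by move=> s _; rewrite normrM ler_piMl.
Qed.

(** Measurability of the spectral density comes from here. *)
Lemma continuous_transform (w f : R -> R) : decaying f -> continuous w -> (forall s, `|w s| <= 1) ->
  continuous (fun l : R => half_int (fun s => w (l * s) * f s)).
Proof.
move=> hf cw w1 l.
have hn := decaying_norm hf.
have cws (x : R) : continuous (fun s : R => w (x * s)).
  move=> s; apply: continuous_comp; last exact: cw.
  by apply: cvgMl_tmp; exact: cvg_id.
apply: (@continuity_under_integral R _ _ mu (fun l s : R => w (l * s) * f s) Hl _ (l - 1) (l + 1) _ _ (fun s => `|f s|)) => //.
- move=> x _; apply: decaying_integrable; apply: (@decaying_bounded 1) => //.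
- apply: aeW => s _ x _; apply: cvgMr_tmp; apply: continuous_comp; last exact: cw.
  by apply: cvgMr_tmp; exact: cvg_id.
- exact: decaying_integrable.
- by move=> x _; apply: aeW => s _; rewrite normrM ler_piMl.
- by rewrite inE /= in_itv /=; apply/andP; split; lra.
Qed.

Section Matrices.
Definition decaying_mx m n (F : R -> 'M[R]_(m, n)) : Prop := forall i j, decaying (fun s => F s i j).
Definition half_intm m n (F : R -> 'M[R]_(m, n)) : 'M[R]_(m, n) :=
  \matrix_(i, j) half_int (fun s => F s i j).
Definition mderiv m n (F G : R -> 'M[R]_(m, n)) : Prop :=
  forall s i j, is_derive s (1 : R) (fun s => F s i j) (G s i j).

Lemma mdecM m n q (F : R -> 'M[R]_(m, n)) (G : R -> 'M[R]_(n, q)) :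
  decaying_mx F -> decaying_mx G -> decaying_mx (fun s => F s *m G s).
Proof.
move=> hF hG i j; under eq_fun do rewrite mxE.
by apply: decaying_sum => l; exact: decayingM.
Qed.

Lemma mdecMl m n q (N : 'M[R]_(m, n)) (G : R -> 'M[R]_(n, q)) :
  decaying_mx G -> decaying_mx (fun s => N *m G s).
Proof.
move=> hG i j; under eq_fun do rewrite mxE.
by apply: decaying_sum => l; exact: decayingZ.
Qed.

Lemma mdecMr m n q (G : R -> 'M[R]_(m, n)) (N : 'M[R]_(n, q)) :
  decaying_mx G -> decaying_mx (fun s => G s *m N).
Proof.
move=> hG i j; under eq_fun do rewrite mxE.
apply: decaying_sum => l; under eq_fun do rewrite mulrC.
exact: decayingZ.
Qed.

Lemma mdecD m n (F G : R -> 'M[R]_(m, n)) : decaying_mx F -> decaying_mx G -> decaying_mx (fun s => F s + G s).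
Proof. by move=> hF hG i j; under eq_fun do rewrite mxE; exact: decayingD. Qed.

Lemma mdecZ m n (c : R) (F : R -> 'M[R]_(m, n)) : decaying_mx F -> decaying_mx (fun s => c *: F s).
Proof. by move=> hF i j; under eq_fun do rewrite mxE; exact: decayingZ. Qed.

Lemma mdecT m n (F : R -> 'M[R]_(m, n)) : decaying_mx F -> decaying_mx (fun s => (F s)^T).
Proof. by move=> hF i j; under eq_fun do rewrite mxE. Qed.

Lemma mdec_cos m n l (F : R -> 'M[R]_(m, n)) : decaying_mx F -> decaying_mx (fun s => cos (l * s) *: F s).
Proof. by move=> hF i j; under eq_fun do rewrite mxE; exact: decaying_cos. Qed.

Lemma mdec_sin m n l (F : R -> 'M[R]_(m, n)) : decaying_mx F -> decaying_mx (fun s => sin (l * s) *: F s).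
Proof. by move=> hF i j; under eq_fun do rewrite mxE; exact: decaying_sin. Qed.

Lemma half_intmD m n (F G : R -> 'M[R]_(m, n)) : decaying_mx F -> decaying_mx G ->
  half_intm (fun s => F s + G s) = half_intm F + half_intm G.
Proof.
move=> hF hG; apply/matrixP => i j; rewrite !mxE -half_intD //.
by congr half_int; apply/funext => s; rewrite mxE.
Qed.

Lemma half_intmZ m n (c : R) (F : R -> 'M[R]_(m, n)) : decaying_mx F ->
  half_intm (fun s => c *: F s) = c *: half_intm F.
Proof.
move=> hF; apply/matrixP => i j; rewrite !mxE -half_intZ //.
by congr half_int; apply/funext => s; rewrite mxE.
Qed.

Lemma half_intmMl m n q (N : 'M[R]_(m, n)) (G : R -> 'M[R]_(n, q)) : decaying_mx G ->
  half_intm (fun s => N *m G s) = N *m half_intm G.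
Proof.
move=> hG; apply/matrixP => i j; rewrite !mxE.
transitivity (half_int (fun s => \sum_l N i l * G s l j)).
  by congr half_int; apply/funext => s; rewrite mxE.
rewrite half_int_sum; last by move=> l; exact: decayingZ.
by apply: eq_bigr => l _; rewrite half_intZ // mxE.
Qed.

Lemma half_intmT m n (F : R -> 'M[R]_(m, n)) : half_intm (fun s => (F s)^T) = (half_intm F)^T.
Proof.
by apply/matrixP => i j; rewrite !mxE; congr half_int; apply/funext => s; rewrite mxE.
Qed.

Lemma half_intmMr m n q (G : R -> 'M[R]_(m, n)) (N : 'M[R]_(n, q)) : decaying_mx G ->
  half_intm (fun s => G s *m N) = half_intm G *m N.
Proof.
move=> hG; apply: trmx_inj; rewrite -half_intmT trmx_mul -half_intmT -half_intmMl; last exact: mdecT.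
by congr half_intm; apply/funext => s; rewrite trmx_mul.
Qed.

Lemma mderivM m n q (F F' : R -> 'M[R]_(m, n)) (G G' : R -> 'M[R]_(n, q)) :
  mderiv F F' -> mderiv G G' ->
  mderiv (fun s => F s *m G s) (fun s => F' s *m G s + F s *m G' s).
Proof.
move=> hF hG s i j.
have -> : (fun s => (F s *m G s) i j) = (fun s => \sum_l F s i l * G s l j).
  by apply/funext => x; rewrite mxE.
rewrite !mxE -big_split /=.
by apply: is_derive_bigsum => l; exact: is_derive_mul.
Qed.

Lemma mderivT m n (F F' : R -> 'M[R]_(m, n)) : mderiv F F' ->
  mderiv (fun s => (F s)^T) (fun s => (F' s)^T).
Proof. by move=> hF s i j; rewrite mxE; under eq_fun do rewrite mxE; exact: hF. Qed.

Lemma mderivMl m n q (N : 'M[R]_(m, n)) (G G' : R -> 'M[R]_(n, q)) :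
  mderiv G G' -> mderiv (fun s => N *m G s) (fun s => N *m G' s).
Proof.
move=> hG s i j.
have -> : (fun s => (N *m G s) i j) = (fun s => \sum_l N i l * G s l j).
  by apply/funext => x; rewrite mxE.
by rewrite !mxE; apply: is_derive_bigsum => l; exact: is_derive_cmul.
Qed.

Lemma mderivMr m n q (N : 'M[R]_(n, q)) (G G' : R -> 'M[R]_(m, n)) :
  mderiv G G' -> mderiv (fun s => G s *m N) (fun s => G' s *m N).
Proof.
move=> /mderivT/(mderivMl N^T)/mderivT.
rewrite /mderiv => H s i j; have := H s i j.
by under eq_fun do rewrite trmx_mul !trmxK; rewrite trmx_mul !trmxK.
Qed.

Lemma mderivZ m n (w w' : R -> R) (F F' : R -> 'M[R]_(m, n)) :
  (forall s, is_derive s (1 : R) w (w' s)) -> mderiv F F' ->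
  mderiv (fun s => w s *: F s) (fun s => w' s *: F s + w s *: F' s).
Proof.
move=> hw hF s i j; rewrite !mxE; under eq_fun do rewrite mxE.
exact: is_derive_mul.
Qed.

Lemma half_intm_FTC m n (F F' : R -> 'M[R]_(m, n)) : mderiv F F' -> decaying_mx F -> decaying_mx F' ->
  half_intm F' = - F 0.
Proof.
move=> hF dF dF'; apply/matrixP => i j; rewrite !mxE.
apply: (half_line_FTC (F := fun s => F s i j) (f := fun s => F' s i j)); first by move=> x; exact: hF.
- by case: (dF' i j).
- by case: (dF i j).
- by case: (dF' i j).
Qed.

End Matrices.

Section Resolvent.
Variables (n : nat) (A : 'M[R]_n).
Hypothesis stab : forall z : R[i], eigenvalue (mxtoC A) z -> complex.Re z < 0.
Notation Phi := (expt A).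

Lemma expt_mdec : decaying_mx Phi.
Proof. by move=> i j; split; [exact: expt_continuous|exact: expt_decay]. Qed.

Lemma expt_mderiv : mderiv Phi (fun s => A *m Phi s).
Proof. by move=> s i j; exact: expt_derive. Qed.

(** The stationary covariance of the state driven by noise of covariance Q. *)
Definition gramian (Q : 'M[R]_n) : 'M[R]_n := half_intm (fun s => Phi s *m Q *m (Phi s)^T).

Lemma gramian_mdec Q : decaying_mx (fun s => Phi s *m Q *m (Phi s)^T).
Proof. by apply: mdecM; [apply: mdecMr; exact: expt_mdec|apply: mdecT; exact: expt_mdec]. Qed.

Lemma gramian_sym Q : Q^T = Q -> (gramian Q)^T = gramian Q.
Proof.
move=> QT; rewrite /gramian -half_intmT; congr half_intm; apply/funext => s.
by rewrite !trmx_mul trmxK QT mulmxA.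
Qed.

(** The left-hand side is the integral of the derivative of Phi Q Phi^T. *)
Lemma lyapunov Q : A *m gramian Q + gramian Q *m A^T = - Q.
Proof.
have d : mderiv (fun s => Phi s *m Q *m (Phi s)^T)
    (fun s => A *m (Phi s *m Q *m (Phi s)^T) + (Phi s *m Q *m (Phi s)^T) *m A^T).
  have := mderivM (mderivMr Q expt_mderiv) (mderivT expt_mderiv).
  by congr mderiv; apply/funext => s; rewrite trmx_mul !mulmxA.
have dG := gramian_mdec Q.
rewrite /gramian -(half_intmMl A dG) -(half_intmMr A^T dG) -half_intmD.
- rewrite (half_intm_FTC d).
  + by rewrite expt0 mul1mx trmx1 mulmx1.
  + exact: gramian_mdec.
  + by apply: mdecD; [apply: mdecMl|apply: mdecMr]; exact: gramian_mdec.
- by apply: mdecMl; exact: gramian_mdec.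
- by apply: mdecMr; exact: gramian_mdec.
Qed.

(** Real and imaginary parts of the integral of e^(-ils) e^(sA) over the half-line,
   up to the sign of the latter; this integral is (il - A)^-1, and [cosPhi_eq] and
   [sinPhi_eq] are the two parts of this equation. *)
Definition cosPhi (l : R) : 'M[R]_n := half_intm (fun s => cos (l * s) *: Phi s).
Definition sinPhi (l : R) : 'M[R]_n := half_intm (fun s => sin (l * s) *: Phi s).

Lemma cosPhi_eq l : A *m cosPhi l - l *: sinPhi l = - 1%:M.
Proof.
have mc := mdec_cos l expt_mdec; have ms := mdec_sin l expt_mdec.
have d := mderivZ (derive_cosZ l) expt_mderiv.
rewrite -half_intmMl // -scaleNr -half_intmZ // -half_intmD; [|exact: mdecMl|exact: mdecZ].
transitivity (- (cos (l * 0) *: Phi 0)); last by rewrite mulr0 cos0 scale1r expt0.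
rewrite -(half_intm_FTC d) //.
  by congr half_intm; apply/funext => s; rewrite addrC -scalemxAr scalerA mulrN mulNr.
apply: mdecD; last by apply: mdec_cos; apply: mdecMl; exact: expt_mdec.
have := mdecZ (- l) ms; congr decaying_mx; apply/funext => s.
by rewrite scalerA mulrN mulNr.
Qed.

Lemma sinPhi_eq l : A *m sinPhi l + l *: cosPhi l = 0.
Proof.
have mc := mdec_cos l expt_mdec; have ms := mdec_sin l expt_mdec.
have d := mderivZ (derive_sinZ l) expt_mderiv.
rewrite -half_intmMl // -half_intmZ // -half_intmD; [|exact: mdecMl|exact: mdecZ].
transitivity (- (sin (l * 0) *: Phi 0)); last by rewrite mulr0 sin0 scale0r oppr0.
rewrite -(half_intm_FTC d) //.
  by congr half_intm; apply/funext => s; rewrite addrC -scalemxAr scalerA.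
apply: mdecD; last by apply: mdec_sin; apply: mdecMl; exact: expt_mdec.
by have := mdecZ l mc; congr decaying_mx; apply/funext => s; rewrite scalerA.
Qed.

Lemma cosPhi_bound i j : exists K, forall l, `|cosPhi l i j| <= K.
Proof.
exists (half_int (fun s => `|Phi s i j|)) => l; rewrite mxE.
under [in leLHS]eq_fun do rewrite mxE.
apply: half_int_bounded; [exact: expt_mdec|exact: continuous_cosZ|by move=> s; exact: cos_max].
Qed.

Lemma sinPhi_bound i j : exists K, forall l, `|sinPhi l i j| <= K.
Proof.
exists (half_int (fun s => `|Phi s i j|)) => l; rewrite mxE.
under [in leLHS]eq_fun do rewrite mxE.
apply: half_int_bounded; [exact: expt_mdec|exact: continuous_sinZ|by move=> s; exact: sin_max].
Qed.

End Resolvent.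
End DecayingFunctions.

(** * Inversion for covariances glued from two half-lines *)

Section CovarianceTransform.
Context {R : realType}.
Notation mu := (@lebesgue_measure R).
Notation Hl := (`[0%R, +oo[%classic : set R).
Variables (f g : R -> R).
Hypotheses (df : decaying f) (dg : decaying g) (fg0 : f 0 = g 0).

(** The shape of an autocovariance: one function on the right half-line, another
   on the left, with a common value at 0. *)
Definition glue (s : R) : R := if 0 <= s then f s else g (- s).

(** The cases are merged into a formula with max, which is continuous. *)
Lemma glue_continuous : continuous glue.
Proof.
have -> : glue = fun s => f (Num.max s 0) + g (Num.max (- s) 0) - f 0.
  apply/funext => s; rewrite /glue; case: (leP 0 s) => s0.
    by rewrite (max_r (_ : - s <= 0)) ?oppr_le0 // -fg0 addrK.
  by rewrite max_l ?oppr_ge0 ?ltW // addrAC subrr add0r.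
have cm (w : R -> R) : continuous w -> continuous (fun s => Num.max (w s) 0).
  by move=> cw x; apply: continuous_max; [exact: cw|exact: cvg_cst].
move=> x; apply: cvgB; last exact: cvg_cst.
have [cf _] := df; have [cg _] := dg.
apply: cvgD.
  apply: (@continuous_comp _ _ _ (fun s : R => Num.max s 0) f x); last exact: cf.
  by apply: (cm id) => y; exact: cvg_id.
apply: (@continuous_comp _ _ _ (fun s : R => Num.max (- s) 0) g x); last exact: cg.
by apply: (cm (fun s => - s)) => y; apply: cvgN; exact: cvg_id.
Qed.

Lemma glue_decay : exists K c : R, [/\ 0 <= K, 0 < c & forall s, `|glue s| <= K * expR (- (c * `|s|))].
Proof.
have [_ [K1 [c1 [K10 c10 H1]]]] := df; have [_ [K2 [c2 [K20 c20 H2]]]] := dg.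
exists (K1 + K2), (Num.min c1 c2); split; [by rewrite addr_ge0|by rewrite lt_min c10|].
have m1 : Num.min c1 c2 <= c1 by rewrite ge_min lexx.
have m2 : Num.min c1 c2 <= c2 by rewrite ge_min lexx orbT.
have G1 s := @exp_decay_weaken _ f K1 c1 (Num.min c1 c2) K10 m1 H1 s.
have G2 s := @exp_decay_weaken _ g K2 c2 (Num.min c1 c2) K20 m2 H2 s.
move=> s; rewrite /glue; case: (leP 0 s) => s0.
  rewrite (ger0_norm s0) (le_trans (G1 s s0)) // mulrDl lerDl mulr_ge0 // expR_ge0.
have s1 : 0 <= - s by rewrite oppr_ge0 ltW.
by rewrite (ltr0_norm s0) (le_trans (G2 _ s1)) // mulrDl lerDr mulr_ge0 // expR_ge0.
Qed.

Lemma glue_bounded : exists M, forall s, `|glue s| <= M.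
Proof.
have [K [c [K0 c0 H]]] := glue_decay; exists K => s; apply: (le_trans (H s)).
by rewrite ler_piMr // -expR0 ler_expR oppr_le0 mulr_ge0 // ltW.
Qed.

Lemma glue_rinteg : rinteg mu glue.
Proof.
have [K [c [K0 c0 H]]] := glue_decay.
apply: (rinteg_le _ _ (rintegZ K (integ_exp_abs c0))).
  apply: continuous_measurable_fun; exact: glue_continuous.
by move=> s; rewrite [leRHS]ger0_norm // mulr_ge0 // expR_ge0.
Qed.

Lemma rinteg_bounded (w u : R -> R) : measurable_fun setT w -> (forall s, `|w s| <= 1) ->
  rinteg mu u -> rinteg mu (fun s => u s * w s).
Proof.
move=> mw w1 hu; apply: (rinteg_le _ _ hu).
  by apply: measurable_funM => //; exact: (rinteg_measurable hu).
by move=> s; rewrite normrM ler_piMr.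
Qed.

Lemma glueN s : 0 <= s -> glue (- s) = g s.
Proof.
move=> s0; rewrite /glue opprK; case: ifP => //; rewrite oppr_ge0 => s1.
by have -> : s = 0; [apply/eqP; rewrite eq_le s0 s1|rewrite oppr0].
Qed.

Lemma glue_cos l : \int[mu]_s (glue s * cos (l * s)) =
  half_int (fun s => cos (l * s) * f s) + half_int (fun s => cos (l * s) * g s).
Proof.
rewrite integral_line_split; last first.
  apply: rinteg_bounded glue_rinteg; last by move=> s; exact: cos_max.
  by apply: continuous_measurable_fun; exact: continuous_cosZ.
congr (_ + _); apply: eq_Rintegral => s; rewrite inE /= in_itv /= andbT => s0.
  by rewrite /glue s0 mulrC.
by rewrite mulrN cosN mulrC glueN.
Qed.

Lemma glue_sin l : \int[mu]_s (glue s * sin (l * s)) =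
  half_int (fun s => sin (l * s) * f s) - half_int (fun s => sin (l * s) * g s).
Proof.
rewrite integral_line_split; last first.
  apply: rinteg_bounded glue_rinteg; last by move=> s; exact: sin_max.
  by apply: continuous_measurable_fun; exact: continuous_sinZ.
rewrite -mulN1r -half_intZ; last exact: decaying_sin.
congr (_ + _); apply: eq_Rintegral => s; rewrite inE /= in_itv /= andbT => s0.
  by rewrite /glue s0 mulrC.
by rewrite mulrN sinN mulrC glueN // mulN1r mulNr.
Qed.

(** The cosine transform of s |-> glue (s + h) is D l cos (hl) + E l sin (hl) by
   the addition theorem; now use [fourier_inversion0]. *)
Lemma glue_inversion h :
  let D l := half_int (fun s => cos (l * s) * f s) + half_int (fun s => cos (l * s) * g s) in
  let E l := half_int (fun s => sin (l * s) * f s) - half_int (fun s => sin (l * s) * g s) in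
  rinteg mu D -> rinteg mu E ->
  \int[mu]_l (D l * cos (h * l) + E l * sin (h * l)) = 2 * pi * glue h.
Proof.
move=> D E hD hE.
have mcos x : measurable_fun setT (fun s : R => cos (x * s)).
  by apply: continuous_measurable_fun; exact: continuous_cosZ.
have msin x : measurable_fun setT (fun s : R => sin (x * s)).
  by apply: continuous_measurable_fun; exact: continuous_sinZ.
have gcos l := rinteg_bounded (mcos l) (fun s => cos_max _) glue_rinteg.
have gsin l := rinteg_bounded (msin l) (fun s => sin_max _) glue_rinteg.
have shift l : \int[mu]_s (glue (s + h) * cos (l * s)) = D l * cos (h * l) + E l * sin (h * l).
  have H : rinteg mu (fun u => cos (h * l) * (glue u * cos (l * u)) + sin (h * l) * (glue u * sin (l * u))).
    by apply: rintegD; exact: rintegZ.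
  have := Rintegral_affine h (oner_neq0 R) H.
  rewrite normr1 mul1r [RHS](rintD (rintegZ _ (gcos l)) (rintegZ _ (gsin l))).
  rewrite (rintZ _ (gcos l)) (rintZ _ (gsin l)) glue_cos glue_sin -/(D l) -/(E l) [D l * _]mulrC [E l * _]mulrC => <-.
  apply: eq_Rintegral => s _; rewrite mul1r.
  have -> : l * s = l * (s + h) - h * l by ring.
  by rewrite cosB; ring.
have cont : continuous (fun s => glue (s + h)).
  move=> s; apply: (@continuous_comp _ _ _ (fun s : R => s + h) glue s); last exact: glue_continuous.
  by apply: cvgD; [exact: cvg_id|exact: cvg_cst].
have [M HM] := glue_bounded.
have int : rinteg mu (fun s => glue (s + h)).
  have := integ_affine h (oner_neq0 R) glue_rinteg.
  by congr rinteg; apply/funext => s; rewrite mul1r.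
have := @fourier_inversion0 R (fun s => glue (s + h)) M cont (fun s => HM _) int.
have -> : (fun l => \int[mu]_s (glue (s + h) * cos (s * l))) =
    (fun l => D l * cos (h * l) + E l * sin (h * l)).
  by apply/funext => l; rewrite -shift; apply: eq_Rintegral => s _; rewrite (mulrC s).
rewrite add0r; apply.
by apply: rintegD; apply: rinteg_bounded => // s; [exact: cos_max|exact: sin_max].
Qed.

End CovarianceTransform.

(** * Factorization of the spectral density *)

Section ComplexMatrices.
Context {R : realType}.
Notation mu := (@lebesgue_measure R).

(** Complex matrices as pairs of real ones: identities between them reduce to
   real identities, and real and imaginary parts are read off. *)
Definition cpx m n (X Y : 'M[R]_(m, n)) : 'M[R[i]]_(m, n) := \matrix_(i, j) (X i j +i* Y i j)%C.

Lemma cpxD m n (X Y X' Y' : 'M[R]_(m, n)) : cpx X Y + cpx X' Y' = cpx (X + X') (Y + Y').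
Proof. by apply/matrixP => i j; rewrite !mxE; apply/eqP; rewrite eq_complex /= !eqxx. Qed.

Lemma cpxM m n q (X Y : 'M[R]_(m, n)) (X' Y' : 'M[R]_(n, q)) :
  cpx X Y *m cpx X' Y' = cpx (X *m X' - Y *m Y') (X *m Y' + Y *m X').
Proof.
apply/matrixP => i j; rewrite !mxE; apply/eqP; rewrite eq_complex Re_sum Im_sum /=.
rewrite -sumrB -big_split /=; apply/andP; split; apply/eqP; apply: eq_bigr => l _.
  by rewrite !mxE.
by rewrite !mxE.
Qed.

Lemma cpx_adj m n (X Y : 'M[R]_(m, n)) : (cpx X Y)^t* = cpx X^T (- Y^T).
Proof. by apply/matrixP => i j; rewrite !mxE. Qed.

Lemma cpx1 n : cpx 1%:M 0 = 1%:M :> 'M[R[i]]_n.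
Proof.
apply/matrixP => i j; rewrite !mxE; apply/eqP; rewrite eq_complex; case: (i == j) => /=; rewrite !eqxx //.
Qed.

Lemma mxtoC_cpx m n (X : 'M[R]_(m, n)) : mxtoC X = cpx X 0.
Proof. by apply/matrixP => i j; rewrite !mxE. Qed.

Section Spectral.
Variables (n k : nat) (A : 'M[R]_n) (B : 'M[R]_(n, k)) (Cc : 'M[R]_(k, n)) (Sg : 'M[R]_k).
Hypothesis stab : forall z : R[i], eigenvalue (mxtoC A) z -> complex.Re z < 0.
Hypothesis SgT : Sg^T = Sg.

(** R = (il - A)^-1; its inverse is [pencil]. *)
Definition resolvent (l : R) := cpx (cosPhi A l) (- sinPhi A l).
Definition pencil (l : R) := cpx (- A) l%:M.

Lemma pencil_resolvent l : pencil l *m resolvent l = 1%:M.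
Proof.
rewrite /pencil /resolvent cpxM -cpx1; congr cpx.
  rewrite mulNmx mulmxN opprK mul_scalar_mx -[X in - X](subrK (l *: sinPhi A l)).
  by rewrite cosPhi_eq // opprD opprK subrK.
by rewrite mulNmx mulmxN opprK mul_scalar_mx sinPhi_eq.
Qed.

Lemma resolvent_pencil l : resolvent l *m pencil l = 1%:M.
Proof. by apply: mulmx1C; exact: pencil_resolvent. Qed.

Definition transfer (l : R) := mxtoC Cc *m resolvent l *m mxtoC B.

Let Q := B *m Sg *m B^T.
Let Ga := gramian A Q.

Definition specRe (l : R) := Cc *m (cosPhi A l *m Ga + Ga *m (cosPhi A l)^T) *m Cc^T.
Definition specIm (l : R) := Cc *m (Ga *m (sinPhi A l)^T - sinPhi A l *m Ga) *m Cc^T.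

Lemma GaT : Ga^T = Ga.
Proof. by apply: gramian_sym; rewrite /Q !trmx_mul trmxK SgT mulmxA. Qed.

(** By Lyapunov's equation B Sg B^T = (il - A) Ga + Ga (il - A)^*, since the terms
   il Ga cancel. Multiplying by R from the left and R^* from the right gives
   R B Sg B^T R^* = Ga R^* + R Ga, which is the Fourier transform of the
   covariance of the state. *)
Theorem spectral_factorization l :
  transfer l *m mxtoC Sg *m (transfer l)^t* = cpx (specRe l) (specIm l).
Proof.
have Qsum : mxtoC Q = pencil l *m mxtoC Ga + mxtoC Ga *m (pencil l)^t*.
  rewrite /pencil cpx_adj !mxtoC_cpx !cpxM cpxD !(mul0mx, mulmx0, subr0, addr0, add0r).
  congr cpx.
    by rewrite mulNmx raddfN /= mulmxN -opprD lyapunov // opprK.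
  by rewrite tr_scalar_mx mulmxN mul_scalar_mx mul_mx_scalar subrr.
have RQR : resolvent l *m mxtoC Q *m (resolvent l)^t* =
    mxtoC Ga *m (resolvent l)^t* + resolvent l *m mxtoC Ga.
  rewrite Qsum mulmxDr mulmxDl !mulmxA resolvent_pencil mul1mx; congr (_ + _).
  by rewrite -!mulmxA -adjM resolvent_pencil adj1 mulmx1.
have mxC m1 m2 (X : 'M[R]_(m1, m2)) : (mxtoC X)^t* = mxtoC X^T.
  by rewrite !mxtoC_cpx cpx_adj trmx0 oppr0.
transitivity (mxtoC Cc *m (resolvent l *m mxtoC Q *m (resolvent l)^t*) *m mxtoC Cc^T).
  by rewrite /transfer /Q !adjM !mxC !mxtoCM !mulmxA.
rewrite RQR /resolvent cpx_adj !mxtoC_cpx !cpxM cpxD.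
rewrite !(mul0mx, mulmx0, subr0, addr0, add0r, sub0r) cpxM.
rewrite !(mul0mx, mulmx0, subr0, addr0, add0r, sub0r) cpxM.
rewrite !(mul0mx, mulmx0, subr0, addr0, add0r, sub0r).
congr cpx; rewrite /specRe /specIm; congr (_ *m _ *m _).
  by rewrite addrC.
by rewrite mulNmx [(- sinPhi A l)^T]linearN /= opprK.
Qed.

(** The autocovariance at lags s >= 0; negative lags are given by its transpose,
   see [acovf]. *)
Definition acov (s : R) := Cc *m expt A s *m Ga *m Cc^T.

Lemma acov_mdec : decaying_mx acov.
Proof. by do 2 apply: mdecMr; apply: mdecMl; exact: expt_mdec. Qed.

Lemma acov0_sym a b : acov 0 a b = acov 0 b a.
Proof.
have E : (acov 0)^T = acov 0 by rewrite /acov expt0 mulmx1 !trmx_mul trmxK GaT mulmxA.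
by rewrite -[in LHS]E [LHS]mxE.
Qed.

(** Transforms commute with the constant matrices, so that one lemma serves for
   cosine and sine. *)
Lemma transform_acov (w : R -> R) a b :
  (forall m q (F : R -> 'M[R]_(m, q)), decaying_mx F -> decaying_mx (fun s => w s *: F s)) ->
  half_int (fun s => w s * acov s a b) =
  (Cc *m half_intm (fun s => w s *: expt A s) *m Ga *m Cc^T) a b.
Proof.
move=> hw; have dP := hw _ _ _ (expt_mdec stab).
rewrite -half_intmMl // -half_intmMr; last exact: mdecMl.
rewrite -half_intmMr; last by apply: mdecMr; exact: mdecMl.
rewrite mxE; congr half_int; apply/funext => s.
by rewrite -scalemxAr -!scalemxAl [RHS]mxE.
Qed.

Lemma specReE l a b : specRe l a b =
  half_int (fun s => cos (l * s) * acov s a b) + half_int (fun s => cos (l * s) * acov s b a).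
Proof.
rewrite !transform_acov; try by move=> m q F; exact: mdec_cos.
rewrite -/(cosPhi A l) /specRe mulmxDr mulmxDl mxE; congr (_ + _); first by rewrite !mulmxA.
rewrite -[in RHS](trmxK (_ *m Cc^T)) [RHS]mxE !trmx_mul trmxK GaT !mulmxA //.
Qed.

Lemma specImE l a b : specIm l a b =
  - (half_int (fun s => sin (l * s) * acov s a b) - half_int (fun s => sin (l * s) * acov s b a)).
Proof.
rewrite !transform_acov; try by move=> m q F; exact: mdec_sin.
rewrite -/(sinPhi A l) /specIm mulmxBr mulmxBl.
rewrite (_ : forall X Y : 'M[R]_k, (X - Y) a b = X a b - Y a b); last by move=> X Y; rewrite !mxE.
rewrite opprB; congr (_ - _); last by rewrite !mulmxA.
rewrite -[in RHS](trmxK (_ *m Cc^T)) [RHS]mxE !trmx_mul trmxK GaT !mulmxA //.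
Qed.

Lemma specRe_even l : specRe (- l) = specRe l.
Proof.
rewrite /specRe (_ : cosPhi A (- l) = cosPhi A l) //.
by congr half_intm; apply/funext => s; rewrite mulNr cosN.
Qed.

Lemma specIm_odd l : specIm (- l) = - specIm l.
Proof.
rewrite /specIm (_ : sinPhi A (- l) = - sinPhi A l).
  by rewrite linearN /= mulmxN mulNmx -opprD mulmxN mulNmx.
rewrite /sinPhi -[RHS]scaleN1r -half_intmZ; last exact: mdec_sin (expt_mdec stab).
by congr half_intm; apply/funext => s; rewrite scalerA mulNr sinN mulN1r.
Qed.

Lemma measurable_specRe a b : measurable_fun setT (fun l => specRe l a b).
Proof.
apply: continuous_measurable_fun => l.
have -> : (fun l => specRe l a b) = (fun l => half_int (fun s => cos (l * s) * acov s a b) +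
    half_int (fun s => cos (l * s) * acov s b a)) by apply/funext => x; rewrite specReE.
by apply: cvgD; apply: continuous_transform; try exact: acov_mdec;
  [exact: continuous_cos|move=> s; exact: cos_max|exact: continuous_cos|move=> s; exact: cos_max].
Qed.

Lemma measurable_specIm a b : measurable_fun setT (fun l => specIm l a b).
Proof.
apply: continuous_measurable_fun => l.
have -> : (fun l => specIm l a b) = (fun l => - (half_int (fun s => sin (l * s) * acov s a b) -
    half_int (fun s => sin (l * s) * acov s b a))) by apply/funext => x; rewrite specImE.
by apply: cvgN; apply: cvgB; apply: continuous_transform; try exact: acov_mdec;
  [exact: continuous_sin|move=> s; exact: sin_max|exact: continuous_sin|move=> s; exact: sin_max].
Qed.

Definition acovf (a b : 'I_k) := glue (fun s => acov s a b) (fun s => acov s b a).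

Definition specdens (l : R) : 'M[R[i]]_k := ((2 * pi)^-1)%:C%C *: cpx (specRe l) (specIm l).

Lemma specdensE l a b : specdens l a b =
  ((2 * pi)^-1 * specRe l a b +i* ((2 * pi)^-1 * specIm l a b))%C.
Proof.
rewrite /specdens mxE [cpx _ _ _ _]mxE; apply/eqP; rewrite eq_complex /=.
by rewrite !mul0r subr0 addr0 !eqxx.
Qed.

Hypothesis intRe : forall a b, rinteg mu (fun l => specRe l a b).
Hypothesis intIm : forall a b, rinteg mu (fun l => specIm l a b).

(** The real part is [glue_inversion], with D and - E the real and imaginary
   parts of 2 pi times the density. The imaginary part is the integral of an odd
   function. *)
Lemma specdens_cov a b h :
  (acovf a b h)%:C%C = cintegral (fun lam => cis (lam * h) * specdens lam a b).
Proof.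
have tp : 2 * pi != 0 :> R by rewrite mulf_neq0 ?pnatr_eq0 // gt_eqF // pi_gt0.
have [mc ms] : measurable_fun setT (fun s : R => cos (h * s)) /\
   measurable_fun setT (fun s : R => sin (h * s)).
  by split; apply: continuous_measurable_fun; [exact: continuous_cosZ|exact: continuous_sinZ].
have i1 := rinteg_bounded mc (fun s => cos_max _) (intRe a b).
have i2 := rinteg_bounded ms (fun s => sin_max _) (intIm a b).
have i3 := rinteg_bounded ms (fun s => sin_max _) (intRe a b).
have i4 := rinteg_bounded mc (fun s => cos_max _) (intIm a b).
apply/eqP; rewrite /cintegral eq_complex /=; apply/andP; split; apply/eqP.
  transitivity ((2 * pi)^-1 * \int[mu]_l (specRe l a b * cos (h * l) + -1 * (specIm l a b * sin (h * l)))).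
    have := @glue_inversion R _ _ (acov_mdec a b) (acov_mdec b a) (acov0_sym a b) h.
    rewrite -/(acovf a b) => H.
    apply: (canRL (mulKf tp)); rewrite -H.
    - by apply: eq_Rintegral => l _; rewrite specReE specImE; ring.
    - by under eq_fun do rewrite -specReE; exact: intRe.
    - have := rintegZ (-1) (intIm a b); congr rinteg; apply/funext => l.
      by rewrite specImE mulN1r opprK.
  rewrite -rintZ; last by apply: rintegD => //; exact: rintegZ.
  apply: eq_Rintegral => l _; rewrite specdensE Re_mul /= [h * l]mulrC; ring.
pose q l := (2 * pi)^-1 * (specRe l a b * sin (h * l) + specIm l a b * cos (h * l)).
have qi : rinteg mu q by apply: rintegZ; exact: rintegD.
have qE : (fun x => complex.Im (cis (x * h) * specdens x a b)) = q.
  by apply/funext => l; rewrite /q specdensE Im_mul /= [h * l]mulrC; ring.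
rewrite qE; have := Rintegral_affine 0 (_ : -1 != 0) qi.
rewrite oppr_eq0 oner_neq0 => /(_ isT); rewrite normrN1 mul1r.
have -> : \int[mu]_x q (-1 * x + 0) = \int[mu]_x (-1 * q x).
  apply: eq_Rintegral => l _; rewrite addr0 mulN1r /q specRe_even specIm_odd mulrN cosN sinN.
  rewrite (_ : (- specIm l) a b = - specIm l a b); last by rewrite [LHS]mxE.
  ring.
rewrite rintZ // => E; lra.
Qed.

End Spectral.
End ComplexMatrices.

(** * Decay of the resolvent in frequency *)

Section InverseLinearDecay.
Context {R : realType}.
Notation mu := (@lebesgue_measure R).

(** f l = O ((1 + |l|)^-d); orders add up under products. *)
Definition bigO_inv (d : nat) (f : R -> R) : Prop :=
  exists K, forall l, `|f l| * (1 + `|l|) ^+ d <= K.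

Lemma bigO_inv0 d : bigO_inv d (fun=> 0).
Proof. by exists 0 => l; rewrite normr0 mul0r. Qed.

Lemma bigO_invD d f g : bigO_inv d f -> bigO_inv d g -> bigO_inv d (fun l => f l + g l).
Proof.
move=> [K hK] [K' hK']; exists (K + K') => l.
apply: (le_trans _ (lerD (hK l) (hK' l))); rewrite -mulrDl ler_wpM2r ?ler_normD //.
Qed.

Lemma bigO_invM d e f g : bigO_inv d f -> bigO_inv e g -> bigO_inv (d + e) (fun l => f l * g l).
Proof.
move=> [K hK] [K' hK']; exists (K * K') => l.
rewrite normrM exprD mulrACA; by apply: ler_pM => //; rewrite mulr_ge0.
Qed.

Lemma bigO_inv_cst (c : R) : bigO_inv 0 (fun=> c).
Proof. by exists `|c| => l; rewrite expr0 mulr1. Qed.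

Lemma bigO_inv_sum d n (f : 'I_n -> R -> R) : (forall i, bigO_inv d (f i)) ->
  bigO_inv d (fun l => \sum_i f i l).
Proof.
elim: n f => [|n IH] f hf.
  by rewrite (_ : (fun l => _) = fun=> 0); [exact: bigO_inv0|apply/funext => l; rewrite big_ord0].
rewrite (_ : (fun l => _) = fun l => f ord0 l + \sum_i f (lift ord0 i) l).
  by apply: bigO_invD => //; apply: IH.
by apply/funext => l; rewrite big_ord_recl.
Qed.

(** Since (1 + |l|)^2 >= 1 + l^2. *)
Lemma bigO_inv_integrable f : measurable_fun setT f -> bigO_inv 2 f -> rinteg mu f.
Proof.
move=> mf [K hK]; apply: (rinteg_le _ _ (rintegZ K (proj1 integ_cauchy))); first exact: mf.
move=> l.
have l0 : 0 < 1 + `|l| ^+ 2 by rewrite ltr_pwDl // exprn_ge0.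
rewrite -real_normK ?num_real //; apply: le_trans (ler_norm _).
rewrite ler_pdivlMr //; apply: le_trans (hK l); rewrite ler_wpM2l //.
have : 0 <= `|l| by []; nra.
Qed.

Definition mbigO d m n (F : R -> 'M[R]_(m, n)) := forall i j, bigO_inv d (fun l => F l i j).

Lemma mbigOM d e m n q (F : R -> 'M[R]_(m, n)) (G : R -> 'M[R]_(n, q)) :
  mbigO d F -> mbigO e G -> mbigO (d + e) (fun l => F l *m G l).
Proof.
move=> hF hG i j; rewrite (_ : (fun l => _) = fun l => \sum_h F l i h * G l h j).
  by apply: bigO_inv_sum => h; exact: bigO_invM.
by apply/funext => l; rewrite mxE.
Qed.

Lemma mbigO_cst m n (M : 'M[R]_(m, n)) : mbigO 0 (fun=> M).
Proof. by move=> i j; exact: bigO_inv_cst. Qed.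

Lemma mbigOMl d m n q (N : 'M[R]_(m, n)) (G : R -> 'M[R]_(n, q)) :
  mbigO d G -> mbigO d (fun l => N *m G l).
Proof. exact: (@mbigOM 0 d _ _ _ (fun=> N)) (mbigO_cst N). Qed.

Lemma mbigOMr d m n q (F : R -> 'M[R]_(m, n)) (N : 'M[R]_(n, q)) :
  mbigO d F -> mbigO d (fun l => F l *m N).
Proof. by move=> hF; rewrite -(addn0 d); apply: mbigOM => //; exact: mbigO_cst. Qed.

Lemma mbigOT d m n (F : R -> 'M[R]_(m, n)) : mbigO d F -> mbigO d (fun l => (F l)^T).
Proof. by move=> hF i j; under eq_fun do rewrite mxE. Qed.

Lemma mbigOD d m n (F G : R -> 'M[R]_(m, n)) : mbigO d F -> mbigO d G ->
  mbigO d (fun l => F l + G l).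
Proof. by move=> hF hG i j; under eq_fun do rewrite mxE; exact: bigO_invD. Qed.

Lemma mbigON d m n (F : R -> 'M[R]_(m, n)) : mbigO d F -> mbigO d (fun l => - F l).
Proof.
by move=> hF i j; have [K hK] := hF i j; exists K => l; rewrite mxE normrN.
Qed.

Lemma oppmxE (S : zmodType) m n (X : 'M[S]_(m, n)) i j : (- X) i j = - X i j.
Proof. by rewrite mxE. Qed.

Lemma scalemxE (S : pzRingType) m n c (X : 'M[S]_(m, n)) i j : (c *: X) i j = c * X i j.
Proof. by rewrite mxE. Qed.

Section Resolvent.
Variables (n k : nat) (A : 'M[R]_n) (B : 'M[R]_(n, k)) (Cc : 'M[R]_(k, n)) (Sg : 'M[R]_k).
Hypothesis stab : forall z : R[i], eigenvalue (mxtoC A) z -> complex.Re z < 0.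
Hypothesis SgT : Sg^T = Sg.

(** The transform is bounded, and l times it is, by [sinPhi_eq], a bounded
   combination of the other transform. *)
Lemma cosPhi_bigO : mbigO 1 (cosPhi A).
Proof.
have b0 : mbigO 0 (cosPhi A).
  by move=> i j; have [K hK] := cosPhi_bound stab i j; exists K => l; rewrite expr0 mulr1.
have b1 : mbigO 0 (sinPhi A).
  by move=> i j; have [K hK] := sinPhi_bound stab i j; exists K => l; rewrite expr0 mulr1.
move=> i j; have [K hK] := b0 i j; have [K' hK'] := mbigOMl A b1 i j.
exists (K + K') => l; rewrite expr1 mulrDr mulr1; apply: lerD.
  by have := hK l; rewrite expr0 mulr1.
have := hK' l; rewrite expr0 mulr1; apply: le_trans.
rewrite (_ : A *m sinPhi A l = - (l *: cosPhi A l)); last first.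
  by apply/eqP; rewrite -addr_eq0 sinPhi_eq.
by rewrite oppmxE scalemxE normrN normrM mulrC.
Qed.

Lemma sinPhi_bigO : mbigO 1 (sinPhi A).
Proof.
have b0 : mbigO 0 (sinPhi A).
  by move=> i j; have [K hK] := sinPhi_bound stab i j; exists K => l; rewrite expr0 mulr1.
have b1 : mbigO 0 (cosPhi A).
  by move=> i j; have [K hK] := cosPhi_bound stab i j; exists K => l; rewrite expr0 mulr1.
move=> i j; have [K hK] := b0 i j.
have [K' hK'] := mbigOD (mbigOMl A b1) (mbigO_cst 1%:M) i j.
exists (K + K') => l; rewrite expr1 mulrDr mulr1; apply: lerD.
  by have := hK l; rewrite expr0 mulr1.
have := hK' l; rewrite expr0 mulr1; apply: le_trans.
rewrite (_ : (A *m cosPhi A l + 1%:M) = l *: sinPhi A l); last first.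
  by apply/eqP; rewrite -subr_eq0 addrAC cosPhi_eq // addNr.
by rewrite scalemxE normrM mulrC.
Qed.

Let Hr l := Cc *m cosPhi A l *m B.
Let Hi l := - (Cc *m sinPhi A l *m B).

Lemma transferE l : transfer A B Cc l = cpx (Hr l) (Hi l).
Proof.
rewrite /transfer /resolvent !mxtoC_cpx !cpxM !(mul0mx, mulmx0, subr0, addr0, add0r).
by rewrite mulmxN mulNmx.
Qed.

Lemma spec_parts l : specRe A B Cc Sg l = Hr l *m Sg *m (Hr l)^T + Hi l *m Sg *m (Hi l)^T /\
  specIm A B Cc Sg l = Hi l *m Sg *m (Hr l)^T - Hr l *m Sg *m (Hi l)^T.
Proof.
have := spectral_factorization B Cc Sg stab l.
rewrite transferE cpx_adj !mxtoC_cpx !cpxM !(mul0mx, mulmx0, subr0, addr0, add0r) mulmxN opprK.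
move=> /matrixP E; split; apply/matrixP => i j; have := E i j; rewrite ![cpx _ _ _ _]mxE => -[] //.
by rewrite mulmxN => _ <-; rewrite addrC.
Qed.

Lemma Hr_bigO : mbigO 1 Hr.
Proof. by apply: mbigOMr; apply: mbigOMl; exact: cosPhi_bigO. Qed.

Lemma Hi_bigO : mbigO 1 Hi.
Proof. by apply: mbigON; apply: mbigOMr; apply: mbigOMl; exact: sinPhi_bigO. Qed.

Lemma specRe_integrable a b : rinteg mu (fun l => specRe A B Cc Sg l a b).
Proof.
apply: bigO_inv_integrable; first exact: measurable_specRe.
have : mbigO (1 + 1) (specRe A B Cc Sg).
  rewrite (_ : specRe _ _ _ _ = fun l => Hr l *m Sg *m (Hr l)^T + Hi l *m Sg *m (Hi l)^T); last first.
    by apply/funext => l; case: (spec_parts l).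
  by apply: mbigOD; apply: mbigOM; [apply: mbigOMr|apply: mbigOT|apply: mbigOMr|apply: mbigOT];
    [exact: Hr_bigO|exact: Hr_bigO|exact: Hi_bigO|exact: Hi_bigO].
exact.
Qed.

Lemma specIm_integrable a b : rinteg mu (fun l => specIm A B Cc Sg l a b).
Proof.
apply: bigO_inv_integrable; first exact: measurable_specIm.
have : mbigO (1 + 1) (specIm A B Cc Sg).
  rewrite (_ : specIm _ _ _ _ = fun l => Hi l *m Sg *m (Hr l)^T - Hr l *m Sg *m (Hi l)^T); last first.
    by apply/funext => l; case: (spec_parts l).
  apply: mbigOD; last apply: mbigON.
    by apply: mbigOM; [apply: mbigOMr; exact: Hi_bigO|apply: mbigOT; exact: Hr_bigO].
  by apply: mbigOM; [apply: mbigOMr; exact: Hr_bigO|apply: mbigOT; exact: Hi_bigO].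
exact.
Qed.

(** The modulus is at most the sum of the moduli of the two parts. *)
Lemma resolvent_bound : exists2 K : R, 0 <= K & forall l i j,
  `|(resolvent A l *m mxtoC B) i j| * (1 + `|l%:C%C|) <= K%:C%C.
Proof.
have hU : mbigO 1 (fun l => cosPhi A l *m B) by apply: mbigOMr; exact: cosPhi_bigO.
have hV : mbigO 1 (fun l => - (sinPhi A l *m B)) by apply: mbigON; apply: mbigOMr; exact: sinPhi_bigO.
have H i j : exists K : R, forall l, `|(resolvent A l *m mxtoC B) i j| * (1 + `|l%:C%C|) <= K%:C%C.
  have [K hK] := hU i j; have [K' hK'] := hV i j; exists (K + K') => l.
  rewrite /resolvent mxtoC_cpx cpxM !(mul0mx, mulmx0, subr0, addr0, add0r) mulNmx [cpx _ _ _ _]mxE.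
  rewrite !normc_def /= expr0n addr0 sqrtr_sqr -(rmorph1 (real_complex R)) -rmorphD -rmorphM lecR.
  apply: (le_trans _ (lerD (hK l) (hK' l))); rewrite expr1 -mulrDl ler_wpM2r ?addr_ge0 //.
  set x := (_ i j); set y := (_ i j).
  rewrite -[leRHS]ger0_norm ?addr_ge0 // -sqrtr_sqr ler_wsqrtr //.
  by rewrite sqrrD !real_normK ?num_real // lerD2r lerDl mulrn_wge0 // mulr_ge0.
have [K hK] := choice (fun ij : 'I_n * 'I_k => H ij.1 ij.2).
exists (\sum_ij `|K ij|); first exact: sumr_ge0.
move=> l i j; apply: (le_trans (hK (i, j) l)); rewrite lecR.
by rewrite (bigD1 (i, j)) //= (le_trans (ler_norm _)) // lerDl sumr_ge0.
Qed.

End Resolvent.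
End InverseLinearDecay.

(** * Autoregressive polynomial and transfer function *)

Section FactorBounds.
Context {C : numClosedFieldType}.

(** With y = H^* x the form is y^* S y; and |y| is at most of the order |x| / w,
   while x = P^* y is at most of the order w |y|. The two bounds differ by a factor
   that does not depend on w. *)
Lemma factor_form_bounds k (H P S : 'M[C]_k) (w K K' s M : C) :
  P *m H = 1%:M -> 0 < w -> 0 <= K -> 0 < K' -> 0 <= s -> 0 <= M ->
  (forall i j, `|H i j| <= K / w) -> (forall i j, `|P i j| <= K' * w) ->
  (forall x, s * sqn x <= (x^t* *m S *m x) 0 0) ->
  (forall x, (x^t* *m S *m x) 0 0 <= M * sqn x) ->
  forall x : 'cV[C]_k,
   s * sqn x <= (k * k)%:R * (K' * w) ^+ 2 * (x^t* *m (H *m S *m H^t*) *m x) 0 0 /\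
   (x^t* *m (H *m S *m H^t*) *m x) 0 0 <= M * ((k * k)%:R * (K / w) ^+ 2) * sqn x.
Proof.
move=> PH w0 K0 K'0 s0 M0 hH hP hs hM x.
have F : x^t* *m (H *m S *m H^t*) *m x = (H^t* *m x)^t* *m S *m (H^t* *m x).
  by rewrite -form_mul adjK.
have nadj (X : 'M[C]_k) i j : `|(X^t*) i j| = `|X j i| by rewrite !mxE norm_conjC.
split; rewrite F.
  have xE : x = P^t* *m (H^t* *m x).
    by rewrite mulmxA -adjM (mulmx1C PH) adj1 mul1mx.
  have hP' i j : `|(P^t*) i j| <= K' * w by rewrite nadj.
  have := sqn_mul_le (H^t* *m x) hP'; rewrite -xE => h1.
  apply: (le_trans (ler_wpM2l s0 h1)); rewrite mulrCA ler_wpM2l //.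
  by rewrite mulr_ge0 // exprn_ge0 // mulr_ge0 // ltW.
have hH' i j : `|(H^t*) i j| <= K / w by rewrite nadj.
by rewrite (le_trans (hM _)) // -mulrA ler_wpM2l // sqn_mul_le.
Qed.

Lemma posdef_upper_bound k (S : 'M[C]_k) : posdefmx S ->
  exists2 M : C, 0 < M & forall x, (x^t* *m S *m x) 0 0 <= M * sqn x.
Proof.
move=> /sqrtmxP[]; set T := sqrtmx S; rewrite hermsymmxE => /eqP TT TTS _.
have [K K0 hK] := mx_entry_bound T.
exists (1 + (k * k)%:R * K ^+ 2).
  by rewrite ltr_pwDl // mulr_ge0 // exprn_ge0 // ltW.
move=> x; rewrite (_ : (x^t* *m S *m x) 0 0 = sqn (T *m x)).
  by rewrite (le_trans (sqn_mul_le x hK)) // mulrDl lerDr mul1r sqn_ge0.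
by rewrite /sqn adjM TT -TTS !mulmxA.
Qed.
End FactorBounds.

Section Companion.
Context {R : realType}.
Variables (k p : nat) (A_ : 'I_p -> 'M[R]_k).
Hypothesis p0 : (0 < p)%N.
Notation N := (\sum_(i < p) k)%N.
Notation A := (companion_mx A_).
Notation B := (input_mx k p).
Notation Cc := (output_mx k p).
Hypothesis stab : forall z : R[i], eigenvalue (mxtoC A) z -> complex.Re z < 0.

Let il (l : R) : R[i] := ('i * l%:C)%C.
Let X l : 'M[R[i]]_(N, k) := resolvent A l *m mxtoC B.
Let v l (j : 'I_p) : 'M[R[i]]_k := submxcol (X l) j.

Lemma mxtoC_scalar (b : bool) : mxtoC (b%:R%:M : 'M[R]_k) = b%:R%:M.
Proof.
apply/matrixP => i j; rewrite !mxE; case: b; case: (i == j) => //=.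
Qed.

Lemma pencilE l : pencil A l = (il l)%:M - mxtoC A.
Proof.
apply/matrixP => i j; rewrite !mxE; apply/eqP; rewrite eq_complex /il.
by case: (i == j); rewrite /= ?mulr0n ?mulr1n /= ?mul0r ?mul1r ?subr0 ?addr0 ?add0r ?sub0r ?oppr0 ?addr0 ?subr0 !eqxx.
Qed.

Lemma state_eq l : il l *: X l = mxtoC A *m X l + mxtoC B.
Proof.
have := congr1 (fun Y => Y *m mxtoC B) (pencil_resolvent stab l).
rewrite mul1mx -mulmxA -/(X l) pencilE mulmxBl mul_scalar_mx => <-.
by rewrite addrC subrK.
Qed.

(** The block rows of (il - A) R B = B. *)
Lemma state_blocks l i : il l *: v l i =
  \sum_j (mxtoC (if i.+1 == p then - A_ (rev_ord j) else (j == i.+1 :> nat)%:R%:M) *m v l j)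
   + (i.+1 == p)%:R%:M.
Proof.
have AE : mxtoC A = \mxblock_(i < p, j < p)
    mxtoC (if i.+1 == p then - A_ (rev_ord j) else (j == i.+1 :> nat)%:R%:M).
  by apply/matrixP => a b; rewrite !mxE.
have BE : mxtoC B = \mxcol_(i < p) ((i.+1 == p)%:R%:M : 'M[R[i]]_k).
  by apply/matrixP => a b; rewrite [RHS]mxE -mxtoC_scalar !mxE.
have XE : X l = \mxcol_j v l j by rewrite /v submxcolK.
have := state_eq l; rewrite [in RHS]XE AE BE mul_mxblock_mxrow -mxcolD.
move=> /(congr1 (fun Y => submxcol Y i)); rewrite mxcolK => <-.
by apply/matrixP => a b; rewrite !mxE.
Qed.

Lemma transfer_block l : transfer A B Cc l = v l (Ordinal p0).
Proof.
have CE : mxtoC Cc = \mxrow_(j < p) ((j == 0 :> nat)%:R%:M : 'M[R[i]]_k).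
  by apply/matrixP => a b; rewrite [RHS]mxE -mxtoC_scalar !mxE.
rewrite /transfer -mulmxA -/(X l) CE -[X l]submxcolK mul_mxrow_mxcol.
rewrite (bigD1 (Ordinal p0)) //= mul1mx big1 ?addr0 // => j.
by rewrite -val_eqE /= => /negbTE ->; rewrite mul_scalar_mx scale0r.
Qed.

(** All block rows but the last say that each block is il times the previous one. *)
Lemma v_power l (j : 'I_p) : v l j = il l ^+ j *: v l (Ordinal p0).
Proof.
case: j => j; elim: j => [|j IH] jp.
  by rewrite expr0 scale1r; congr (v l _); apply: val_inj.
have jp' : (j < p)%N by exact: ltnW.
have := state_blocks l (Ordinal jp'); rewrite /= (ltn_eqF jp) /=.
rewrite (bigD1 (Ordinal jp)) //= eqxx mxtoC_scalar mul1mx big1 => [|i ne]; last first.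
  by rewrite mxtoC_scalar (_ : (i == j.+1 :> nat) = false) ?mul_scalar_mx ?scale0r //; apply/negbTE.
rewrite addr0 (_ : 0%:R%:M = 0) ?addr0; last by rewrite -scalemx1 scale0r.
by move=> <-; rewrite IH scalerA -exprS.
Qed.

(** The autoregressive polynomial P at il. *)
Definition ar_poly (l : R) : 'M[R[i]]_k :=
  (il l ^+ p)%:M + \sum_(j < p) il l ^+ j *: mxtoC (A_ (rev_ord j)).

Lemma last_ltn : (p.-1 < p)%N. Proof. by rewrite prednK. Qed.

(** The last block row, after the blocks have been expressed by the first one. *)
Lemma ar_transfer l : ar_poly l *m transfer A B Cc l = 1%:M.
Proof.
have := state_blocks l (Ordinal last_ltn); rewrite /= prednK // eqxx.
rewrite v_power /= scalerA -exprS prednK // => /eqP; rewrite addrC -subr_eq => /eqP <-.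
rewrite transfer_block mulmxDl mul_scalar_mx; congr (_ + _).
rewrite mulmx_suml -sumrN; apply: eq_bigr => j _.
rewrite [in RHS]v_power -scalemxAl -scalemxAr -scalerN; congr (_ *: _).
by rewrite (_ : mxtoC (- _) = - mxtoC (A_ (rev_ord j))) ?mulNmx ?opprK //; apply/matrixP => a b; rewrite !mxE rmorphN.
Qed.

Let x (l : R) : R[i] := `|l%:C%C|.
Let w (l : R) : R[i] := 1 + x l ^+ p.

Lemma norm_il l : `|il l| = x l.
Proof. by rewrite /il normrM (_ : `|'i%C : R[i]| = 1) ?mul1r // normc_def /= expr0n expr1n add0r sqrtr1. Qed.

Lemma w_gt0 l : 0 < w l.
Proof. by rewrite /w ltr_pwDl // exprn_ge0 // normr_ge0. Qed.

(** The first block is bounded, and the last one is (il)^(p - 1) times it and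
   still of order 1 / (1 + |l|). *)
Lemma transfer_bound : exists2 K : R[i], 0 < K & forall l i j,
  `|transfer A B Cc l i j| <= K / w l.
Proof.
have [K K0 hK] := resolvent_bound B stab.
exists (1 + K%:C%C *+ 2); first by rewrite ltr_pwDl // mulrn_wge0 // ler0c.
move=> l i j; rewrite ler_pdivlMr ?w_gt0 //.
have x0 : 0 <= x l by exact: normr_ge0.
have vb (m : 'I_p) : `|v l m i j| * (1 + x l) <= K%:C%C by rewrite mxE hK.
have h0 : `|transfer A B Cc l i j| <= K%:C%C.
  by rewrite transfer_block (le_trans _ (vb (Ordinal p0))) // ler_peMr // lerDl.
have h1 : `|transfer A B Cc l i j| * x l ^+ p <= K%:C%C.
  have := vb (Ordinal last_ltn); rewrite (v_power l (Ordinal last_ltn)) -transfer_block scalemxE normrM normrX norm_il /=.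
  apply: le_trans; have -> : x l ^+ p = x l ^+ p.-1 * x l by rewrite -exprSr prednK.
  rewrite mulrCA mulrA ler_wpM2l //.
    by rewrite mulr_ge0 // exprn_ge0.
  by rewrite lerDr.
rewrite /w mulrDr mulr1 (le_trans (lerD h0 h1)) // -mulr2n lerDr //.
Qed.

Lemma ar_poly_bound : exists2 K : R[i], 0 < K & forall l i j, `|ar_poly l i j| <= K * w l.
Proof.
have H m : exists K : R[i], 0 < K /\ forall i j, `|mxtoC (A_ (rev_ord m)) i j| <= K.
  by have [K K0 hK] := mx_entry_bound (mxtoC (A_ (rev_ord m))); exists K.
have [K hK] := choice H.
exists (1 + \sum_m K m).
  by rewrite ltr_pwDl // sumr_ge0 // => m _; case: (hK m) => /ltW.
move=> l i j; rewrite /ar_poly mxE mulrDl mul1r.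
have x0 : 0 <= x l by exact: normr_ge0.
have xp m : (m <= p)%N -> x l ^+ m <= w l.
  move=> mp; rewrite /w; case: (real_leP (ger0_real x0) (@real1 _)) => x1.
    by rewrite (le_trans (exprn_ile1 _ x0 x1)) // lerDl exprn_ge0.
  by rewrite (le_trans (ler_weXn2l (ltW x1) mp)) // lerDr.
apply: (le_trans (ler_normD _ _)); apply: lerD.
  rewrite mxE normrMn normrX norm_il; case: (i == j); rewrite ?mulr0n ?mulr1n; first exact: xp.
  exact: ltW (w_gt0 l).
rewrite summxE mulr_suml; apply: (le_trans (ler_norm_sum _ _ _)); apply: ler_sum => m _.
rewrite scalemxE normrM normrX norm_il mulrC; apply: ler_pM => //; first by rewrite exprn_ge0.
  by case: (hK m).
by apply: xp; exact: ltnW.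
Qed.

End Companion.

(** * Uniform conditioning of the spectral density *)

Section Conditioning.
Context {R : realType}.

Lemma posdefZ (C : numClosedFieldType) k (c : C) (M : 'M[C]_k) :
  0 < c -> posdefmx M -> posdefmx (c *: M).
Proof.
move=> c0 [hM pM]; split.
  move: hM; rewrite !hermsymmxE => /eqP E; apply/eqP; rewrite -[in RHS]E.
  by apply/matrixP => i j; rewrite !mxE rmorphM /= (conj_Creal (gtr0_real c0)).
by move=> x x0; rewrite -scalemxAr -scalemxAl mxE mulr_gt0 // pM.
Qed.

(** The weight w, which carries the frequency, and the constant c cancel. *)
Lemma bound_ratio (F : fieldType) (c s q K K' w M : F) :
  c != 0 -> q != 0 -> K != 0 -> K' != 0 -> w != 0 -> M != 0 ->
  c * (s / (q * (K' * w) ^+ 2)) / (c * (M * (q * (K / w) ^+ 2))) =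
  s / (q ^+ 2 * K' ^+ 2 * K ^+ 2 * M).
Proof. by move=> c0 q0 K0 K'0 w0 M0; field; rewrite c0 q0 K0 K'0 w0 M0. Qed.

Variables (k p : nat) (A_ : 'I_p -> 'M[R]_k) (Sg : 'M[R]_k).
Hypotheses (k0 : (0 < k)%N) (p0 : (0 < p)%N).
Notation A := (companion_mx A_).
Notation B := (input_mx k p).
Notation Cc := (output_mx k p).
Hypothesis stab : forall z : R[i], eigenvalue (mxtoC A) z -> complex.Re z < 0.
Hypothesis Sgpos : posdefmx (mxtoC Sg).
Notation f := (specdens A B Cc Sg).

Let c : R[i] := ((2 * pi)^-1)%:C%C.
Let c0 : 0 < c.
Proof. by rewrite /c ltcR invr_gt0 mulr_gt0 // pi_gt0. Qed.

Lemma posdef_real_sym : Sg^T = Sg.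
Proof.
case: Sgpos => + _; rewrite hermsymmxE => /eqP E; apply/matrixP => i j.
by have /matrixP/(_ i j) := E; rewrite !mxE => -[].
Qed.

Lemma specdens_factor l : f l = c *: (transfer A B Cc l *m mxtoC Sg *m (transfer A B Cc l)^t*).
Proof. by rewrite spectral_factorization. Qed.

(** The transfer function is invertible, with inverse P (il). *)
Lemma specdens_posdef l : posdefmx (f l).
Proof.
rewrite specdens_factor; apply: (posdefZ c0).
have := @posdef_congr _ _ _ ((transfer A B Cc l)^t*) _ _ Sgpos; rewrite adjK; apply.
move=> x hx.
have HP := mulmx1C (ar_transfer p0 stab l).
have : (transfer A B Cc l *m ar_poly A_ l)^t* *m x = x.
  by rewrite HP adj1 mul1mx.
by rewrite adjM -mulmxA hx mulmx0 => <-.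
Qed.

(** The bounds of [factor_form_bounds] with w = 1 + |l|^p, inserted into
   [coherence_le]. The minimum with 1 / 2 keeps eps below 1. *)
Theorem uniform_coherence : exists eps : R, 0 < eps < 1 /\
  forall (l : R) (a b : {set 'I_k}), [disjoint a & b]%B ->
  loewner_le
    (invmx (sqrtmx (blockmx (f l) a a)) *m blockmx (f l) a b *m invmx (blockmx (f l) b b)
       *m blockmx (f l) b a *m invmx (sqrtmx (blockmx (f l) a a)))
    ((1 - eps)%:C%C%:M).
Proof.
have [K K0 hK] := transfer_bound p0 stab.
have [K' K'0 hK'] := ar_poly_bound A_.
have [s s0 hs] := posdef_lower_bound Sgpos.
have [M M0 hM] := posdef_upper_bound Sgpos.
pose kk : R[i] := (k * k)%:R.
have kk0 : 0 < kk by rewrite ltr0n muln_gt0 k0.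
pose e0 := s / (kk ^+ 2 * K' ^+ 2 * K ^+ 2 * M).
have e00 : 0 < e0 by rewrite divr_gt0 // !mulr_gt0 // exprn_gt0.
have e0E : (complex.Re e0)%:C%C = e0 by apply: RRe_real; exact: gtr0_real.
have re0 : 0 < complex.Re e0 by rewrite -ltcR e0E.
exists (Num.min (complex.Re e0) 2^-1); split.
  rewrite lt_min re0 /= invr_gt0 ltr0n /= gt_min; apply/orP; right.
  by rewrite invf_lt1 // ltr1n.
move=> l a b ab; rewrite rmorphB rmorph1.
pose w := 1 + `|l%:C%C| ^+ p.
have w0 : 0 < w by rewrite /w ltr_pwDl // exprn_ge0.
have bounds := factor_form_bounds (ar_transfer p0 stab l) w0 (ltW K0) K'0 (ltW s0) (ltW M0)
  (hK l) (hK' l) hs hM.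
have form x : (x^t* *m f l *m x) 0 0 =
    c * (x^t* *m (transfer A B Cc l *m mxtoC Sg *m (transfer A B Cc l)^t*) *m x) 0 0.
  by rewrite specdens_factor -scalemxAr -scalemxAl [LHS]mxE.
have Kw0 : 0 < (K' * w) ^+ 2 by apply: exprn_gt0; apply: mulr_gt0.
have Kw1 : 0 < (K / w) ^+ 2 by apply: exprn_gt0; apply: divr_gt0.
have kKw0 : 0 < kk * (K' * w) ^+ 2 by apply: mulr_gt0.
pose m1 := c * (s / (kk * (K' * w) ^+ 2)); pose M1 := c * (M * (kk * (K / w) ^+ 2)).
have m10 : 0 < m1 by apply: mulr_gt0 => //; apply: divr_gt0.
have M10 : 0 < M1 by apply: mulr_gt0 => //; apply: mulr_gt0 => //; apply: mulr_gt0.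
apply: (coherence_le (specdens_posdef l) m10 M10 _ _ _ _ ab).
- rewrite (_ : m1 / M1 = e0); last by apply: bound_ratio; rewrite gt_eqF.
  by rewrite -e0E lecR ge_min lexx.
- by rewrite complex_real.
- move=> x; rewrite form -mulrA (ler_pM2l c0) mulrAC (ler_pdivrMr _ _ kKw0).
  by rewrite [leRHS]mulrC; exact: (bounds x).1.
- by move=> x; rewrite form -mulrA (ler_pM2l c0); exact: (bounds x).2.
Qed.

End Conditioning.

(** * Second-order structure of the output process *)

Section StateCovariance.
Context {R : realType} {d : measure_display} {T : measurableType d}.
Variable P : probability T R.
Notation leb := (@lebesgue_measure R).
Notation Hl := (`[0%R, +oo[%classic : set R).

Lemma expectation_centered (X : T -> R) : sqint P X -> \int[P]_w X w = 0 -> ('E_P[X] = 0)%E.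
Proof.
move=> hX h0; rewrite expectation_rint; have hi := sqint_rinteg hX.
transitivity (\int[P]_w X w)%:E; last by rewrite h0.
by rewrite /Rintegral fineK //; exact: (integrable_fin_num measurableT hi).
Qed.

Lemma covariance_centered (X Y : T -> R) : sqint P X -> sqint P Y ->
  \int[P]_w X w = 0 -> \int[P]_w Y w = 0 -> fine (covariance P X Y) = ip P X Y.
Proof.
move=> hX hY X0 Y0; rewrite covariance.unlock (expectation_centered hX X0) (expectation_centered hY Y0).
rewrite expectation_rint.
by rewrite /ip; congr fine; apply: eq_integral => w _; rewrite fctE /= !subr0.
Qed.

Variables (k n : nat) (A : 'M[R]_n) (B : 'M[R]_(n, k)) (M : 'M[R]_(k, n)).
Variables (L Y : R -> T -> 'cV[R]_k) (X : R -> T -> 'cV[R]_n).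
Hypothesis hL : driving_levy P L.
Hypothesis stab : forall z : R[i], eigenvalue (mxtoC A) z -> complex.Re z < 0.
Hypothesis Xrv : forall t, random_vector (X t).
Hypothesis Xint : forall t, levy_integral P L
  (fun u => if u <= t then expmx ((t - u) *: A) *m B else 0) (X t).
Hypothesis YX : forall t w, Y t w = M *m X t w.
Notation Sg := (levy_cov P L).
Notation Phi := (expt A).
Notation Ga := (gramian A (B *m Sg *m B^T)).

Definition kern (t : R) (r : 'I_n) (q : 'I_k) (u : R) : R :=
  (u <= t)%R%:R * (Phi (t - u) *m B) r q.

Let PhiB_mdec : decaying_mx (fun s => Phi s *m B).
Proof. by apply: mdecMr; exact: expt_mdec. Qed.

Lemma kernE t r q u : (if u <= t then expmx ((t - u) *: A) *m B else 0) r q = kern t r q u.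
Proof. by rewrite /kern; case: ifP => _; rewrite ?mul1r ?mul0r // mxE. Qed.

Lemma state_wiener t r : is_wiener P L (kern t r) (fun w => X t w r 0).
Proof.
have -> : kern t r = fun q u => (if u <= t then expmx ((t - u) *: A) *m B else 0) r q.
  by apply/funext => q; apply/funext => u; rewrite kernE.
apply: levy_integral_wiener => // r' q.
rewrite (_ : (fun u => _) = kern t r' q); last by apply/funext => u; rewrite kernE.
apply: measurable_funM.
  rewrite (_ : (fun u => _) = \1_(`]-oo, t]%classic : set R)).
    by apply: measurable_indic; exact: measurable_itv.
  by apply/funext => u; rewrite indicE mem_setE in_itv.
apply: continuous_measurable_fun => u.
have [cf _] := PhiB_mdec r' q.
apply: (@continuous_comp _ _ _ (fun u : R => t - u) (fun s => (Phi s *m B) r' q) u); last exact: cf.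
by apply: cvgB; [exact: cvg_cst|exact: cvg_id].
Qed.

Lemma kern_future t r q u : t < u -> kern t r q u = 0.
Proof. by move=> tu; rewrite /kern leNgt tu mul0r. Qed.

(** Substitute u = t - s. *)
Lemma kern_ip t h r q r' q' : 0 <= h -> ip leb (kern (t + h) r q) (kern t r' q') =
  half_int (fun s => (Phi (h + s) *m B) r q * (Phi s *m B) r' q').
Proof.
move=> h0; have [s1 _ _] := state_wiener (t + h) r; have [s2 _ _] := state_wiener t r'.
have := Rintegral_affine t (_ : -1 != 0) (sqint_mul (s1 q) (s2 q')).
rewrite oppr_eq0 oner_neq0 normrN1 mul1r /ip => /(_ isT) <-.
rewrite /half_int [RHS]Rintegral_mkcond; apply: eq_Rintegral => s _.
rewrite /kern patchE mem_setE in_itv /= andbT mulN1r.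
rewrite [- s + t]addrC gerBl lerD2l.
rewrite (_ : t + h - (t - s) = h + s); last by ring.
rewrite (_ : t - (t - s) = s); last by ring.
case: (leP 0 s) => s0; last by rewrite !mul0r mulr0.
by rewrite (le_trans _ h0) ?oppr_le0 // !mul1r.
Qed.

(** By the isometry and the semigroup law, the integral of
   Phi (h + s) B Sg B^T Phi (s)^T. *)
Lemma state_cov t h r r' : 0 <= h ->
  ip P (fun w => X (t + h) w r 0) (fun w => X t w r' 0) = (Phi h *m Ga) r r'.
Proof.
move=> h0; rewrite (wiener_isometry hL (state_wiener (t + h) r) (state_wiener t r')).
have hd q : decaying (fun s => (Phi (h + s) *m B) r q).
  have := mdecMl (Phi h) PhiB_mdec r q.
  by congr decaying; apply/funext => s; rewrite exptD mulmxA.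
have hd2 q q' := decayingM (hd q) (PhiB_mdec r' q').
rewrite /gramian -half_intmMl; last exact: gramian_mdec.
rewrite mxE; under eq_bigr do under eq_bigr do rewrite kern_ip //.
transitivity (half_int (fun s => \sum_q \sum_q' Sg q q' * ((Phi (h + s) *m B) r q * (Phi s *m B) r' q'))).
  rewrite half_int_sum.
    apply: eq_bigr => q _; rewrite half_int_sum.
      by apply: eq_bigr => q' _; rewrite (half_intZ _ (hd2 q q')).
    by move=> q'; apply: decayingZ; exact: hd2.
  by move=> q; apply: decaying_sum => q'; apply: decayingZ; exact: hd2.
congr half_int; apply/funext => s.
have -> : Phi h *m (Phi s *m (B *m Sg *m B^T) *m (Phi s)^T) =
   (Phi (h + s) *m B) *m Sg *m (Phi s *m B)^T.
  by rewrite exptD trmx_mul !mulmxA.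
rewrite mxE exchange_big /=; apply: eq_bigr => q' _.
rewrite [(_ *m Sg) _ _]mxE [(_^T) _ _]mxE mulr_suml; apply: eq_bigr => q _; ring.
Qed.

Let Xsq t r : sqint P (fun w => X t w r 0).
Proof. by case: (state_wiener t r). Qed.

Let YE t a : (fun w => Y t w a 0) = (fun w => \sum_r M a r * X t w r 0).
Proof. by apply/funext => w; rewrite YX mxE. Qed.

Lemma output_sqint t a : sqint P (fun w => Y t w a 0).
Proof. by rewrite YE; apply: sqint_sum => r; exact: sqintZ. Qed.

Lemma output_mean t a : \int[P]_w Y t w a 0 = 0.
Proof.
under eq_Rintegral do rewrite YX mxE.
rewrite rint_sum; last by move=> r; apply: rintegZ; exact: sqint_rinteg.
rewrite big1 // => r _; rewrite rintZ; last exact: sqint_rinteg.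
by rewrite (wiener_mean hL (state_wiener t r)) mulr0.
Qed.

Lemma output_cov_ge0 t h a b : 0 <= h ->
  ip P (fun w => Y (t + h) w a 0) (fun w => Y t w b 0) = acov A B M Sg h a b.
Proof.
move=> h0; rewrite !YE ip_sum2 //; try by move=> r; exact: Xsq.
under eq_bigr do under eq_bigr do rewrite state_cov //.
rewrite /acov -(mulmxA M) [RHS]mxE exchange_big /=; apply: eq_bigr => r' _.
rewrite [(M *m _) _ _]mxE mulr_suml [M^T _ _]mxE; apply: eq_bigr => r _; ring.
Qed.

Lemma output_cov t h a b :
  ip P (fun w => Y (t + h) w a 0) (fun w => Y t w b 0) = acovf A B M Sg a b h.
Proof.
rewrite /acovf /glue; case: (leP 0 h) => h0; first exact: output_cov_ge0.
have h1 : 0 <= - h by rewrite oppr_ge0 ltW.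
by rewrite ipC; have := output_cov_ge0 (t + h) b a h1; rewrite addrK.
Qed.

Theorem output_spectral_density : Sg^T = Sg -> spectral_density P Y (specdens A B M Sg).
Proof.
move=> SgT.
have iRe := specRe_integrable B M stab SgT; have iIm := specIm_integrable B M stab SgT.
split.
- by move=> t; apply: random_vectorP => i; case: (output_sqint t i).
- move=> t.
  have := rinteg_sum (fun i => (output_sqint t i).2).
  have -> : (fun w => \sum_i Y t w i 0 ^+ 2) = (fun w => frobsq (Y t w)).
    by apply/funext => w; rewrite frobsq_cV.
  move=> /rintegP[_]; apply: le_lt_trans; rewrite le_eqVlt; apply/orP; left; apply/eqP.
  apply: eq_integral => w _; rewrite ger0_norm // frobsq_cV sumr_ge0 // => i _; exact: sqr_ge0.
- by move=> t a; rewrite !expectation_centered ?output_mean //; exact: output_sqint.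
- move=> a b; split.
    have := rintegZ ((2 * pi)^-1) (iRe a b); congr (_.-integrable _ _).
    by apply/funext => l; rewrite /= specdensE.
  have := rintegZ ((2 * pi)^-1) (iIm a b); congr (_.-integrable _ _).
  by apply/funext => l; rewrite /= specdensE.
- move=> a b t h; rewrite covariance_centered ?output_mean //; try exact: output_sqint.
  by rewrite output_cov; exact: specdens_cov.
Qed.

Theorem output_remote_past : purely_nondeterministic P Y.
Proof.
apply: (remote_past_trivial hL _ YX) => u r.
by exists (kern u r); [exact: state_wiener|move=> q x; exact: kern_future].
Qed.

End StateCovariance.

Local Close Scope classical_set_scope.
Local Close Scope sesquilinear_scope.
Local Open Scope complex_scope.

Theorem proposition6p5 (R : realType) (d : measure_display)
    (T : measurableType d) (P : probability T R) (k p : nat)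
    (hk : (0 < k)%N) (hp : (0 < p)%N)
    (A_ : 'I_p -> 'M[R]_k) (L Y : R -> T -> 'cV[R]_k)
    (hY : causal_MCAR P A_ L Y) (hSigma : posdefmx (mxtoC (levy_cov P L))) :
  (exists f : R -> 'M[R[i]]_k,
    [/\ spectral_density P Y f,
        forall lam : R, posdefmx (f lam) &
        exists eps : R, 0 < eps < 1 /\
          {ae (@lebesgue_measure R), forall lam : R, forall A B : {set 'I_k},
            [disjoint A & B] ->
            let fAA := blockmx (f lam) A A in
            let fAB := blockmx (f lam) A B in
            let fBA := blockmx (f lam) B A in
            let fBB := blockmx (f lam) B B in
            loewner_le
              (invmx (sqrtmx fAA) *m fAB *m invmx fBB *m fBA
                 *m invmx (sqrtmx fAA))
              ((1 - eps)%:C%:M)}])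
  /\ purely_nondeterministic P Y.
Proof.
case: hY => hL stab [X hX YX].
have Sg_sym := posdef_real_sym hSigma.
have Xrv := state_rv hX; have Xint := state_integral hX.
split; last exact: (output_remote_past hL stab Xrv Xint YX).
exists (specdens (companion_mx A_) (input_mx k p) (output_mx k p) (levy_cov P L)); split.
- exact: (output_spectral_density hL stab Xrv Xint YX Sg_sym).
- by move=> lam; exact: specdens_posdef.
- have [eps [eps01 H]] := uniform_coherence hk hp stab hSigma.
  by exists eps; split => //; apply: aeW => lam A B AB; exact: H.
Qed.
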